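(* Let $X_1,X_2$ be completely regular spaces and let $H:\mathfrak C[X_1]\times\mathfrak C[X_2]\to[0,+\infty]$ be a proper, radially $1$-homogeneous and lower semicontinuous function. (1) For every $(\mu_1,\mu_2)\in\mathcal M_+(X_1)\times\mathcal M_+(X_2)$ such that $\mathcal U_H(\mu_1,\mu_2)<+\infty$ there exists $\alpha\in\mathfrak H^1(\mu_1,\mu_2)$ such that $$\mathcal U_H(\mu_1,\mu_2)=\int_{\mathfrak C[X_1]\times\mathfrak C[X_2]}H\,d\alpha .$$ (2) $\mathcal U_H$ is a lower semicontinuous convex function and satisfies $$\mathcal U_H(r_1\delta_{x_1},r_2\delta_{x_2})=\overline{\mathrm{co}}(H)([x_1,r_1],[x_2,r_2])\le H([x_1,r_1],[x_2,r_2])$$ for every $(x_1,x_2)\in X_1\times X_2$ and every $(r_1,r_2)\in[0,+\infty)^2$. If, in addition, $H$ is radially convex, then $\mathcal U_H(r_1\delta_{x_1},r_2\delta_{x_2})=H([x_1,r_1],[x_2,r_2])$ for every $(x_1,x_2)\in X_1\times X_2$ and every $(r_1,r_2)\in[0,+\infty)^2$. (3) $\mathcal U_H$ is the convex lower semicontinuous envelope of $\mathcal S_H$ (the largest convex and lower semicontinuous function on $\mathcal M(X_1)\times\mathcal M(X_2)$ dominated by $\mathcal S_H$) and for every $(\mu_1,\mu_2)\in\mathcal M_+(X_1)\times\mathcal M_+(X_2)$ $$\mathcal U_H(\mu_1,\mu_2)=\mathcal U_{\overline{\mathrm{co}}(H)}(\mu_1,\mu_2)=\overline{\mathrm{co}}(\mathcal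 S_H)(\mu_1,\mu_2)=\sup\Big\{\int_{X_1}\varphi_1\,d\mu_1+\int_{X_2}\varphi_2\,d\mu_2:\ (\varphi_1,\varphi_2)\in\Phi_H\Big\},$$ where $\overline{\mathrm{co}}(\mathcal S_H)$ denotes the convex lower semicontinuous envelope of $\mathcal S_H$.
   Context: Completely regular spaces are assumed Hausdorff. For such a space $X$, $\mathcal M(X)$ is the vector space of finite signed Radon measures on $X$, $\mathcal M_+(X)$ the cone of nonnegative ones, $C_b(X)$ the bounded continuous real functions; $\mathcal M(X)$ carries the weak topology, the coarsest one making $\mu\mapsto\int\varphi\,d\mu$ continuous for all $\varphi\in C_b(X)$, and $\mathcal M(X_1)\times\mathcal M(X_2)$ carries the product topology. Cone: $\mathfrak C[X]=(X\times[0,+\infty))/\sim$, where $(x,r)\sim(y,s)$ iff ($x=y$ and $r=s\neq0$) or $r=s=0$. The class of $(x,r)$ is $[x,r]$ and $\mathfrak o=[x,0]$ is the vertex. Topology: a neighbourhood base at $[x,r]$ with $r>0$ is given by the images of the neighbourhoods of $(x,r)$ in the product topology; a neighbourhood base at $\mathfrak o$ is given by the sets $\{[x,r]:0\le r<\varepsilon\}$, $\varepsilon>0$. $\mathfrak C[X_1]\times\mathfrak C[X_2]$ has the product topology. For $H:\mathfrak C[X_1]\times\mathfrak C[X_2]\to[0,+\infty]$ set $H_{x_1,x_2}(r_1,r_2)=H([x_1,r_1],[x_2,r_2])$ on $[0,+\infty)^2$. $H$ is proper if not identically $+\infty$; radially $1$-homogeneous if $H_{x_1,x_2}(\lambda r_1,\lambda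 r_2)=\lambda H_{x_1,x_2}(r_1,r_2)$ for all $\lambda>0$, $(x_1,x_2)$, $(r_1,r_2)$; radially convex if every $H_{x_1,x_2}$ is convex. $\overline{\mathrm{co}}(H)([x_1,r_1],[x_2,r_2])$ is the value at $(r_1,r_2)$ of the lower semicontinuous convex envelope (largest convex l.s.c. minorant) of $H_{x_1,x_2}$ on $[0,+\infty)^2$. Homogeneous couplings: $\mathfrak H^1(\mu_1,\mu_2)$ is the set of nonnegative finite Radon measures $\alpha$ on $\mathfrak C[X_1]\times\mathfrak C[X_2]$ with $\int(r_1+r_2)\,d\alpha<+\infty$ and $\mu_i(A)=\int_{\{r_i>0,\ x_i\in A\}}r_i\,d\alpha([x_1,r_1],[x_2,r_2])$ for every Borel $A\subset X_i$, $i=1,2$. $\mathcal U_H(\mu_1,\mu_2):=\inf\{\int H\,d\alpha:\alpha\in\mathfrak H^1(\mu_1,\mu_2)\}$ if $(\mu_1,\mu_2)\in\mathcal M_+(X_1)\times\mathcal M_+(X_2)$, and $+\infty$ elsewhere in $\mathcal M(X_1)\times\mathcal M(X_2)$. $\mathcal S_H(\mu_1,\mu_2):=H([x_1,r_1],[x_2,r_2])$ if $\mu_1=r_1\delta_{x_1}$, $\mu_2=r_2\delta_{x_2}$ with $x_i\in X_i$, $r_i\ge0$, and $+\infty$ elsewhere in $\mathcal M(X_1)\times\mathcal M(X_2)$. $\Phi_H$ is the set of $(\varphi_1,\varphi_2)\in C_b(X_1)\times C_b(X_2)$ with $\varphi_1(x_1)r_1+\varphi_2(x_2)r_2\le H([x_1,r_1],[x_2,r_2])$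 for all $x_i\in X_i$, $r_i\ge0$. *)

(* Defs.v *)
From HB Require Import structures.
From mathcomp Require Import all_boot all_order all_algebra.
From mathcomp Require Import interval_inference.
From mathcomp Require Import all_classical all_reals all_analysis.

Set Implicit Arguments.
Unset Strict Implicit.
Unset Printing Implicit Defensive.

Import Order.TTheory GRing.Theory Num.Theory.
Import numFieldNormedType.Exports.

Local Open Scope classical_set_scope.
Local Open Scope quotient_scope.
Local Open Scope ring_scope.

(* Measurable types of the library are pointed, hence so are the spaces; this
   only excludes the empty space, on which no function is proper. *)
HB.mixin Record isCompletelyRegular X & PointedTopological X := {
  hausdorff_subproof : hausdorff_space X ;
  completely_regular_subproof : completely_regular_space X }.

#[short(type="completelyRegularType")]
HB.structure Definition CompletelyRegular :=
  {X of PointedTopological X & isCompletelyRegular X}.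

#[short(type="topConvType")]
HB.structure Definition TopConvexSpace (R : numDomainType) :=
  {T of ConvexSpace R T & Topological T}.

Section convexity.
Context {R : realType}.
Local Open Scope convex_scope.
Local Open Scope ereal_scope.

(* Addition is the dual one, for which -oo + +oo = +oo: this is convexity of the
   epigraph, for functions that may take both infinite values. *)
Definition econvex (T : convType R) (f : T -> \bar R) :=
  forall (t : {i01 R}) (a b : T),
    f (a <| t |> b) <=
      (t%:num%:E * f a + (1 - t%:num)%:E * f b)%dE :> \bar R.

Definition convex_lsc_minorant (T : topConvType R) (f g : T -> \bar R) :=
  [/\ econvex g, lower_semicontinuous g & forall p, g p <= f p].

Definition lsc_convex_envelope (T : topConvType R) (f : T -> \bar R) (p : T) :=
  ereal_sup [set g p | g in [set g | convex_lsc_minorant f g]].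

End convexity.

Section prod_convType.
Context {R : numDomainType} {U V : convType R}.
Local Open Scope convex_scope.

Let pconv (t : {i01 R}) (a b : U * V) := (a.1 <| t |> b.1, a.2 <| t |> b.2).

Let pconv1 a b : pconv 1%:i01 a b = a.
Proof. by rewrite /pconv !conv1 -surjective_pairing. Qed.

Let pconvmm t a : pconv t a a = a.
Proof. by rewrite /pconv !convmm -surjective_pairing. Qed.

Let pconvC t a b : pconv t a b = pconv (1 - t%:inum)%:i01 b a.
Proof. by rewrite /pconv convC; congr pair; exact: convC. Qed.

Let pconvA : convex_quasi_associative pconv.
Proof.
by move=> p q r s a b c prs spq; rewrite /pconv/=; congr pair; exact: convA.
Qed.

HB.instance Definition _ :=
  @isConvexSpace.Build R (U * V)%type _ pconv1 pconvmm pconvC pconvA.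

End prod_convType.

Section nonneg_topConvType.
Context {R : realType}.
Local Open Scope convex_scope.

HB.instance Definition _ :=
  Topological.copy {nonneg R} (initial_topology (fun r : {nonneg R} => r%:num)).

Lemma nonneg_conv_subproof (t : {i01 R}) (a b : {nonneg R}) :
  0 <= t%:num * a%:num + (1 - t%:num) * b%:num.
Proof. by rewrite addr_ge0// mulr_ge0// subr_ge0. Qed.

Let nconv t a b : {nonneg R} := NngNum (nonneg_conv_subproof t a b).

Let nconv1 a b : nconv 1%:i01 a b = a.
Proof. by apply/val_inj; rewrite /= subrr mul1r mul0r addr0. Qed.

Let nconvmm t a : nconv t a a = a.
Proof. by apply/val_inj; rewrite /= -mulrDl addrC subrK mul1r. Qed.

Let nconvC t a b : nconv t a b = nconv (1 - t%:inum)%:i01 b a.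
Proof. by apply/val_inj; rewrite /= subKr addrC. Qed.

Let nconvA : convex_quasi_associative nconv.
Proof.
move=> p q r s a b c prs spq; apply/val_inj => /=.
have := @convA R R^o p q r s a%:num b%:num c%:num prs spq.
by rewrite !convRE.
Qed.

HB.instance Definition _ :=
  @isConvexSpace.Build R {nonneg R} nconv nconv1 nconvmm nconvC nconvA.

End nonneg_topConvType.

HB.instance Definition _ {R : numDomainType} {U V : topConvType R} :=
  ConvexSpace.on (U * V)%type.

Section cone.
Context {R : realType} {X : ptopologicalType}.
Implicit Types (x : X) (r : {nonneg R}).

Definition cone_rel (p q : X * {nonneg R}) : bool :=
  [&& p.1 == q.1, p.2 == q.2 & p.2%:num != 0] ||
  ((p.2%:num == 0) && (q.2%:num == 0)).

Let cone_rel_refl : reflexive cone_rel.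
Proof. by move=> [x r]; rewrite /cone_rel /= !eqxx/=; case: eqP. Qed.

Let cone_rel_sym : symmetric cone_rel.
Proof.
move=> [x r] [y s]; rewrite /cone_rel/= [y == x]eq_sym [s == r]eq_sym.
by rewrite [(s%:num == 0) && _]andbC; case: (r =P s) => [->|]; rewrite ?andbF.
Qed.

Let cone_rel_trans : transitive cone_rel.
Proof.
move=> [y s] [x r] [z u]; rewrite /cone_rel/=.
move=> /orP[/and3P[/eqP -> /eqP -> s0]//|/andP[-> /eqP s0]] /=.
by rewrite s0 eqxx /= => /orP[/and3P[_ /eqP <-]|-> //]; rewrite ?s0 ?eqxx ?orbT.
Qed.

Canonical cone_equiv := EquivRel cone_rel cone_rel_refl cone_rel_sym cone_rel_trans.

Definition cone : Type := {eq_quot cone_equiv}.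
HB.instance Definition _ := Quotient.on cone.
HB.instance Definition _ := Choice.on cone.

Definition cpt x r : cone := \pi_cone (x, r).

(* [base c] is arbitrary when [c] is the vertex. *)
Definition base (c : cone) : X := (repr c).1.
Definition rad (c : cone) : {nonneg R} := (repr c).2.

HB.instance Definition _ := isPointed.Build cone (cpt point 0%:nng).

Lemma cpt_eqP p q : reflect
  ((p = q /\ p.2%:num != 0) \/ (p.2%:num = 0 /\ q.2%:num = 0))
  (cpt p.1 p.2 == cpt q.1 q.2).
Proof.
case: p q => [x r] [y s]; rewrite /cpt/= eqmodE/= /cone_rel/=.
apply: (iffP orP) => [[/and3P[/eqP-> /eqP-> ?]|/andP[/eqP-> /eqP->]]|].
- by left.
- by right.
- by move=> [[[-> ->] s0]|[-> ->]]; [left|right]; rewrite !eqxx.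
Qed.

Lemma cptK c : cpt (base c) (rad c) = c.
Proof. by rewrite /cpt /base /rad -surjective_pairing reprK. Qed.

Lemma rad_cpt x r : rad (cpt x r) = r.
Proof.
have /eqP/(cpt_eqP (base (cpt x r), rad (cpt x r)) (x, r)) := cptK (cpt x r).
by move=> [[[_ ->]]//|[/= r0 s0]]; apply/val_inj; rewrite /= r0 s0.
Qed.

Lemma repr_cpt x r : r%:num != 0 -> repr (cpt x r) = (x, r).
Proof.
move=> r0.
have /eqP/(cpt_eqP (base (cpt x r), rad (cpt x r)) (x, r)) := cptK (cpt x r).
by rewrite /= -surjective_pairing => -[[]//|[_ /eqP]]; rewrite (negbTE r0).
Qed.

Lemma base_cpt x r : r%:num != 0 -> base (cpt x r) = x.
Proof. by move=> r0; rewrite /base repr_cpt. Qed.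

(* Off the vertex, the images under [\pi_cone] of the neighborhoods of
   [(base c, rad c)] form a neighborhood base. *)
Definition cone_nbhs (c : cone) : set_system cone :=
  if (rad c)%:num == 0 then
    filter_from [set e : R | 0 < e] (fun e => [set d : cone | (rad d)%:num < e])
  else [set A | nbhs (repr c) (\pi_cone @^-1` A)].

HB.instance Definition _ := hasNbhs.Build cone cone_nbhs.

Let nbhs_vertexP (c : cone) (A : set cone) : (rad c)%:num == 0 -> cone_nbhs c A <->
  exists2 e : R, 0 < e & forall d, (rad d)%:num < e -> A d.
Proof. by rewrite /cone_nbhs => ->. Qed.

Let nbhs_posE (c : cone) (A : set cone) : (rad c)%:num != 0 ->
  cone_nbhs c A = nbhs (repr c) (\pi_cone @^-1` A).
Proof. by rewrite /cone_nbhs => /negbTE ->. Qed.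

Let continuous_num : continuous (fun r => r%:num).
Proof. exact: initial_continuous. Qed.

Let near_rad (p : X * {nonneg R}) (U : set R) : nbhs p.2%:num U ->
  nbhs p [set q | U q.2%:num].
Proof.
move=> pU; exists (setT, [set r : {nonneg R} | U r%:num]) => /=.
  by split; [exact: filterT|exact: continuous_num].
by move=> [x r] [].
Qed.

Let cone_nbhs_filter c : ProperFilter (cone_nbhs c).
Proof.
have [c0|c0] := boolP ((rad c)%:num == 0); rewrite /cone_nbhs ?c0 ?(negbTE c0).
  apply: filter_from_proper; last first.
    by move=> e e0; exists c; rewrite /= (eqP c0).
  apply: filter_from_filter; first by exists 1 => /=.
  move=> e1 e2 /= e10 e20; exists (Num.min e1 e2); first by rewrite /= lt_min e10.
  by move=> d /=; rewrite lt_min => /andP[].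
apply: Build_ProperFilter_ex.
  by move=> A /nbhs_singleton /= Ac; exists (\pi_cone (repr c)).
Qed.

Let cone_nbhs_singleton c (A : set cone) : cone_nbhs c A -> A c.
Proof.
have [c0|c0] := boolP ((rad c)%:num == 0).
  by move/nbhs_vertexP => /(_ c0)[e e0]; apply; rewrite (eqP c0).
by rewrite nbhs_posE// => /nbhs_singleton/=; rewrite reprK.
Qed.

Let cone_nbhs_nbhs c (A : set cone) :
  cone_nbhs c A -> cone_nbhs c (cone_nbhs^~ A).
Proof.
have [c0|c0] := boolP ((rad c)%:num == 0).
  move/nbhs_vertexP => /(_ c0)[e e0 eA]; apply/nbhs_vertexP => //.
  exists e => // d de.
  have [d0|d0] := boolP ((rad d)%:num == 0); first by apply/nbhs_vertexP => //; exists e.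
  rewrite nbhs_posE//; have := @near_rad (repr d) _ (lt_nbhsl de).
  by apply: filterS => -[x r] /= re; apply: eA; rewrite -[\pi_cone _]/(cpt x r) rad_cpt.
rewrite !nbhs_posE// => /nbhs_interior.
have cpos : 0 < (repr c).2%:num by rewrite lt_neqAle eq_sym c0 ge0.
move/(filterI (@near_rad (repr c) _ (lt_nbhsr cpos))).
apply: filterS => -[x r]/= [r0 xrA].
rewrite -[\pi_cone _]/(cpt x r) nbhs_posE ?rad_cpt ?gt_eqF//.
by rewrite repr_cpt// gt_eqF.
Qed.

HB.instance Definition _ := Nbhs_isNbhsTopological.Build cone
  cone_nbhs_filter cone_nbhs_singleton cone_nbhs_nbhs.

Lemma nbhs_vertexE x (A : set cone) : nbhs (cpt x 0%:nng) A <->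
  exists2 e : R, 0 < e & [set cpt p.1 p.2 | p in [set p | p.2%:num < e]] `<=` A.
Proof.
rewrite /nbhs/= /cone_nbhs rad_cpt eqxx; split => -[e e0 eA]; exists e => //.
  by move=> _ [p pe <-]; apply: eA; rewrite /= rad_cpt.
by move=> c /= ce; rewrite -(cptK c); apply: eA; exists (base c, rad c).
Qed.

Lemma nbhs_cptE x r (A : set cone) : r%:num != 0 -> nbhs (cpt x r) A <->
  exists2 N, nbhs (x, r) N & [set cpt p.1 p.2 | p in N] `<=` A.
Proof.
move=> r0; rewrite /nbhs/= /cone_nbhs rad_cpt (negbTE r0) repr_cpt//; split.
  move=> xrA; exists (\pi_cone @^-1` A) => // _ [[y s] /= + <-]; exact.
by case=> N xN NA; apply: filterS xN => -[y s] ?; apply: NA; exists (y, s).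
Qed.

End cone.
Arguments cone : clear implicits.

HB.instance Definition _ {U V : ptopologicalType} := Pointed.on (U * V)%type.

Notation borel X := (g_sigma_algebraType (@open X)).

Section radon.
Context {R : realType}.
Local Open Scope ereal_scope.

Definition radon (X : ptopologicalType) (mu : set (borel X) -> \bar R) :=
  forall (A : set (borel X)) (e : R), measurable A -> (0 < e)%R ->
    exists K : set X, [/\ compact K, K `<=` A & mu (A `\` K) <= e%:E].

Section hahn.
Context d (T : measurableType d) (nu : {charge set T -> \bar R}).

(* Hahn decompositions are not unique, but on measurable sets the Jordan
   decomposition does not depend on the choice. *)
Definition hahn_set := sval (cid (Hahn_decomposition nu)).
Definition hahn_setC := sval (cid (svalP (cid (Hahn_decomposition nu)))).

Lemma hahnP : hahn_decomposition nu hahn_set hahn_setC.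
Proof. exact: (svalP (cid (svalP (cid (Hahn_decomposition nu))))). Qed.

Definition total_variation : {measure set T -> \bar R} := charge_variation hahnP.

Definition charge_integral (f : T -> R) : R :=
  (\int[jordan_pos hahnP]_x f x - \int[jordan_neg hahnP]_x f x)%R.
End hahn.

Context (X : completelyRegularType).

(* Charges of the library are arbitrary off the measurable sets; the value 0
   there makes Leibniz equality the equality of measures. *)
Record sradon := SRadon {
  sradon_charge :> {charge set (borel X) -> \bar R} ;
  sradonP : radon (total_variation sradon_charge) ;
  sradon_nmeasurable : forall A, ~ measurable A -> sradon_charge A = 0 }.

HB.instance Definition _ := gen_eqMixin sradon.
HB.instance Definition _ := gen_choiceMixin sradon.

Lemma eq_charge d (T : measurableType d) (m n : {charge set T -> \bar R}) :
  (m = n :> (set T -> \bar R)) -> m = n.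
Proof.
move: m n => [m [[m1] [m2] [m3]]] [n [[n1] [n2] [n3]]] /= mn.
rewrite -mn in n1 n2 n3 *.
by rewrite (Prop_irrelevance m1 n1) (Prop_irrelevance m2 n2) (Prop_irrelevance m3 n3).
Qed.

Lemma eq_sradon (m n : sradon) : (forall A, measurable A -> m A = n A) -> m = n.
Proof.
move: m n => [m m1 m2] [n n1 n2] /= mn.
have {}mn : m = n.
  apply: eq_charge; apply/funext => A.
  by have [|mA] := pselect (measurable A); [exact: mn|rewrite m2// n2].
subst n; by rewrite (Prop_irrelevance m1 n1) (Prop_irrelevance m2 n2).
Qed.

Lemma compact_borel (K : set X) : compact K -> measurable (K : set (borel X)).
Proof.
move=> cK; rewrite -[K]setCK; apply: measurableC; apply: sub_sigma_algebra.
by apply: closed_openC; apply: compact_closed => //; exact: hausdorff_subproof.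
Qed.

Lemma total_variation_le (nu : {charge set (borel X) -> \bar R}) (m : {measure set (borel X) -> \bar R}) :
  (forall A, measurable A -> `|nu A| <= m A) ->
  forall A, measurable A -> total_variation nu A <= m A.
Proof.
move=> num A mA; have [[mP Pp] [mN Nn] PN1 PN0] := hahnP nu.
have -> : total_variation nu A = `|nu (A `&` hahn_set nu)| + `|nu (A `&` hahn_setC nu)|.
  rewrite /total_variation /= /charge_variation jordan_posE cjordan_posE jordan_negE cjordan_negE.
  rewrite /crestr0 mem_set// /crestr gee0_abs ?Pp//; last exact: measurableI.
  by rewrite lee0_abs// Nn//; exact: measurableI.
have -> : m A = m (A `&` hahn_set nu) + m (A `&` hahn_setC nu).
  rewrite -measureU//; [|exact: measurableI|exact: measurableI|].
    by rewrite -setIUr PN1 setIT.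
  by rewrite setIACA PN0 setI0.
by apply: leeD; apply: num; exact: measurableI.
Qed.

Lemma total_variation_abs (nu : {charge set (borel X) -> \bar R}) A : measurable A ->
   `|nu A| <= total_variation nu A.
Proof. exact: abse_charge_variation. Qed.

Lemma radon_le (nu : {charge set (borel X) -> \bar R}) (m : {measure set (borel X) -> \bar R}) :
  (forall A, measurable A -> `|nu A| <= m A) -> radon m -> radon (total_variation nu).
Proof.
move=> num rm A e mA e0; have [K [cK KA mK]] := rm A e mA e0.
exists K; split => //; apply: le_trans mK; apply: total_variation_le => //.
by apply: measurableD => //; exact: compact_borel.
Qed.

Lemma radonD (m1 m2 : {measure set (borel X) -> \bar R}) :
  radon m1 -> radon m2 -> radon (measure_add m1 m2).
Proof.
move=> r1 r2 A e mA e0; have e20 : (0 < e / 2)%R by rewrite divr_gt0.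
have [K [cK KA mK]] := r1 A _ mA e20; have [L [cL LA mL]] := r2 A _ mA e20.
exists (K `|` L); split; first exact: compactU.
  by move=> x [/KA|/LA].
have [mbK mbL] := (compact_borel cK, compact_borel cL).
rewrite [leLHS](measure_addE m1 m2) (splitr e) EFinD; apply: leeD.
- apply: le_trans mK; rewrite le_measure ?inE//.
  + by apply: measurableD => //; exact: measurableU.
  + exact: measurableD.
  + by move=> x [Ax KLx]; split => // Kx; apply: KLx; left.
- apply: le_trans mL; rewrite le_measure ?inE//.
  + by apply: measurableD => //; exact: measurableU.
  + exact: measurableD.
  + by move=> x [Ax KLx]; split => // Kx; apply: KLx; right.
Qed.

Lemma radonZ (r : {nonneg R}) (m : {measure set (borel X) -> \bar R}) :
  radon m -> radon (mscale r m).
Proof.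
move=> rm A e mA e0; have r10 : (0 < r%:num + 1)%R by rewrite ltr_wpDl.
have [K [cK KA mK]] := rm A (e / (r%:num + 1))%R mA (divr_gt0 e0 r10).
exists K; split => //; rewrite /mscale/=.
apply: le_trans (lee_wpmul2l _ mK) _; first by rewrite lee_fin.
rewrite -EFinM lee_fin mulrCA ger_pMr// ler_pdivrMr// mul1r lerDl//.
Qed.

Let sradon0_radon : radon (total_variation (czero : {charge set (borel X) -> \bar R})).
Proof.
apply: (@radon_le _ mzero) => [A mA|A e mA e0]; first by rewrite abse0.
by exists set0; split; [exact: compact0|exact: sub0set|rewrite lee_fin ltW].
Qed.

Definition sradon0 := SRadon sradon0_radon (fun _ _ => erefl).

Let sradonD_radon (m n : sradon) : radon (total_variation (cadd m n)).
Proof.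
apply: (@radon_le _ (measure_add (total_variation m) (total_variation n))).
  move=> A mA; rewrite [leRHS](measure_addE (total_variation m)).
  apply: (le_trans (lee_abs_add _ _)).
  by apply: leeD; exact: total_variation_abs.
by apply: radonD; exact: sradonP.
Qed.

Let sradonD_nm (m n : sradon) A : ~ measurable A -> cadd m n A = 0.
Proof. by move=> mA; rewrite /cadd !sradon_nmeasurable// adde0. Qed.

Definition sradonD m n := SRadon (@sradonD_radon m n) (@sradonD_nm m n).

Let sradonZ_radon (r : R) (m : sradon) : radon (total_variation (cscale r m)).
Proof.
pose k : {nonneg R} := NngNum (normr_ge0 r).
apply: (@radon_le (cscale r m) (mscale k (total_variation m))).
  move=> A mA; rewrite /cscale abseM; apply: lee_wpmul2l => //.
  exact: total_variation_abs.
by apply: radonZ; exact: sradonP.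
Qed.

Let sradonZ_nm (r : R) (m : sradon) A : ~ measurable A -> cscale r m A = 0.
Proof. by move=> mA; rewrite /cscale sradon_nmeasurable// mule0. Qed.

Definition sradonZ r m := SRadon (@sradonZ_radon r m) (@sradonZ_nm r m).

Let fin (m : sradon) A : measurable A -> m A \is a fin_num.
Proof. exact: fin_num_measure. Qed.

Let sradonDA : associative sradonD.
Proof. by move=> m n p; apply: eq_sradon => A mA; exact: addeA. Qed.

Let sradonDC : commutative sradonD.
Proof. by move=> m n; apply: eq_sradon => A mA; exact: addeC. Qed.

Let sradon0D : left_id sradon0 sradonD.
Proof. by move=> m; apply: eq_sradon => A mA; exact: add0e. Qed.

Let sradonND : left_inverse sradon0 (sradonZ (-1)) sradonD.
Proof.
move=> m; apply: eq_sradon => A mA /=.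
by rewrite /cadd/= /cscale mulN1e addeC subee// fin.
Qed.

HB.instance Definition _ :=
  GRing.isZmodule.Build sradon sradonDA sradonDC sradon0D sradonND.

Let sradonZA a b m : sradonZ a (sradonZ b m) = sradonZ (a * b)%R m.
Proof. by apply: eq_sradon => A mA; rewrite /= /cscale EFinM muleA. Qed.

Let sradonZ1 : left_id 1%R sradonZ.
Proof. by move=> m; apply: eq_sradon => A mA; exact: mul1e. Qed.

Let sradonZDr : right_distributive sradonZ +%R.
Proof.
by move=> a m n; apply: eq_sradon => A mA; rewrite /= /cscale /cadd muleDr// fin_num_adde_defl// fin.
Qed.

Let sradonZDl m : {morph sradonZ^~ m : a b / (a + b)%R}.
Proof.
by move=> a b; apply: eq_sradon => A mA; rewrite /= /cadd/= /cscale EFinD muleDl// fin.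
Qed.

HB.instance Definition _ := GRing.Zmodule_isLmodule.Build R sradon
  sradonZA sradonZ1 sradonZDr sradonZDl.

Lemma sradonDE (m n : sradon) A : (m + n)%R A = m A + n A. Proof. by []. Qed.
Lemma sradonZE a (m : sradon) A : (a *: m)%R A = a%:E * m A. Proof. by []. Qed.

Definition dirac_charge (x : borel X) : {charge set (borel X) -> \bar R} :=
  crestr0 (charge_of_finite_measure \d_x) measurableT.

Lemma dirac_chargeE x A : measurable A -> dirac_charge x A = \d_x A.
Proof. by move=> mA; rewrite /= /crestr0 mem_set// /crestr setIT. Qed.

Let sdirac_radon x : radon (total_variation (dirac_charge x)).
Proof.
apply: (@radon_le _ \d_x) => [A mA|A e mA e0].
  by rewrite dirac_chargeE// gee0_abs.
have [xA|xA] := pselect (A x).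
  exists [set x]; split; [exact: compact_set1|by move=> _ ->|].
  by rewrite [leLHS]diracE memNset ?lee_fin ?ltW// => -[_]; exact.
exists set0; split; [exact: compact0|exact: sub0set|].
by rewrite setD0 [leLHS]diracE memNset// lee_fin ltW.
Qed.

Let sdirac_nm x A : ~ measurable A -> dirac_charge x A = 0.
Proof. by move=> mA; rewrite /= /crestr0 memNset. Qed.

Definition sdirac x := SRadon (sdirac_radon x) (@sdirac_nm x).

Lemma sdiracE x A : measurable A -> sdirac x A = \d_x A.
Proof. exact: dirac_chargeE. Qed.

End radon.
Arguments sradon : clear implicits.

Record Cb (R : realType) (X : topologicalType) := MkCb {
  Cb_fun :> X -> R ;
  Cb_continuous : continuous Cb_fun ;
  Cb_bounded : [bounded Cb_fun x | x in [set: X]] }.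

Section weak_topology.
Context {R : realType} {X : completelyRegularType}.

HB.instance Definition _ :=
  ConvexSpace.copy (sradon R X) (convex_lmodType (sradon R X)).

(* Coarsest topology making [mu |-> charge_integral mu phi] continuous for all
   [phi : Cb R X]. *)
HB.instance Definition _ := Topological.copy (sradon R X)
  (sup_topology (fun phi : Cb R X => Topological.class
    (initial_topology (fun mu : sradon R X => charge_integral mu phi)))).

End weak_topology.

Section unbalanced.
Context {R : realType} {X1 X2 : completelyRegularType}.
Implicit Types (H : cone R X1 * cone R X2 -> \bar R).
Implicit Types (mu : sradon R X1 * sradon R X2).
Local Open Scope ereal_scope.

Definition radial_section H (x1 : X1) (x2 : X2) :
    {nonneg R} * {nonneg R} -> \bar R :=
  fun r => H (cpt x1 r.1, cpt x2 r.2).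

Definition proper_fun H := exists p, H p != +oo.

Definition radially_1homogeneous H :=
  forall (x1 : X1) (x2 : X2) (l : {posnum R}) (r1 r2 : {nonneg R}),
    radial_section H x1 x2 ((l%:num * r1%:num)%:nng, (l%:num * r2%:num)%:nng)%R =
    l%:num%:E * radial_section H x1 x2 (r1, r2).

Definition radially_convex H := forall x1 x2, econvex (radial_section H x1 x2).

(* At the vertex the base point is arbitrary; for 1-homogeneous lower
   semicontinuous [H] the value does not depend on it. *)
Definition co_cone H : cone R X1 * cone R X2 -> \bar R := fun p =>
  lsc_convex_envelope (radial_section H (base p.1) (base p.2)) (rad p.1, rad p.2).

Definition nonneg_sradon (X : completelyRegularType) (m : sradon R X) :=
  forall A, 0 <= m A.

Definition hcoupling mu :
    set {finite_measure set (borel (cone R X1 * cone R X2)%type) -> \bar R} :=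
  [set alpha |
   [/\ radon alpha,
       \int[alpha]_p ((rad p.1)%:num + (rad p.2)%:num)%:E < +oo,
       forall A, measurable A ->
         mu.1 A = \int[alpha]_(p in
           [set p | (0 < (rad p.1)%:num)%R /\ A (base p.1)]) (rad p.1)%:num%:E &
       forall A, measurable A ->
         mu.2 A = \int[alpha]_(p in
           [set p | (0 < (rad p.2)%:num)%R /\ A (base p.2)]) (rad p.2)%:num%:E]].

Definition calU H mu : \bar R :=
  if `[< nonneg_sradon mu.1 /\ nonneg_sradon mu.2 >] then
    ereal_inf [set \int[alpha]_p H p | alpha in hcoupling mu]
  else +oo.

(* The infimum of a set with at most one element, +oo if it is empty: a
   representation of [mu] is unique up to the base point of a zero mass. *)
Definition calS H mu : \bar R :=
  ereal_inf [set H (cpt q.1.1 q.1.2, cpt q.2.1 q.2.2) |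
    q in [set q : (X1 * {nonneg R}) * (X2 * {nonneg R}) |
      mu = (q.1.2%:num *: sdirac q.1.1, q.2.2%:num *: sdirac q.2.1)%R]].

Definition Phi H : set (Cb R X1 * Cb R X2) :=
  [set phi : Cb R X1 * Cb R X2 | forall x1 x2 (r1 r2 : {nonneg R}),
    (phi.1 x1 * r1%:num + phi.2 x2 * r2%:num)%:E <= H (cpt x1 r1, cpt x2 r2)].

End unbalanced.

(* Main.v *)
From HB Require Import structures.
From mathcomp Require Import all_boot all_order all_algebra.
From mathcomp Require Import interval_inference.
From mathcomp Require Import all_classical all_reals all_analysis.
From mathcomp Require Import measurable_realfun ring lra.
Require Import Defs.

(** The proof rests on the duality between couplings and test pairs: [calU H mu]
    is the supremum of [pairing mu phi] over [phi] in [Phi H] (lemma [calU_dual]).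
    The inequality from below is integration of [cone_sum phi <= H]. For the
    other, an optimal coupling is constructed whenever the supremum [D] is finite
    ([exists_optimal_coupling]).

    By homogeneity, couplings may be sought on the slice where the radii add up
    to 1. For a bounded function [f] on the product of the cones let [q f] be the
    infimum of [pairing mu phi + t * D] over the [phi] and [t >= 0] such that
    [f <= cone_sum phi + t * H] on the slice. The definition of [D] makes [q]
    finite and sublinear, and the Hahn-Banach theorem gives a positive linear
    functional [L <= q] ([functional_of_dual]): it has the right integrals on the
    functions [cone_sum phi] and at most [D] on bounded functions below [H]. It
    need not be countably additive. But [mu] is tight, and a set of points of the
    cones whose base lies in a compact [K n] as soon as the radius exceeds
    [2 ^- n] is compact, because the base point is free at the vertex; hence [L]
    is tight as well ([functional_tight]). A tight finitely additive set function
    has a Radon measure below it on open sets with the same total mass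
    ([radon_of_finitely_additive]). Therefore the integrals of bounded continuous
    functions are those of [L], and the integrals of lower semicontinuous
    functions are at most those of [L] ([radon_of_functional],
    [integral_of_functional]). Thus the measure has marginals [mu]
    ([marginal_of_integrals]) and integrates [H] to at most [D].

    As a supremum of continuous linear functions, [calU H] is convex and lower
    semicontinuous, and it lies below [calS H]. It is the largest such minorant:
    an optimal coupling can be sampled at finitely many points with weights so
    that the cost increases by at most [e] while finitely many weak test
    integrals stay almost the same ([coupling_approximation]). A convex function
    below the 1-homogeneous [calS H] is, at a finite sum of Dirac masses, at most
    the weighted sum of the costs ([econvex_sum_le]), and lower semicontinuity
    passes this on to the limit ([minorant_le_calU]).

    A coupling of [r1 *: sdirac x1] and [r2 *: sdirac x2] lives over the points
    [x1] and [x2], so the same argument applies to the minorants of the section of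
    [H] over these points ([section_minorant_le_calU]), and [calU H] at Dirac
    masses is the envelope of the section. This envelope has the same test pairs
    as [H], whence [calU (co_cone H) = calU H]. *)

Set Implicit Arguments.
Unset Strict Implicit.
Unset Printing Implicit Defensive.

Import Order.TTheory GRing.Theory Num.Theory.
Import numFieldNormedType.Exports.

Local Open Scope classical_set_scope.
Local Open Scope ring_scope.

(** * Extension of linear functionals *)

(** The sublinear function only lives on a subset closed under linear
    combinations, so that it applies to the bounded functions inside all
    functions, without a type of bounded functions. Partial extensions are
    ordered as graphs: relations that are closed under linear combinations and
    lie below [q] are automatically single-valued. *)
Lemma hahn_banach (R : realType) (V : lmodType R) (D : set V) (q : V -> R) :
  D 0 -> (forall a u v, D u -> D v -> D (a *: u + v)) ->
  (forall u v, D u -> D v -> q (u + v) <= q u + q v) ->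
  (forall a u, 0 < a -> D u -> q (a *: u) <= a * q u) ->
  exists L : V -> R,
    (forall a u v, D u -> D v -> L (a *: u + v) = a * L u + L v) /\
    (forall u, D u -> L u <= q u).
Proof.
move=> D0 DL qD qZ.
have DD u v : D u -> D v -> D (u + v) by move=> Du Dv; rewrite -[u]scale1r; exact: DL.
have DZ a u : D u -> D (a *: u) by move=> Du; rewrite -[_ *: _]addr0; exact: DL.
have qZ' a u : 0 < a -> D u -> a * q u <= q (a *: u).
  move=> a0 Du; have := qZ a^-1 (a *: u).
  rewrite scalerA mulVf ?gt_eqF// scale1r invr_gt0 => /(_ a0 (DZ _ _ Du)).
  by rewrite ler_pdivlMl.
have q0_ge0 : 0 <= q 0 by have := qD 0 0 D0 D0; rewrite addr0; lra.
pose P (G : set (V * R)) :=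
  [/\ forall u r, G (u, r) -> D u /\ r <= q u &
      forall a u r v s, G (u, r) -> G (v, s) -> G (a *: u + v, a * r + s)].
have [F FP Ftot|G [[Gq GL] Gmax]] := @Zorn_bigcup _ P.
  split=> [u r [G FG]|a u r v s [G FG Gur] [G' FG' Gvs]].
    by have [+ _] := FP _ FG; exact.
  have [GG'|G'G] := Ftot _ _ FG FG'.
    by exists G' => //; have [_] := FP _ FG'; apply => //; exact: GG'.
  by exists G => //; have [_] := FP _ FG; apply => //; exact: G'G.
have G0 : G (0, 0).
  apply: contrapT => G0.
  have [[[u r] Gur]|] := pselect (exists p, G p).
    by apply: G0; have := GL (-1) _ _ _ _ Gur Gur; rewrite scaleN1r mulN1r !addNr.
  move=> /forallNP G_empty; apply: (Gmax [set (0, 0)]); last first.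
    split=> [u r [-> ->]//|a u r v s [-> ->] [-> ->]].
    by rewrite scaler0 mulr0 !addr0.
  split; first by move=> p /G_empty.
  by move=> h; apply: G0; exact: h.
have GD u r v s : G (u, r) -> G (v, s) -> G (u + v, r + s).
  by move=> ? ?; rewrite -[u]scale1r -[r]mul1r; exact: GL.
have GZ a u r : G (u, r) -> G (a *: u, a * r).
  by move=> ?; rewrite -[_ *: _]addr0 -[_ * _]addr0; exact: GL.
(* If [G] had two values at one point, it would contain a ray over 0, on which
   the values would exceed [q 0]. *)
have Guniq u r s : G (u, r) -> G (u, s) -> r = s.
  move=> Gr Gs; have Z r' : G (0, r') -> r' <= 0.
    move=> Gr'; rewrite leNgt; apply/negP => r'0.
    have [_] := Gq _ _ (GZ ((q 0 + 1) / r') _ _ Gr').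
    by rewrite scaler0 divfK ?gt_eqF//; lra.
  have := GL (-1) _ _ _ _ Gr Gs; have := GL (-1) _ _ _ _ Gs Gr.
  by rewrite !scaleN1r !addNr !mulN1r => /Z + /Z; lra.
have Gtot v : D v -> exists r, G (v, r).
  move=> Dv; apply: contrapT => Gv.
  pose A := [set p.2 - q (p.1 - v) | p in G].
  have qB u w : D u -> D w -> q (u + w) <= q (u - v) + q (w + v).
    move=> Du Dw; apply: le_trans (qD _ _ _ _).
    - by rewrite addrACA addNr addr0.
    - by apply: DD => //; rewrite -scaleN1r; exact: DZ.
    - exact: DD.
  have Aub w s : G (w, s) -> ubound A (q (w + v) - s).
    move=> Gws _ [[u r] Gur <-] /=.
    have [Du _] := Gq _ _ Gur; have [Dw _] := Gq _ _ Gws.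
    have [_ ?] := Gq _ _ (GD _ _ _ _ Gur Gws).
    by have := qB _ _ Du Dw; lra.
  have A0 : A !=set0 by exists (0 - q (0 - v)); exists (0, 0).
  have Asup : has_sup A by split => //; exists (q (0 + v) - 0); exact: Aub.
  (* Any value between this supremum and the upper bounds given by [Aub] extends
     the graph to [v]. *)
  pose c := sup A.
  have c_ge u r : G (u, r) -> r - c <= q (u - v).
    move=> Gur; suff: r - q (u - v) <= c by lra.
    by apply: ub_le_sup; [have [] := Asup|exists (u, r)].
  have c_le u r : G (u, r) -> r + c <= q (u + v).
    move=> Gur; suff: c <= q (u + v) - r by lra.
    by apply: ge_sup => //; exact: Aub.
  pose G' := [set (p.1.1 + p.2 *: v, p.1.2 + p.2 * c) | p in [set p : (V * R) * R | G p.1]].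
  apply: (Gmax G'); last first.
    split=> [_ _ [[[u r] t] /= Gur [<- <-]]|a _ _ _ _
        [[[u r] t] /= Gur [<- <-]] [[[u' r'] t'] /= Gur' [<- <-]]]; last first.
      exists ((a *: u + u', a * r + r'), a * t + t') => /=; first exact: GL.
      by rewrite scalerDr scalerA scalerDl addrACA; congr pair; ring.
    have [Du ruq] := Gq _ _ Gur; split; first by apply: DD => //; exact: DZ.
    have [t0|t0|->] := ltgtP t 0; last by rewrite scale0r mul0r !addr0.
      have tp : 0 < - t by rewrite oppr_gt0.
      have t0' : - t != 0 by rewrite oppr_eq0 lt_eqF.
      have := qZ' (- t) ((- t)^-1 *: u - v) tp.
      rewrite scalerBr scalerA divff// scale1r scaleNr opprK.
      have := ler_wpM2l (ltW tp) (c_ge _ _ (GZ (- t)^-1 _ _ Gur)).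
      rewrite mulrBr mulrA divff// mul1r => h1 h2.
      rewrite -[t * c]opprK -mulNr; apply: le_trans h1 _; apply: h2.
      by apply: DD; [exact: DZ|rewrite -scaleN1r; exact: DZ].
    have t0' : t != 0 by rewrite gt_eqF.
    have := qZ' t (t^-1 *: u + v) t0.
    rewrite scalerDr scalerA divff// scale1r.
    have := ler_wpM2l (ltW t0) (c_le _ _ (GZ t^-1 _ _ Gur)).
    rewrite mulrDr mulrA divff// mul1r => h1 h2.
    by apply: le_trans h1 _; apply: h2; apply: DD => //; exact: DZ.
  split.
    by move=> [u r] Gur; exists ((u, r), 0) => //=; rewrite scale0r mul0r !addr0.
  move=> G'G; apply: Gv; exists c; apply: G'G; exists ((0, 0), 1) => //=.
  by rewrite scale1r mul1r !add0r.
pose L v := xget 0 [set r | G (v, r)].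
have LG v : D v -> G (v, L v).
  by move=> /Gtot[r Gvr]; rewrite /L; case: xgetP => [s _ //|/(_ r)].
exists L; split=> [a u v Du Dv|u Du]; last by have [] := Gq _ _ (LG _ Du).
by apply: (Guniq (a *: u + v)); [apply: LG; exact: DL|apply: GL; exact: LG].
Qed.

(** * Compactness and ultrafilters *)

(** If no point of [K] were a limit, each would have a neighbourhood outside
    the ultrafilter; by compactness a neighbourhood of all of [K] would be
    disjoint from one of its members. *)
Lemma ultra_compact_cvg (T : topologicalType) (K : set T) (G : set_system T) :
  compact K -> UltraFilter G -> (forall U, open U -> K `<=` U -> G U) ->
  exists2 x, K x & G --> x.
Proof.
move=> cK GU GK; apply: contrapT => /forall2NP Knot.
have [|I /= [IG _ [W IW]] IK] := (compact_near_coveringP K).1 cK _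
    (powerset_filter_from G) (fun i x => nbhs x (~` i)) _.
  move=> x Kx; have [//|Gx] := Knot x.
  move/existsNP : Gx => [V /not_implyP[xV GV]].
  exists (interior V, [set W | G W /\ W `<=` ~` V]) => /=.
    split; first by apply: open_nbhs_nbhs; split => //; exact: open_interior.
    apply: powerset_filter_fromP.
    by have [] := in_ultra_setVsetC V GU.
  move=> [y W] /= [yV [_ WV]]; apply: filterS yV => z Vz Wz; exact: (WV _ Wz).
have GW : G W by exact: IG.
have GW' : G (interior (~` W)) by apply: GK; [exact: open_interior|exact: IK].
apply: (@filter_not_empty _ G); apply: filterS (filterI GW GW') => x [Wx /nbhs_singleton].
exact.
Qed.

(** If all pairs of neighbourhoods met, an ultrafilter finer than them would
    converge to a point of [K] and to a point of [L]. *)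
Lemma compact_separated (T : topologicalType) (K L : set T) :
  hausdorff_space T -> compact K -> compact L -> K `&` L = set0 ->
  exists U V, [/\ open U, open V, K `<=` U, L `<=` V & U `&` V = set0].
Proof.
move=> hT cK cL KL0; apply: contrapT => nsep.
pose I := [set p : set T * set T | [/\ open p.1, open p.2, K `<=` p.1 & L `<=` p.2]].
pose F := filter_from I (fun p => p.1 `&` p.2).
have FF : ProperFilter F.
  apply: filter_from_proper => [|[U V] [/= oU oV KU LV]].
    apply: filter_from_filter; first by exists (setT, setT); split => //; exact: openT.
    move=> [U V] [U' V'] [/= oU oV KU LV] [/= oU' oV' KU' LV'].
    exists (U `&` U', V `&` V') => /=; first by split; [exact: openI|exact: openI|move=> x Kx; split; auto|move=> x Lx; split; auto].
    by move=> x [[? ?] [? ?]].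
  by apply/set0P/eqP => UV0; apply: nsep; exists U, V.
have [G [GU FG]] := ultraFilterLemma FF.
have [x Kx Gx] : exists2 x, K x & G --> x.
  apply: ultra_compact_cvg => // U oU KU; apply: FG.
  by exists (U, setT) => /=; [split => //; exact: openT|move=> ? []].
have [y Ly Gy] : exists2 y, L y & G --> y.
  apply: ultra_compact_cvg => // U oU KU; apply: FG.
  by exists (setT, U) => /=; [split => //; exact: openT|move=> ? []].
have xy : x = y by apply: (@cvg_unique _ hT G).
by suff : set0 x by []; rewrite -KL0 xy; split => //; rewrite -xy.
Qed.

Lemma compact_subsetU (T : topologicalType) (K U V : set T) :
  hausdorff_space T -> compact K -> open U -> open V -> K `<=` U `|` V ->
  exists K1 K2, [/\ compact K1, compact K2, K1 `<=` U, K2 `<=` V & K = K1 `|` K2].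
Proof.
move=> hT cK oU oV KUV.
have cD W : open W -> compact (K `\` W).
  move=> oW; rewrite setDE; apply: compact_closedI => //; exact: open_closedC.
have [U' [V' [oU' oV' KU KV UV0]]] : exists U' V', [/\ open U', open V',
    K `\` U `<=` U', K `\` V `<=` V' & U' `&` V' = set0].
  apply: compact_separated => //; [exact: cD|exact: cD|].
  by rewrite -subset0 => x [[Kx nU] [_ nV]]; have [] := KUV _ Kx.
exists (K `\` U'), (K `\` V'); split; [exact: cD|exact: cD| | |].
- by move=> x [Kx nU']; apply: contrapT => nU; apply: nU'; exact: KU.
- by move=> x [Kx nV']; apply: contrapT => nV; apply: nV'; exact: KV.
- apply/seteqP; split => x; last by case=> -[].
  move=> Kx; have [U'x|] := pselect (U' x); last by left.
  by right; split => // V'x; suff : set0 x by []; rewrite -UV0.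
Qed.

(** * Radon measures from finitely additive set functions *)

(** A finitely additive [m] on all subsets induces a content on compact sets, by
    outer approximation through open sets; from this content a Radon measure is
    built as usual, inner on open sets, then outer on all sets. It does not
    exceed [m] on open sets, and [m_tight] prevents the loss of mass. *)
Section radonification.
Local Open Scope ereal_scope.
Variables (R : realType) (Y : ptopologicalType) (hY : hausdorff_space Y).
Variable m : set Y -> R.
Hypothesis m_ge0 : forall A, (0 <= m A)%R.
Hypothesis mU : forall A B, A `&` B = set0 -> m (A `|` B) = (m A + m B)%R.

Let m_le A B : A `<=` B -> (m A <= m B)%R.
Proof. by move=> /setDUK <-; rewrite mU ?setDIK// lerDl. Qed.

Let m_set0 : m set0 = 0%R.
Proof. by have := @mU set0 set0 (setI0 _); rewrite setU0; lra. Qed.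

Let m_leU A B : (m (A `|` B) <= m A + m B)%R.
Proof.
have -> : A `|` B = A `|` (B `\` A) by rewrite setDE setUIr setUCr setIT.
by rewrite mU ?setDIK// lerD2l m_le// => x [].
Qed.

Definition outer_content (K : set Y) : \bar R :=
  ereal_inf [set (m U)%:E | U in [set U | open U /\ K `<=` U]].

Let oc_le U K : open U -> K `<=` U -> outer_content K <= (m U)%:E.
Proof. by move=> oU KU; apply: ereal_inf_lbound; exists U. Qed.

Let oc_ge x K : (forall U, open U -> K `<=` U -> x <= (m U)%:E) -> x <= outer_content K.
Proof. by move=> h; apply: le_ereal_inf_tmp => _ [U [oU KU] <-]; exact: h. Qed.

Let oc_fin K : outer_content K \is a fin_num.
Proof.
rewrite ge0_fin_numE; last by apply: oc_ge => U _ _; rewrite lee_fin.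
by apply: (le_lt_trans (oc_le openT (@subsetT _ K))) => //; exact: ltry.
Qed.

Let oc_ex K (e : R) : (0 < e)%R ->
  exists U, [/\ open U, K `<=` U & (m U)%:E <= outer_content K + e%:E].
Proof.
move=> e0; have [_ [U [oU KU] <-] h] := lb_ereal_inf_adherent e0 (oc_fin K).
by exists U; split => //; exact: ltW.
Qed.

Let ocU K L : outer_content (K `|` L) <= outer_content K + outer_content L.
Proof.
apply/lee_addgt0Pr => e e0; have e20 : (0 < e / 2)%R by rewrite divr_gt0.
have [U [oU KU mUU]] := oc_ex K e20; have [V [oV LV mVV]] := oc_ex L e20.
apply: (@le_trans _ _ (m (U `|` V))%:E).
  by apply: oc_le; [exact: openU|exact: setUSS].
rewrite (splitr e) EFinD addeACA; apply: le_trans (leeD mUU mVV).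
by rewrite -EFinD lee_fin.
Qed.

(** Disjoint compact sets have disjoint neighbourhoods, hence the content is
    additive even though the approximating sets are only open. *)
Let ocU_disj K L : compact K -> compact L -> K `&` L = set0 ->
  outer_content K + outer_content L <= outer_content (K `|` L).
Proof.
move=> cK cL KL0; have [U [V [oU oV KU LV UV0]]] := compact_separated hY cK cL KL0.
apply: oc_ge => W oW KLW.
apply: (@le_trans _ _ ((m (W `&` U))%:E + (m (W `&` V))%:E)).
  apply: leeD; apply: oc_le; [exact: openI| |exact: openI|].
    by move=> x Kx; split; [apply: KLW; left|exact: KU].
  by move=> x Lx; split; [apply: KLW; right|exact: LV].
rewrite -EFinD lee_fin -mU; first by apply: m_le => x [[]|[]].
by rewrite setIACA UV0 setI0.
Qed.

Definition inner_open (U : set Y) : \bar R :=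
  ereal_sup [set outer_content K | K in [set K | compact K /\ K `<=` U]].

Let io_ge K U : compact K -> K `<=` U -> outer_content K <= inner_open U.
Proof. by move=> cK KU; apply: ereal_sup_ubound; exists K. Qed.

Let io_le U x : (forall K, compact K -> K `<=` U -> outer_content K <= x) -> inner_open U <= x.
Proof. by move=> h; apply: ge_ereal_sup => _ [K [cK KU] <-]; exact: h. Qed.

Let io_ge0 U : 0 <= inner_open U.
Proof.
apply: le_trans (io_ge compact0 (@sub0set _ U)) => //.
by apply: oc_ge => V _ _; rewrite lee_fin.
Qed.

Let io_lem U : open U -> inner_open U <= (m U)%:E.
Proof. by move=> oU; apply: io_le => K cK KU; exact: oc_le. Qed.

Let io_mono U V : U `<=` V -> inner_open U <= inner_open V.
Proof. by move=> UV; apply: io_le => K cK KU; apply: io_ge => //; exact: subset_trans UV. Qed.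

Let io_fin U : inner_open U \is a fin_num.
Proof.
rewrite ge0_fin_numE//; apply: (le_lt_trans (io_mono (@subsetT _ U))) => //.
by apply: (le_lt_trans (io_lem openT)); exact: ltry.
Qed.

Let io_ex U (e : R) : (0 < e)%R ->
  exists K, [/\ compact K, K `<=` U & inner_open U <= outer_content K + e%:E].
Proof.
move=> e0; have [_ [K [cK KU] <-] h] := ub_ereal_sup_adherent e0 (io_fin U).
by exists K; split => //; rewrite -leeBlDr// ltW.
Qed.

(** A compact subset of a countable union is covered by finitely many of the open
    sets and splits into compact pieces inside each of them. *)
Let io_bigcup (U : (set Y)^nat) : (forall n, open (U n)) ->
  inner_open (\bigcup_n U n) <= \sum_(n <oo) inner_open (U n).
Proof.
move=> oU.
have H N K : compact K -> K `<=` \bigcup_(i < N) U i ->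
    outer_content K <= \sum_(0 <= i < N) inner_open (U i).
  elim: N K => [|N IH] K cK.
    rewrite II0 bigcup_set0 => K0; rewrite big_geq// -[leRHS]/(0%:E) -m_set0.
    by apply: oc_le => //; exact: open0.
  rewrite bigcup_mkord big_ord_recr/= -bigcup_mkord => KU.
  have [K1 [K2 [cK1 cK2 K1U K2U ->]]] :
      exists K1 K2, [/\ compact K1, compact K2, K1 `<=` \bigcup_(i < N) U i,
      K2 `<=` U N & K = K1 `|` K2].
    by apply: compact_subsetU => //; exact: bigcup_open.
  rewrite big_nat_recr//=; apply: (le_trans (ocU _ _)); apply: leeD; first exact: IH.
  exact: io_ge.
apply: io_le => K cK KU.
have [|N _ NK] := (compact_near_coveringP K).1 cK _ \oo
    (fun n x => (\bigcup_(i < n) U i) x) _.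
  move=> x /KU[n _ Un]; exists (U n, [set i | (n < i)%N]).
    split; last by exists n.+1.
    by apply: open_nbhs_nbhs; split; [exact: oU|exact: Un].
  by move=> [y k] /= [Uy nk]; exists n.
apply: le_trans (H N K cK _) _; first by apply: NK => /=.
exact: nneseries_lim_ge.
Qed.

Definition outer_radon (A : set Y) : \bar R :=
  ereal_inf [set inner_open U | U in [set U | open U /\ A `<=` U]].

Let or_le A U : open U -> A `<=` U -> outer_radon A <= inner_open U.
Proof. by move=> oU KU; apply: ereal_inf_lbound; exists U. Qed.

Let or_open U : open U -> outer_radon U = inner_open U.
Proof.
move=> oU; apply/eqP; rewrite eq_le or_le//=.
by apply: le_ereal_inf_tmp => _ [V [oV UV] <-]; exact: io_mono.
Qed.

Let or_ge0 A : 0 <= outer_radon A.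
Proof. by apply: le_ereal_inf_tmp => _ [V [oV UV] <-]. Qed.

Let or_fin A : outer_radon A \is a fin_num.
Proof.
rewrite ge0_fin_numE//; apply: (le_lt_trans (or_le openT (@subsetT _ A))) => //.
by rewrite -ge0_fin_numE.
Qed.

Let or_ex A (e : R) : (0 < e)%R ->
  exists U, [/\ open U, A `<=` U & inner_open U <= outer_radon A + e%:E].
Proof.
move=> e0; have [_ [U [oU AU] <-] h] := lb_ereal_inf_adherent e0 (or_fin A).
by exists U; split => //; exact: ltW.
Qed.

Let or_set0 : outer_radon set0 = 0.
Proof.
apply/eqP; rewrite eq_le or_ge0 andbT or_open; last exact: open0.
by rewrite -[leRHS]/(0%:E) -m_set0 io_lem//; exact: open0.
Qed.

Let or_mono : {homo outer_radon : A B / A `<=` B >-> A <= B}.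
Proof.
move=> A B AB; apply: le_ereal_inf_tmp => _ [V [oV UV] <-]; apply: or_le => //.
exact: subset_trans UV.
Qed.

Let or_subadd : sigma_subadditive outer_radon.
Proof.
move=> A; apply/lee_addgt0Pr => e e0.
have e2 n : (0 < e / (2 ^ n.+1)%:R)%R by rewrite divr_gt0// ltr0n expn_gt0.
pose U n := sval (cid (or_ex (A n) (e2 n))).
have UP n : [/\ open (U n), A n `<=` U n &
    inner_open (U n) <= outer_radon (A n) + (e / (2 ^ n.+1)%:R)%:E].
  exact: (svalP (cid (or_ex (A n) (e2 n)))).
apply: le_trans (epsilon_trick xpredT _ (ltW e0)) => //.
apply: (@le_trans _ _ (inner_open (\bigcup_n U n))).
  apply: or_le; first by apply: bigcup_open => n _; have [] := UP n.
  by apply: subset_bigcup => n _; have [] := UP n.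
apply: le_trans (io_bigcup _) _; first by move=> n; have [] := UP n.
by apply: lee_nneseries => n _ //; have [] := UP n.
Qed.

HB.instance Definition _ := isOuterMeasure.Build R Y outer_radon
  or_set0 or_ge0 or_mono or_subadd.

(** Replace the test set by an open [W], exhaust [W `&` U] by a compact [K],
    then [W `\` K] by a compact [L]: the content is additive on [K] and [L]. *)
Let or_cara_open U : open U -> outer_radon.-caratheodory U.
Proof.
move=> oU; apply: le_caratheodory_measurable => A /=.
apply/lee_addgt0Pr => e e0; have e30 : (0 < e / 3)%R by rewrite divr_gt0.
have [W [oW AW hW]] := or_ex A e30.
have [K [cK KWU hK]] := io_ex (W `&` U) e30.
have clK : closed K by exact: compact_closed.
have oWK : open (W `\` K) by rewrite setDE; apply: openI => //; exact: closed_openC.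
have [L [cL LWK hL]] := io_ex (W `\` K) e30.
have h1 : outer_radon (A `&` U) <= outer_content K + (e / 3)%:E.
  by apply: le_trans hK; apply: or_le; [exact: openI|move=> x [/AW]].
have h2 : outer_radon (A `&` ~` U) <= outer_content L + (e / 3)%:E.
  apply: le_trans hL; apply: or_le => // x [/AW Wx nUx]; split => // /KWU[_].
  exact: nUx.
have h3 : outer_content K + outer_content L <= inner_open W.
  apply: (le_trans (ocU_disj cK cL _)).
    by rewrite -subset0 => x [Kx /LWK[_]]; exact.
  apply: io_ge; first exact: compactU.
  by move=> x [/KWU[]|/LWK[]].
apply: (le_trans (leeD h1 h2)); rewrite addeACA.
apply: (le_trans (leeD (le_trans h3 hW) (lexx _))); rewrite -addeA leeD2l//.
by rewrite -!EFinD lee_fin; lra.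
Qed.

Let or_cara (A : set (borel Y)) : measurable A -> outer_radon.-caratheodory A.
Proof.
move=> mA; suff : <<s @open Y >> `<=` outer_radon.-caratheodory by exact.
apply: smallest_sub => //; split.
- exact: caratheodory_measurable_set0.
- by move=> B mB; rewrite setTD; exact: caratheodory_measurable_setC.
- exact: caratheodory_measurable_bigcup.
Qed.

Definition radon_extension : set (borel Y) -> \bar R := outer_radon.

Let or_sigma_additive : semi_sigma_additive radon_extension.
Proof.
move=> F mF tF mU'.
exact: (@caratheodory_measure_sigma_additive R Y outer_radon F
  (fun n => or_cara (mF n)) tF (or_cara mU')).
Qed.

HB.instance Definition _ := isMeasure.Build _ (borel Y) R radon_extension
  or_set0 or_ge0 or_sigma_additive.

Let or_finite : fin_num_fun radon_extension.
Proof. by move=> A mA; exact: or_fin. Qed.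

HB.instance Definition _ := @Measure_isFinite.Build _ (borel Y) R radon_extension or_finite.

Hypothesis m_tight : forall e : R, (0 < e)%R -> exists2 K, compact K &
  forall U, open U -> K `<=` U -> (m (~` U) <= e)%R.

Let or_setT : radon_extension setT = (m setT)%:E.
Proof.
apply/eqP; rewrite eq_le [radon_extension _](or_open openT) io_lem//=; last exact: openT.
apply/lee_addgt0Pr => e e0; have [K cK Ke] := m_tight e0.
rewrite -leeBlDr//; apply: le_trans (io_ge cK (@subsetT _ _)).
apply: oc_ge => U oU KU; rewrite -EFinB lee_fin -(setvU U) mU ?setICl//.
by have := Ke _ oU KU; lra.
Qed.

Let or_radon : radon radon_extension.
Proof.
move=> A e mA e0; have e20 : (0 < e / 2)%R by rewrite divr_gt0.
have [U [oU AU hU]] := or_ex (~` A) e20.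
have [K [cK _ hK]] := io_ex setT e20.
have clU : closed (~` U) by exact: open_closedC.
have mb (B : set Y) : open B -> measurable (B : set (borel Y)).
  by move=> ?; exact: sub_sigma_algebra.
have mK : measurable (K : set (borel Y)).
  by rewrite -[K]setCK; apply: measurableC; apply: mb; apply: closed_openC; exact: compact_closed.
exists (K `&` ~` U); split; first exact: compact_closedI.
  by move=> x [_ nU]; apply: contrapT => nA; exact/nU/AU.
pose mu : {finite_measure set (borel Y) -> \bar R} := radon_extension.
have muE (V : set Y) : open V -> mu V = inner_open V by exact: or_open.
apply: (@le_trans _ _ (mu (~` K `|` (U `\` ~` A)))).
  apply: or_mono => x [Ax]; rewrite not_andE/= => -[nK|nU]; first by left.
  by right; split; [exact: contrapT|].
have mUA : measurable ((U `\` ~` A) : set (borel Y)).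
  by apply: measurableD; [exact: mb|exact: measurableC].
apply: (le_trans (measureU2 _ _ _)) => //; first exact: measurableC.
rewrite (splitr e) EFinD; apply: leeD.
  rewrite -setTD measureD//; last by rewrite -ge0_fin_numE//; exact: or_fin.
  rewrite setTI leeBlDr; last exact: or_fin.
  rewrite addeC [leLHS](muE _ openT).
  apply: (le_trans hK); rewrite leeD2r//.
  apply: le_ereal_inf_tmp => _ [V [oV KV] <-].
  exact: io_ge.
rewrite measureD//; [|exact: mb|exact: measurableC|by rewrite -ge0_fin_numE//; exact: or_fin].
rewrite leeBlDr; last exact: or_fin.
by rewrite setIidr// addeC [leLHS](muE _ oU).
Qed.

Lemma radon_of_finitely_additive :
  exists alpha : {finite_measure set (borel Y) -> \bar R},
    [/\ radon alpha, alpha setT = (m setT)%:E &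
        forall U : set Y, open U -> alpha U <= (m U)%:E].
Proof.
exists radon_extension; split => // U oU.
by rewrite [leLHS](or_open oU) io_lem.
Qed.

End radonification.

(** * Integrals as sums over layers *)

(** [c] rounded down to a multiple of [d], strictly below [c] and capped at
    [N * d]: for a function [h] it is a combination of indicators of the sets
    [d * k < h], which are open when [h] is lower semicontinuous. *)
Definition staircase (R : realType) (d : R) (N : nat) (c : R) : R :=
  \sum_(k < N) d * (k.+1%:R * d < c)%R%:R.

Lemma staircase_le (R : realType) (d : R) N c :
  0 < d -> 0 <= c -> staircase d N c <= c.
Proof.
move=> d0 c0; rewrite /staircase; elim: N => [|N IH]; first by rewrite big_ord0.
rewrite big_ord_recr/=; have [h|_] := ltP; last by rewrite mulr0 addr0.
rewrite mulr1; apply: ltW; apply: le_lt_trans h; rewrite -natr1 mulrDl mul1r lerD2r.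
apply: (@le_trans _ _ (\sum_(k < N) d : R)%R); last by rewrite sumr_const card_ord mulr_natl.
by apply: ler_sum => k _; rewrite ler_piMr ?(ltW d0)//; case: ltP.
Qed.

Lemma le_staircase (R : realType) (d : R) N c :
  0 < d -> c <= N%:R * d -> c <= staircase d N c + d.
Proof.
move=> d0; rewrite /staircase; elim: N => [|N IH].
  by rewrite big_ord0 mul0r add0r => c0; exact: (le_trans c0 (ltW d0)).
move=> cN; rewrite big_ord_recr/=; have [cN'|Nc] := leP c (N%:R * d).
  apply: (le_trans (IH cN')); rewrite lerD2r lerDl mulr_ge0// ltW//.
rewrite (_ : \sum_(k < N) _ = N%:R * d).
  apply: (le_trans cN); rewrite -natr1 mulrDl mul1r lerD2r lerDl mulr_ge0// ltW//.
under eq_bigr => k _.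
  rewrite (_ : _ < _) ?mulr1; last first.
    by apply: le_lt_trans Nc; rewrite ler_pM2r// ler_nat.
  over.
by rewrite sumr_const card_ord mulr_natl.
Qed.

Lemma measurable_superlevel d (T : measurableType d) (R : realType) (h : T -> R) (a : R) :
  measurable_fun setT h -> measurable [set x | a < h x].
Proof.
move=> mh; have := mh measurableT _ (measurable_itv `]a, +oo[); rewrite setTI.
by congr measurable; apply/seteqP; split => x /=; rewrite in_itv/= andbT.
Qed.

Section layers.
Local Open Scope ereal_scope.
Variables (R : realType) (d : measure_display) (T : measurableType d).
Variables (mu : {measure set T -> \bar R}) (w h : T -> R).
Hypotheses (mw : measurable_fun setT w) (mh : measurable_fun setT h).
Hypothesis w0 : forall x, (0 <= w x)%R.

Definition layer_sum (e : R) (N : nat) : \bar R :=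
  \sum_(k < N) e%:E * \int[mu]_(x in [set x | (k.+1%:R * e < h x)%R]) (w x)%:E.

Let mE a : measurable [set x | (a < h x)%R].
Proof. exact: measurable_superlevel. Qed.

Lemma integral_staircase (e : R) N : (0 < e)%R ->
  \int[mu]_x (staircase e N (h x) * w x)%:E = layer_sum e N.
Proof.
move=> e0; rewrite /layer_sum.
transitivity (\int[mu]_x (\sum_(k < N)
    e%:E * (((k.+1%:R * e < h x)%R)%:R * w x)%:E)).
  apply: eq_integral => x _; rewrite /staircase mulr_suml -sumEFin.
  by apply: eq_bigr => k _; rewrite -EFinM mulrA.
have mk (k : 'I_N) : measurable_fun setT ((fun x => (((k.+1%:R * e < h x)%R)%:R * w x)%:E) : T -> \bar R).
  apply/measurable_EFinP; apply: measurable_funM => //.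
  rewrite (_ : (fun _ => _) = \1_[set x | (k.+1%:R * e < h x)%R]).
    exact: measurable_indic.
  by apply/funext => x; rewrite indicE mem_setE.
rewrite ge0_integral_sum//; last 2 first.
- by move=> k; apply: measurable_funeM.
- by move=> k x _; rewrite mule_ge0// lee_fin ?mulr_ge0// ltW.
apply: eq_bigr => k _; rewrite ge0_integralZl//; last 2 first.
- by move=> x _; rewrite lee_fin mulr_ge0.
- by rewrite lee_fin ltW.
congr (_ * _); rewrite [RHS]integral_mkcond; apply: eq_integral => x _.
rewrite /patch; case: ifPn; rewrite ?inE ?notin_setE/=; first by move=> ->; rewrite mul1r.
by move=> /negP/negbTE ->; rewrite mul0r.
Qed.

Let mst e N : measurable_fun setT ((fun x => (staircase e N (h x) * w x)%:E) : T -> \bar R).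
Proof.
apply/measurable_EFinP; apply: measurable_funM => //.
rewrite /staircase; apply: measurable_sum => k; apply: measurable_funM => //.
rewrite (_ : (fun _ => _) = \1_[set x | (k.+1%:R * e < h x)%R]).
  exact: measurable_indic.
by apply/funext => x; rewrite indicE mem_setE.
Qed.

Let st_ge0 e N x : (0 < e)%R -> (0 <= staircase e N (h x) * w x)%R.
Proof.
by move=> e0; rewrite mulr_ge0// sumr_ge0// => k _; rewrite mulr_ge0// ltW.
Qed.

Lemma layer_sum_le (e : R) N : (0 < e)%R -> (forall x, 0 <= h x)%R ->
  layer_sum e N <= \int[mu]_x (h x * w x)%:E.
Proof.
move=> e0 h0; rewrite -integral_staircase//; apply: ge0_le_integral => //.
- by move=> x _; rewrite lee_fin st_ge0.
- by apply/measurable_EFinP; exact: measurable_funM.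
- by move=> x _; rewrite lee_fin ler_wpM2r// staircase_le.
Qed.

Lemma le_layer_sum (e : R) N : (0 < e)%R -> (forall x, 0 <= h x)%R ->
  (forall x, h x <= N%:R * e)%R ->
  \int[mu]_x (h x * w x)%:E <= layer_sum e N + e%:E * \int[mu]_x (w x)%:E.
Proof.
move=> e0 h0 hN; rewrite -integral_staircase// -ge0_integralZl//; last 3 first.
- exact/measurable_EFinP.
- by move=> x _; rewrite lee_fin.
- by rewrite lee_fin ltW.
rewrite -ge0_integralD//; last 3 first.
- by move=> x _; rewrite lee_fin st_ge0.
- by move=> x _; rewrite mule_ge0// lee_fin// ltW.
- by apply: measurable_funeM; exact/measurable_EFinP.
apply: ge0_le_integral => //.
- by move=> x _; rewrite lee_fin mulr_ge0.
- by apply/measurable_EFinP; exact: measurable_funM.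
- by apply: emeasurable_funD => //; apply: measurable_funeM; exact/measurable_EFinP.
- by move=> x _; rewrite -EFinM -EFinD lee_fin -mulrDl ler_wpM2r// le_staircase.
Qed.

End layers.

(** * Radon measures from positive functionals *)

Section functional.
Variables (R : realType) (Y : ptopologicalType).

Definition bdd_fun (f : Y -> R) := exists M, forall y, `|f y| <= M.

Lemma bdd_fun_lin (a : R) f g : bdd_fun f -> bdd_fun g -> bdd_fun (a *: f + g).
Proof.
move=> [M fM] [N gN]; exists (`|a| * M + N) => y.
apply: (le_trans (ler_normD _ _)); apply: lerD; last exact: gN.
by rewrite normrM ler_wpM2l.
Qed.

Lemma bdd_fun_cst c : bdd_fun (cst c).
Proof. by exists `|c|. Qed.

Lemma bdd_fun_indic A : bdd_fun \1_A.
Proof. by exists 1 => y; rewrite indicE normr_nat lern1 leq_b1. Qed.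

Lemma bdd_funD f g : bdd_fun f -> bdd_fun g -> bdd_fun (f + g).
Proof. by move=> bf bg; rewrite -[f]scale1r; exact: bdd_fun_lin. Qed.

Lemma bdd_funZ a f : bdd_fun f -> bdd_fun (a *: f).
Proof. by move=> bf; rewrite -[_ *: _]addr0; apply: bdd_fun_lin => //; exact: bdd_fun_cst. Qed.

Lemma bdd_funB f g : bdd_fun f -> bdd_fun g -> bdd_fun (f - g).
Proof. by move=> bf bg; rewrite addrC -scaleN1r; exact: bdd_fun_lin. Qed.

Definition positive_functional (L : (Y -> R) -> R) :=
  (forall a u v, bdd_fun u -> bdd_fun v -> L (a *: u + v) = a * L u + L v) /\
  (forall u, bdd_fun u -> (forall y, 0 <= u y) -> 0 <= L u).

Variable L : (Y -> R) -> R.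
Hypothesis posL : positive_functional L.

Lemma pfunD f g : bdd_fun f -> bdd_fun g -> L (f + g) = L f + L g.
Proof. by move=> bf bg; rewrite -[f]scale1r posL.1// scale1r mul1r. Qed.

Lemma pfun0 : L 0 = 0.
Proof.
have b0 := bdd_fun_cst 0.
by have := posL.1 1 _ _ b0 b0; rewrite scaler0 addr0 mul1r -[X in X = _]addr0 => /addrI.
Qed.

Lemma pfunZ a f : bdd_fun f -> L (a *: f) = a * L f.
Proof.
by move=> bf; rewrite -[_ *: _]addr0 posL.1//; [rewrite pfun0 addr0|exact: bdd_fun_cst].
Qed.

Lemma pfunB f g : bdd_fun f -> bdd_fun g -> L (f - g) = L f - L g.
Proof. by move=> bf bg; rewrite addrC -scaleN1r posL.1// mulN1r addrC. Qed.

Lemma pfun_le f g : bdd_fun f -> bdd_fun g -> (forall y, f y <= g y) -> L f <= L g.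
Proof.
move=> bf bg fg; rewrite -subr_ge0 -pfunB//; apply: posL.2; first exact: bdd_funB.
by move=> y; rewrite subr_ge0.
Qed.

Lemma pfun_staircase (h : Y -> R) (e : R) N : 0 < e -> bdd_fun h -> (forall y, 0 <= h y) ->
  \sum_(k < N) e * L \1_[set y | k.+1%:R * e < h y] <= L h.
Proof.
move=> e0 bh h0.
have [bs <-] : bdd_fun (fun y => staircase e N (h y)) /\
    L (fun y => staircase e N (h y)) = \sum_(k < N) e * L \1_[set y | k.+1%:R * e < h y].
  rewrite /staircase; elim: N => [|N [IHb IH]].
    under eq_fun do rewrite big_ord0; rewrite big_ord0.
    by split; [exact: bdd_fun_cst|exact: pfun0].
  rewrite big_ord_recr/= -IH.
  rewrite (_ : (fun y => \sum_(k < N.+1) _) = e *: \1_[set y | N.+1%:R * e < h y] +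
     (fun y => \sum_(k < N) e * (k.+1%:R * e < h y)%R%:R)).
    split; first by apply: bdd_fun_lin => //; exact: bdd_fun_indic.
    by rewrite posL.1//; [rewrite addrC|exact: bdd_fun_indic].
  apply/funext => y; rewrite big_ord_recr/= addrC; congr (_ + _).
  by rewrite fctE indicE mem_setE.
by apply: pfun_le => // y; exact: staircase_le.
Qed.

Local Open Scope ereal_scope.
Hypothesis hY : hausdorff_space Y.
Hypothesis tightL : forall e : R, (0 < e)%R -> exists2 K : set Y, compact K &
  forall U, open U -> K `<=` U -> (L \1_(~` U) <= e)%R.

Lemma measurable_open_superlevel (h : borel Y -> R) :
  (forall a, open [set y : Y | (a < h y)%R]) -> measurable_fun setT h.
Proof.
move=> oh; apply: (measurability _ (RGenOInfty.measurableE R)).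
move=> _ [_ [a ->] <-]; rewrite setTI; apply: sub_sigma_algebra.
rewrite [X in @open Y X](_ : _ = [set y : Y | (a < h y)%R])//.
by apply/seteqP; split => y /=; rewrite in_itv/= andbT.
Qed.

(** The functional applied to indicators is finitely additive, so a Radon measure
    lies below it on open sets. Rounding a lower semicontinuous function down to
    a combination of indicators of open sets extends the comparison. *)
Lemma radon_of_functional :
  exists alpha : {finite_measure set (borel Y) -> \bar R},
    [/\ radon alpha, alpha setT = (L (cst 1%R))%:E &
        forall h : Y -> R, bdd_fun h -> (forall y, 0 <= h y)%R ->
          (forall a, open [set y | (a < h y)%R]) ->
          \int[alpha]_y (h y)%:E <= (L h)%:E].
Proof.
have m0 A : (0 <= L \1_A)%R.
  by apply: posL.2; [exact: bdd_fun_indic|move=> y; rewrite indicE].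
have mU A B : A `&` B = set0 -> L \1_(A `|` B) = (L \1_A + L \1_B)%R.
  move=> AB; rewrite -pfunD; [|exact: bdd_fun_indic|exact: bdd_fun_indic].
  congr L; apply/funext => y; rewrite fctE !indicE in_setU.
  have [yA|yA] := boolP (y \in A); have [yB|yB] := boolP (y \in B); rewrite ?addr0 ?add0r//.
  by move: yA yB; rewrite !inE => yA yB; suff : set0 y by []; rewrite -AB.
have [alpha [ra aT aU]] := radon_of_finitely_additive hY m0 mU tightL.
exists alpha; split => //; first by rewrite aT; congr (L _)%:E; apply/funext => y; rewrite indicT.
move=> h bh h0 oh; have [C hC] := bh.
have mh : measurable_fun setT (h : borel Y -> R) by exact: measurable_open_superlevel.
have aTfin : alpha setT \is a fin_num by rewrite fin_num_measure.
pose c := fine (alpha setT).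
apply/lee_addgt0Pr => e e0.
have c0 : (0 <= c)%R by rewrite fine_ge0.
pose d := (e / (c + 1))%R.
have d0 : (0 < d)%R by rewrite divr_gt0// ltr_wpDl.
have dc : (d * c <= e)%R.
  by rewrite /d mulrAC ler_pdivrMr ?ltr_wpDl// ler_pM2l// lerDl.
clearbody d.
have [N CN] : exists N, (C <= N%:R * d)%R.
  exists (Num.Def.archi_bound (`|C| / d)).
  rewrite -ler_pdivrMr//; apply: (@le_trans _ _ (`|C| / d)%R).
    by rewrite ler_pM2r ?invr_gt0// ler_norm.
  by apply/ltW/archi_boundP; rewrite divr_ge0// ltW.
have m1 : measurable_fun setT (cst 1%R : borel Y -> R) by exact: measurable_cst.
have := le_layer_sum alpha m1 mh (fun=> ler01) (N := N) d0 h0.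
rewrite (eq_integral (fun y : borel Y => (h y)%:E)); last by move=> x _; rewrite /= mulr1.
move=> hle; apply: (le_trans (hle _)).
  by move=> y; apply: le_trans CN; apply: le_trans (hC y); exact: ler_norm.
apply: leeD.
  apply: (@le_trans _ _ (\sum_(k < N) d * L \1_[set y | (k.+1%:R * d < h y)%R])%:E).
    rewrite -sumEFin; apply: lee_sum => k _; rewrite EFinM; apply: lee_wpmul2l; first by rewrite lee_fin ltW.
    have ok := oh (k.+1%:R * d)%R.
    rewrite [leLHS](integral_cst alpha (sub_sigma_algebra ok) 1) mul1e.
    exact: aU.
  by rewrite lee_fin pfun_staircase.
suff -> : \int[alpha]_x (cst 1%R x)%:E = c%:E by rewrite -EFinM lee_fin.
by rewrite /c fineK// [LHS](integral_cst alpha measurableT 1) mul1e.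
Qed.

(** A continuous function is also upper semicontinuous: the inequality holds for
    [g] and for [C - g], and the total masses agree. *)
Lemma integral_of_functional (alpha : {finite_measure set (borel Y) -> \bar R}) :
  alpha setT = (L (cst 1%R))%:E ->
  (forall h : Y -> R, bdd_fun h -> (forall y, 0 <= h y)%R ->
          (forall a, open [set y | (a < h y)%R]) ->
          \int[alpha]_y (h y)%:E <= (L h)%:E) ->
  forall g : Y -> R, continuous g -> (forall y, 0 <= g y)%R -> bdd_fun g ->
    \int[alpha]_y (g y)%:E = (L g)%:E.
Proof.
move=> aT aL g cg g0 bg; have [C gC] := bg.
have og a : open [set y | (a < g y)%R].
  by apply: (@open_comp _ _ g [set x | (a < x)%R]) => [y _|]; [exact: cg|exact: open_gt].
have og' a : open [set y | (a < C - g y)%R].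
  rewrite (_ : [set _ | _] = g @^-1` [set x | (x < C - a)%R]).
    by apply: open_comp => [y _|]; [exact: cg|exact: open_lt].
  by apply/seteqP; split => y /=; rewrite ltrBrDr ltrBrDr addrC.
have bg' : bdd_fun (fun y => C - g y)%R by apply: (bdd_funB (bdd_fun_cst C) bg).
have g0' y : (0 <= C - g y)%R by rewrite subr_ge0 (le_trans (ler_norm _) (gC y)).
have mg : measurable_fun setT (g : borel Y -> R) by exact: measurable_open_superlevel.
have mg' : measurable_fun setT (fun y : borel Y => C - g y)%R by exact: measurable_open_superlevel.
have C0 : (0 <= C)%R := le_trans (normr_ge0 _) (gC point).
apply/eqP; rewrite eq_le aL//=.
have := aL _ bg' g0' og'.
have -> : L (fun y => C - g y)%R = (C * L (cst 1) - L g)%R.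
  rewrite -pfunZ; last exact: bdd_fun_cst.
  rewrite -pfunB//; last by apply: bdd_funZ; exact: bdd_fun_cst.
  by congr L; apply/funext => y; rewrite -[X in (X - _)%R]mulr1.
have : \int[alpha]_y (C - g y)%:E + \int[alpha]_y (g y)%:E = (C * L (cst 1))%:E.
  rewrite -ge0_integralD//; last 4 first.
  - by move=> y _; rewrite lee_fin.
  - exact/measurable_EFinP.
  - by move=> y _; rewrite lee_fin.
  - exact/measurable_EFinP.
  rewrite (eq_integral (cst C%:E : borel Y -> _)); last by move=> y _; rewrite /= -EFinD subrK.
  by rewrite integral_cst// EFinM -aT.
have := aL _ bg g0 og.
have : 0 <= \int[alpha]_y (g y)%:E by apply: integral_ge0 => y _; rewrite lee_fin.
have : 0 <= \int[alpha]_y (C - g y)%:E by apply: integral_ge0 => y _; rewrite lee_fin.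
case: (\int[alpha]_y (C - g y)%:E) => [u| |]//; case: (\int[alpha]_y (g y)%:E) => [v| |]//.
rewrite -EFinD !lee_fin => _ _ _ [uv]; lra.
Qed.

End functional.

(** * Topology of the cone *)

Lemma ultra_fmap (T U : Type) (f : T -> U) (G : set_system T) :
  UltraFilter G -> UltraFilter (f @ G).
Proof.
move=> GU; apply: Build_UltraFilter => H HF sub; apply/seteqP; split; last exact: sub.
move=> A HA; have [//|GA] := in_ultra_setVsetC (f @^-1` A) GU.
have HA' : H (~` A) by exact: sub.
by have [x []] := filter_ex (filterI HA HA').
Qed.

Lemma cluster_continuous (T U : topologicalType) (f : T -> U) (x y : T) :
  hausdorff_space U -> {for x, continuous f} -> {for y, continuous f} ->
  cluster (nbhs x) y -> f x = f y.
Proof.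
move=> hU fx fy xy; apply: hU => A B Ax By.
by have [z [Az Bz]] := xy _ _ (fx _ Ax) (fy _ By); exists (f z).
Qed.

Lemma prod_hausdorff (U V : topologicalType) :
  hausdorff_space U -> hausdorff_space V -> hausdorff_space (U * V)%type.
Proof.
move=> hU hV [u v] [u' v'] h; congr pair.
  by apply: (@cluster_continuous _ _ (@fst U V) _ _ hU _ _ h); exact: cvg_fst.
by apply: (@cluster_continuous _ _ (@snd U V) _ _ hV _ _ h); exact: cvg_snd.
Qed.

Lemma nonneg_num_continuous (R : realType) : continuous (fun r : {nonneg R} => r%:num).
Proof. exact: initial_continuous. Qed.

Section cone_topology.
Variables (R : realType) (X : ptopologicalType).
Implicit Types (c : cone R X) (x : X) (r : {nonneg R}).

Lemma rad_eq0 c : ((rad c)%:num == 0) = (c == cpt point 0%:nng).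
Proof.
apply/eqP/eqP => [c0|->]; last by rewrite rad_cpt.
by rewrite -(cptK c); apply/eqP/(cpt_eqP (_, _) (_, _)); right.
Qed.

Lemma cpt0 x r : r%:num = 0 -> cpt x r = cpt point 0%:nng :> cone R X.
Proof. by move=> r0; apply/eqP; rewrite -rad_eq0 rad_cpt r0. Qed.

Lemma rad_gt0 c : (0 < (rad c)%:num) = ((rad c)%:num != 0).
Proof. by rewrite lt_neqAle eq_sym ge0 andbT. Qed.

Lemma nbhs_vertex c (A : set (cone R X)) : (rad c)%:num = 0 ->
  nbhs c A <-> exists2 e : R, 0 < e & forall d, (rad d)%:num < e -> A d.
Proof. by move=> c0; rewrite /nbhs/= /cone_nbhs c0 eqxx. Qed.

Lemma nbhs_off_vertex c (A : set (cone R X)) : (rad c)%:num != 0 ->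
  nbhs c A <-> nbhs (base c, rad c) [set q | A (cpt q.1 q.2)].
Proof.
move=> c0; rewrite {1}/nbhs/= /cone_nbhs (negbTE c0) -surjective_pairing.
by rewrite (_ : [set q | A (cpt q.1 q.2)] = \pi_(cone R X)%qT @^-1` A)//; apply/seteqP; split => -[].
Qed.

Lemma rad_continuous : continuous (fun c => (rad c)%:num).
Proof.
move=> c U /= cU; rewrite nbhs_simpl/=.
have [c0|c0] := eqVneq (rad c)%:num 0.
  apply/nbhs_vertex => //.
  move: cU; rewrite c0 -filter_from_ballE => -[e /= e0 eU]; exists e => // d de.
  by apply: eU; rewrite /ball/= sub0r normrN ger0_norm.
apply/nbhs_off_vertex => //=.
exists (setT, (fun r : {nonneg R} => r%:num) @^-1` U) => /=.
  by split; [exact: filterT|exact: nonneg_num_continuous].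
by move=> [x r] /= [_]; rewrite rad_cpt.
Qed.

Lemma base_continuous c : (rad c)%:num != 0 -> {for c, continuous (@base R X)}.
Proof.
move=> c0 U /= cU; rewrite nbhs_simpl/=; apply/nbhs_off_vertex => //=.
exists (U, (fun r : {nonneg R} => r%:num) @^-1` [set s | 0 < s]) => /=.
  split; first exact: cU.
  by apply: nonneg_num_continuous; apply: lt_nbhsr; rewrite rad_gt0.
by move=> [x r] /= [Ux r0]; rewrite base_cpt ?gt_eqF.
Qed.

Lemma cpt_continuous x : continuous (fun r => cpt x r : cone R X).
Proof.
move=> r U /= rU; rewrite nbhs_simpl/=.
have [r0|r0] := eqVneq r%:num 0.
  have /nbhs_vertex : (rad (cpt x r : cone R X))%:num = 0 by rewrite rad_cpt.
  move=> /(_ U) [/(_ rU)[e e0 eU] _].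
  have : nbhs r ((fun r : {nonneg R} => r%:num) @^-1` [set s | s < e]).
    by apply: nonneg_num_continuous; apply: lt_nbhsl; rewrite r0.
  by apply: filterS => s /= se; apply: eU; rewrite rad_cpt.
have /nbhs_off_vertex : (rad (cpt x r : cone R X))%:num != 0 by rewrite rad_cpt.
move=> /(_ U) [/(_ rU) + _]; rewrite rad_cpt base_cpt// => -[[A B] /= [xA rB] AB].
by apply: filterS rB => s Bs; apply: (AB (x, s)); split => //; exact: nbhs_singleton.
Qed.

Lemma cone_hausdorff : hausdorff_space X -> hausdorff_space (cone R X).
Proof.
move=> hX c d cd.
have rcd : (rad c)%:num = (rad d)%:num.
  by apply: (@cluster_continuous _ _ (fun c : cone R X => (rad c)%:num : R) _ _ (@Rhausdorff R) _ _ cd); exact: rad_continuous.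
have [c0|c0] := eqVneq (rad c)%:num 0.
  have /eqP := c0; rewrite rad_eq0 => /eqP ->.
  by move: c0; rewrite rcd => /eqP; rewrite rad_eq0 => /eqP ->.
rewrite -(cptK c) -(cptK d); congr cpt; last exact/val_inj.
apply: (@cluster_continuous _ _ (@base R X) _ _ hX _ _ cd); apply: base_continuous => //.
by rewrite -rcd.
Qed.

Lemma rad_base_continuous (phi : X -> R) : continuous phi ->
  [bounded phi x | x in [set: X]] -> continuous (fun c => phi (base c) * (rad c)%:num).
Proof.
move=> cphi [M0 [_ bM]] c.
have FF : Filter (cone_nbhs c) by exact: (nbhs_filter (c : cone R X)).
have [c0|c0] := eqVneq (rad c)%:num 0; last first.
  apply: cvgM; last exact: rad_continuous.
  exact: (cvg_comp _ _ (base_continuous c0) (cphi (base c))).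
rewrite /continuous_at c0 mulr0.
pose M := `|M0| + 1.
have phiM x : `|phi x| <= M.
  by apply: bM => //; rewrite (le_lt_trans (ler_norm _))// ltrDl.
apply/norm_cvg0P; apply: (@squeeze_cvgr _ _ _ _ (cst 0) (fun c => M * (rad c)%:num)).
- by near=> d; rewrite normr_ge0/= normrM ler_pM// ger0_norm.
- exact: cvg_cst.
- rewrite -[X in _ --> X](mulr0 M) -c0; apply: cvgM; first exact: cvg_cst.
  exact: rad_continuous.
Unshelve. all: by end_near. Qed.

(** Compactness in the cone. Either the radius tends to 0 along the ultrafilter,
    which then converges to the vertex whatever the base points do, or some
    [2 ^- n] lies below the radius and the base points converge in [K n]. *)
Lemma cone_ultra_cvg (K : nat -> set X) (G : set_system (cone R X)) :
  hausdorff_space X -> UltraFilter G ->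
  (forall n, compact (K n)) -> G [set c | (rad c)%:num <= 1] ->
  (forall n U, open U -> K n `<=` U ->
    G [set c | 2^-1 ^+ n < (rad c)%:num -> U (base c)]) ->
  exists2 c, G --> c & (rad c)%:num <= 1 /\
    forall n, 2^-1 ^+ n < (rad c)%:num -> K n (base c).
Proof.
move=> hX GU cK G1 GK.
have GP : ProperFilter G by exact: ultra_proper.
have GF : Filter G by exact: filter_filter.
have [Gv|] := pselect (forall n, G [set c | (rad c)%:num <= 2^-1 ^+ n]).
  exists (cpt point 0%:nng); last first.
    rewrite rad_cpt; split=> // n /=; rewrite ltNge exprn_ge0//.
  move=> U /= /nbhs_vertex []; first by rewrite rad_cpt.
  move=> e e0 eU; have [n ne] : exists n, 2^-1 ^+ n < e.
    have : (2^-1 : R) ^+ n @[n --> \oo] --> (0 : R).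
      by apply: cvg_expr; rewrite ger0_norm ?invf_lt1 ?ltr1n.
    move=> /cvgrPdist_lt/(_ _ e0)[n _ /(_ n (leqnn _))] h; exists n.
    by move: h; rewrite /= sub0r normrN ger0_norm ?exprn_ge0.
  by apply: filterS (Gv n) => c /= cn; apply: eU; exact: le_lt_trans cn ne.
move/existsNP => [n nG].
have Gn : G [set c | 2^-1 ^+ n < (rad c)%:num].
  have [//|] := in_ultra_setVsetC [set c | (rad c)%:num <= 2^-1 ^+ n] GU.
  by apply: filterS => c /= /negP; rewrite -ltNge.
have baseK m : G [set c | 2^-1 ^+ m < (rad c)%:num] ->
    exists2 x, K m x & (@base R X) @ G --> x.
  move=> Gm; apply: (ultra_compact_cvg (cK m) (ultra_fmap _ _)) => U oU KU.
  by apply: (@filterS _ G GF _ _ _ (filterI Gm (GK _ _ oU KU))) => c [cm]; exact.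
have [x Kx Gx] := baseK n Gn.
have GUr : UltraFilter ((fun c => (rad c)%:num) @ G) by exact: ultra_fmap.
have [r [r01 Gr]] : (`[0, 1]%classic : set R) `&` [set r | (fun c => (rad c)%:num) @ G --> r] !=set0.
  move: (@segment_compact R 0 1); rewrite compact_ultra; apply.
  by apply: (@filterS _ G GF _ _ _ G1) => c /= c1; rewrite in_itv/= c1 andbT.
have rn : 2^-1 ^+ n <= r.
  by apply: (cvgr_to_ge Gr); apply: (@filterS _ G GF _ _ _ Gn) => c; exact: ltW.
have r0 : 0 < r by apply: lt_le_trans rn; rewrite exprn_gt0.
pose rr : {nonneg R} := NngNum (ltW r0).
exists (cpt x rr).
  move=> U /=; have : (rad (cpt x rr : cone R X))%:num != 0 by rewrite rad_cpt gt_eqF.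
  move=> /nbhs_off_vertex -> /=; rewrite base_cpt ?gt_eqF// rad_cpt => -[[A B] /= [xA rB] AB].
  have [V [oV Vr] VB] : exists2 V : set R, open V /\ V r & (fun s : {nonneg R} => s%:num) @^-1` V `<=` B.
    move: rB; rewrite nbhsE => -[B' [[V oV VB'] B'r] B'B].
    exists V; first by split => //; move: B'r; rewrite -VB'.
    by rewrite VB'.
  have GV := Gr V (open_nbhs_nbhs (conj oV Vr)).
  apply: (@filterS _ G GF _ _ _ (@filterI _ G GF _ _ (Gx _ xA) GV)) => c [/= cA cV].
  by rewrite -(cptK c); apply: (AB (base c, rad c)); split => //; exact: VB.
rewrite rad_cpt; split; first by move: r01; rewrite /= in_itv/= => /andP[].
move=> m mr; rewrite base_cpt ?gt_eqF//.
have [y Ky Gy] : exists2 y, K m y & (@base R X) @ G --> y.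
  by apply: baseK; apply: (Gr [set s | 2^-1 ^+ m < s]); exact: lt_nbhsr.
suff -> : x = y by [].
by apply: (@cvg_unique _ hX _ _ _ _ Gx Gy).
Qed.

End cone_topology.

(** * Integrals against charges *)

Section measure_add_finite.
Context d (T : measurableType d) (R : realType) (p n : {finite_measure set T -> \bar R}).

Let measure_add_fin : fin_num_fun (measure_add p n).
Proof. by move=> A mA; rewrite measure_addE fin_numD !fin_num_measure. Qed.

HB.instance Definition _ := Measure.on (measure_add p n).

HB.instance Definition _ :=
  @Measure_isFinite.Build d T R (measure_add p n) measure_add_fin.

End measure_add_finite.

Section charge_integral_theory.
Local Open Scope ereal_scope.
Context d (T : measurableType d) (R : realType).
Implicit Types (p n : {finite_measure set T -> \bar R}) (nu : {charge set T -> \bar R}).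

Definition bounded_measurable (f : T -> R) :=
  measurable_fun setT f /\ [bounded f x | x in [set: T]].

Lemma bounded_measurable_integrable p f : bounded_measurable f ->
  p.-integrable setT (EFin \o f).
Proof.
move=> [mf bf]; apply: measurable_bounded_integrable => //.
by rewrite -ge0_fin_numE ?fin_num_measure.
Qed.

Lemma Rintegral_measure_add p n f : bounded_measurable f ->
  (\int[measure_add p n]_x f x)%R = (\int[p]_x f x + \int[n]_x f x)%R.
Proof.
move=> bf; have ip := bounded_measurable_integrable p bf.
have inn := bounded_measurable_integrable n bf.
rewrite /Rintegral (integral_measure_add measurableT ip inn).
by rewrite fineD//; exact: integrable_fin_num.
Qed.

(** The integral does not depend on how the charge is written as a difference of
    measures, hence it is linear in the charge although the Hahn decomposition
    is not. *)
Lemma charge_integral_diff nu p n f : bounded_measurable f ->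
  (forall A, measurable A -> nu A = p A - n A) ->
  charge_integral nu f = (\int[p]_x f x - \int[n]_x f x)%R.
Proof.
move=> bf nuE; rewrite /charge_integral.
set jp := jordan_pos _; set jn := jordan_neg _.
suff : (\int[jp]_x f x + \int[n]_x f x = \int[p]_x f x + \int[jn]_x f x)%R by lra.
rewrite -!Rintegral_measure_add// /Rintegral; congr fine.
apply: eq_measure_integral => A mA _.
rewrite [LHS](measure_addE jp n) [RHS](measure_addE p jn).
have := nuE A mA; rewrite (jordan_decomp (hahnP nu))// /cadd/= cscaleN1 -/jp -/jn => h.
have pf (q : {finite_measure set T -> \bar R}) : q A \is a fin_num by exact: fin_num_measure.
have fin_swap (a b c e : \bar R) : a \is a fin_num -> b \is a fin_num ->
    c \is a fin_num -> e \is a fin_num -> a - b = c - e -> a + e = c + b.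
  by case: a b c e => [a| |] [b| |] [c| |] [e| |]//= _ _ _ _ [?]; congr EFin; lra.
exact: fin_swap (pf jp) (pf jn) (pf p) (pf n) h.
Qed.

Lemma charge_integral_measure nu p f : bounded_measurable f ->
  (forall A, measurable A -> nu A = p A) -> charge_integral nu f = (\int[p]_x f x)%R.
Proof.
move=> bf nuE; rewrite (@charge_integral_diff nu p mzero)//.
  by rewrite [X in (_ - X)%R]/Rintegral integral_measure_zero subr0.
by move=> A mA; rewrite nuE// sube0.
Qed.

Lemma charge_integralZ nu nu' (r : R) f : (0 <= r)%R -> bounded_measurable f ->
  (forall A, measurable A -> nu' A = r%:E * nu A) ->
  charge_integral nu' f = (r * charge_integral nu f)%R.
Proof.
move=> r0 bf nuE; pose k : {nonneg R} := NngNum r0.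
pose jp := jordan_pos (hahnP nu); pose jn := jordan_neg (hahnP nu).
have sc p : (\int[mscale k p]_x f x)%R = (r * \int[p]_x f x)%R.
  have ip := bounded_measurable_integrable p bf.
  have mf : measurable_fun setT (EFin \o f) by apply/measurable_EFinP; have [] := bf.
  rewrite /Rintegral -[r]/(fine r%:E) -fineM//; last exact: integrable_fin_num.
  congr fine; rewrite [LHS]integralE.
  have -> : \int[p]_x (f x)%:E = \int[p]_x (EFin \o f)^\+ x - \int[p]_x (EFin \o f)^\- x.
    exact: integralE.
  rewrite !ge0_integral_mscale//; [|exact: measurable_funeneg|exact: measurable_funepos].
  by rewrite [RHS]muleBr//; exact: (integrable_add_def measurableT ip).
rewrite (@charge_integral_diff nu' (mscale k jp) (mscale k jn))//.
  by rewrite !sc -mulrBr.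
move=> A mA; rewrite nuE// (jordan_decomp (hahnP nu))// /cadd/= cscaleN1 -/jp -/jn.
by rewrite muleBr// fin_num_adde_defl// fin_numN fin_num_measure.
Qed.

Lemma charge_integralD nu1 nu2 nu f : bounded_measurable f ->
  (forall A, measurable A -> nu A = nu1 A + nu2 A) ->
  charge_integral nu f = (charge_integral nu1 f + charge_integral nu2 f)%R.
Proof.
move=> bf nuE.
pose jp1 := jordan_pos (hahnP nu1); pose jn1 := jordan_neg (hahnP nu1).
pose jp2 := jordan_pos (hahnP nu2); pose jn2 := jordan_neg (hahnP nu2).
rewrite (@charge_integral_diff nu (measure_add jp1 jp2) (measure_add jn1 jn2))//.
  by rewrite !Rintegral_measure_add// /charge_integral -/jp1 -/jp2 -/jn1 -/jn2; lra.
move=> A mA; rewrite nuE// (jordan_decomp (hahnP nu1))// (jordan_decomp (hahnP nu2))//.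
rewrite [X in _ = X - _](measure_addE jp1) [X in _ = _ - X](measure_addE jn1).
rewrite /cadd/= !cscaleN1 -/jp1 -/jp2 -/jn1 -/jn2.
rewrite addeACA; congr (_ + _).
by rewrite fin_num_oppeD// fin_num_measure.
Qed.

End charge_integral_theory.

(** * Measures with a density and their images *)

Section weighted_pushforward.
Local Open Scope ereal_scope.
Context d d' (T : measurableType d) (T' : measurableType d') (R : realType).
Variables (alpha : {measure set T -> \bar R}) (w : T -> R) (p : T -> T').
Hypotheses (mw : measurable_fun setT w) (w0 : forall x, (0 <= w x)%R).
Hypotheses (wfin : \int[alpha]_x (w x)%:E < +oo) (mp : measurable_fun setT p).

(** The hypotheses are arguments of the definition for the measure structure
    to be inferred from the term. *)
Definition weighted_pushforward (_ : measurable_fun setT w) (_ : forall x, (0 <= w x)%R)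
    (_ : \int[alpha]_x (w x)%:E < +oo) (_ : measurable_fun setT p) (A : set T') : \bar R :=
  \int[alpha]_(x in p @^-1` A) (w x)%:E.

Local Notation nu := (weighted_pushforward mw w0 wfin mp).

Let mpA A : measurable A -> measurable (p @^-1` A).
Proof. by move=> mA; rewrite -[X in measurable X]setTI; exact: mp. Qed.

Let mwE D : measurable_fun D (EFin \o w).
Proof. by apply: measurable_funTS; exact/measurable_EFinP. Qed.

Let nu0 : nu set0 = 0.
Proof. by rewrite /weighted_pushforward preimage_set0 integral_set0. Qed.

Let nu_ge0 A : 0 <= nu A.
Proof. by apply: integral_ge0 => x _; rewrite lee_fin. Qed.

Let nu_sigma_additive : semi_sigma_additive nu.
Proof.
move=> F mF tF mUF; rewrite /weighted_pushforward preimage_bigcup.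
have mpF n : measurable (p @^-1` F n) by apply: mpA; exact: mF.
have tpF : trivIset setT (fun n => p @^-1` F n).
  apply/trivIsetP => /= i j _ _ ij; rewrite -preimage_setI.
  by move/trivIsetP : tF => /(_ _ _ _ _ ij) ->//; rewrite preimage_set0.
rewrite (ge0_integral_bigcup alpha mpF (@mwE _) _ tpF)//; last by move=> x _; rewrite lee_fin.
by apply: is_cvg_nneseries => n _ _; apply: integral_ge0 => x _; rewrite lee_fin.
Qed.

HB.instance Definition _ := isMeasure.Build _ _ _ nu nu0 nu_ge0 nu_sigma_additive.

Let nu_fin : fin_num_fun nu.
Proof.
move=> A mA; rewrite ge0_fin_numE//; apply: le_lt_trans wfin.
rewrite /weighted_pushforward; apply: ge0_subset_integral => //.
- exact: mpA.
- by move=> x _; rewrite lee_fin.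
Qed.

HB.instance Definition _ := @Measure_isFinite.Build _ _ _ nu nu_fin.

End weighted_pushforward.

(** Change of variables for a measure with a density followed by an image. The
    layers of [h] and of [h \o p] have the same masses, so the two integrals have
    the same approximations by finite sums. *)
Section weighted_transfer.
Local Open Scope ereal_scope.
Context d d' (T : measurableType d) (T' : measurableType d') (R : realType).
Variables (alpha : {measure set T -> \bar R}) (w : T -> R) (p : T -> T').
Variables (mu : {finite_measure set T' -> \bar R}).
Hypotheses (mw : measurable_fun setT w) (w0 : forall x, (0 <= w x)%R).
Hypothesis (mp : measurable_fun setT p).
Hypothesis muE : forall A, measurable A -> mu A = \int[alpha]_(x in p @^-1` A) (w x)%:E.

Let wfin : \int[alpha]_x (w x)%:E \is a fin_num.
Proof. by rewrite -(preimage_setT p) -muE// fin_num_measure. Qed.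

Lemma weighted_transfer_integrable f : bounded_measurable f ->
  alpha.-integrable setT (fun x => (f (p x) * w x)%:E).
Proof.
move=> [mf [M0 [_ bf]]]; have {bf} := bf (`|M0| + 1)%R.
set M := (`|M0| + 1)%R => bM; have fM x : (`|f x| <= M)%R.
  by apply: bM => //; rewrite (le_lt_trans (ler_norm _))// ltrDl.
have M0' : (0 <= M)%R by rewrite addr_ge0.
apply/integrableP; split.
  by apply/measurable_EFinP; apply: measurable_funM => //; exact: measurableT_comp.
apply: (@le_lt_trans _ _ (\int[alpha]_x (M%:E * (w x)%:E))).
  apply: ge0_le_integral => //.
  - apply/measurable_EFinP; apply: measurableT_comp => //; apply: measurable_funM => //.
    exact: measurableT_comp.
  - by apply: measurable_funeM; exact/measurable_EFinP.
  - by move=> x _; rewrite abse_EFin -EFinM lee_fin normrM ler_pM// ger0_norm.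
rewrite ge0_integralZl//; [|exact/measurable_EFinP|by move=> x _; rewrite lee_fin].
by rewrite -(fineK wfin) -EFinM ltry.
Qed.

Let ge0_weighted_transfer (h : T' -> R) : measurable_fun setT h -> (forall x, 0 <= h x)%R ->
  (exists C, forall x, h x <= C)%R ->
  \int[mu]_x (h x)%:E = \int[alpha]_x (h (p x) * w x)%:E.
Proof.
move=> mh h0 [C hC].
pose c := fine (\int[alpha]_x (w x)%:E).
have cE : \int[alpha]_x (w x)%:E = c%:E by rewrite fineK.
have c0 : (0 <= c)%R by rewrite fine_ge0// integral_ge0// => x _; rewrite lee_fin.
have mhp : measurable_fun setT (h \o p) by exact: measurableT_comp.
have m1 : measurable_fun setT (cst 1%R : T' -> R) by exact: measurable_cst.
have layersE e N : layer_sum mu (cst 1%R) h e N = layer_sum alpha w (h \o p) e N.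
  apply: eq_bigr => k _; congr (_ * _).
  have mk : measurable [set x | (k.+1%:R * e < h x)%R].
    exact: measurable_superlevel.
  by rewrite [LHS](integral_cst mu mk 1) mul1e [LHS]muE.
have int1 : \int[mu]_x (cst 1%R x)%:E = c%:E.
  by rewrite [LHS](integral_cst mu measurableT 1) mul1e [LHS]muE// preimage_setT cE.
have step (e : R) : (0 < e)%R -> exists d N, [/\ (0 < d)%R, (d * c <= e)%R & (C <= N%:R * d)%R].
  move=> e0; exists (e / (c + 1))%R, (Num.Def.archi_bound (`|C| / (e / (c + 1)))%R).
  have d0 : (0 < e / (c + 1))%R by rewrite divr_gt0// ltr_wpDl.
  split => //; first by rewrite mulrAC ler_pdivrMr ?ltr_wpDl// ler_pM2l// lerDl.
  rewrite -ler_pdivrMr//; apply: (@le_trans _ _ (`|C| / (e / (c + 1)))%R).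
    by rewrite ler_pM2r ?invr_gt0// ler_norm.
  by apply/ltW/archi_boundP; rewrite divr_ge0// ltW.
have mu1 : \int[mu]_x (h x)%:E = \int[mu]_x (h x * cst 1%R x)%:E.
  by apply: eq_integral => x _; rewrite /= mulr1.
rewrite mu1; apply/eqP; rewrite eq_le; apply/andP; split; apply/lee_addgt0Pr => e /step[a [N [a0 ac CN]]].
- apply: (le_trans (le_layer_sum mu m1 mh (fun=> ler01) (N := N) a0 h0 _)).
    by move=> x; exact: le_trans (hC x) CN.
  apply: leeD; last by rewrite int1 -EFinM lee_fin.
  by rewrite layersE; apply: layer_sum_le => // x; exact: h0.
- apply: (le_trans (le_layer_sum alpha mw mhp w0 (N := N) a0 (fun x => h0 (p x)) _)).
    by move=> x; exact: le_trans (hC (p x)) CN.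
  apply: leeD; last by rewrite cE -EFinM lee_fin.
  by rewrite -layersE; exact: layer_sum_le.
Qed.

Lemma Rintegral_weighted_transfer f : bounded_measurable f ->
  (\int[mu]_x f x = \int[alpha]_x (f (p x) * w x))%R.
Proof.
move=> bf; have [mf [M0 [_ bM]]] := bf; have {bM} := bM (`|M0| + 1)%R.
set M := (`|M0| + 1)%R => bM; have fM x : (`|f x| <= M)%R.
  by apply: bM => //; rewrite (le_lt_trans (ler_norm _))// ltrDl.
have bc : bounded_measurable (cst M : T' -> R).
  by split; [exact: measurable_cst|exact: bounded_cst].
pose g x := (f x + M)%R.
have bg : bounded_measurable g.
  split; first by apply: measurable_funD.
  exists (M + M)%R; split; first exact: num_real.
  move=> x Mx y _ /=; apply: ltW; apply: le_lt_trans Mx.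
  by apply: (le_trans (ler_normD _ _)); rewrite lerD// ger0_norm// addr_ge0.
have h : (\int[mu]_x g x = \int[alpha]_x (g (p x) * w x))%R.
  rewrite /Rintegral; congr fine; apply: ge0_weighted_transfer; first by have [] := bg.
    by move=> x; rewrite /g; have := fM x; rewrite ler_norml => /andP[]; lra.
  by exists (M + M)%R => x; rewrite /g lerD2r; apply: le_trans (fM x); exact: ler_norm.
have hc : (\int[mu]_x cst M x = \int[alpha]_x (cst M (p x) * w x))%R.
  rewrite /Rintegral; congr fine; apply: ge0_weighted_transfer => //=; last by exists M.
  by move=> x; rewrite addr_ge0.
have eg : (\int[mu]_x g x = \int[mu]_x f x + \int[mu]_x cst M x)%R.
  by apply: RintegralD => //; exact: bounded_measurable_integrable.
have eg' : (\int[alpha]_x (g (p x) * w x) =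
    \int[alpha]_x (f (p x) * w x) + \int[alpha]_x (cst M (p x) * w x))%R.
  rewrite -RintegralD//; [|exact: weighted_transfer_integrable|exact: weighted_transfer_integrable].
  by apply: eq_Rintegral => x _; rewrite -mulrDl.
by move: h; rewrite eg eg' hc => /addIr.
Qed.

End weighted_transfer.

(** * Borel functions and Urysohn functions *)

Lemma continuous_borel_measurable (U V : ptopologicalType) (f : U -> V) :
  continuous f -> measurable_fun setT (f : borel U -> borel V).
Proof.
move=> cf; apply: (@measurability _ _ (borel U) (borel V) setT f (@open V) erefl).
move=> _ [A oA <-]; rewrite setTI; apply: sub_sigma_algebra.
by apply: (@open_comp U V f A) => // x _; exact: cf.
Qed.

Lemma continuous_real_measurable (R : realType) (U : ptopologicalType) (f : U -> R) :
  continuous f -> measurable_fun setT (f : borel U -> R).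
Proof.
move=> cf; apply: measurable_open_superlevel => a.
by apply: (@open_comp _ _ f [set x | a < x]) => [y _|]; [exact: cf|exact: open_gt].
Qed.

Lemma Cb_bounded_measurable (R : realType) (X : ptopologicalType) (phi : Cb R X) :
  bounded_measurable (phi : borel X -> R).
Proof.
split; last exact: Cb_bounded.
by apply: continuous_real_measurable; exact: Cb_continuous.
Qed.

(** Off the vertex the base point is continuous; the vertex is a closed point, and
    it does not matter on which side of the preimage it falls. *)
Lemma measurable_base (R : realType) (X : ptopologicalType) :
  measurable_fun setT (@base R X : borel (cone R X) -> borel X).
Proof.
apply: (@measurability _ _ (borel (cone R X)) (borel X) setT _ (@open X) erefl) => _ [U oU <-]; rewrite setTI.
have oP : open [set c : cone R X | 0 < (rad c)%:num].
  apply: (@open_comp _ _ (fun c : cone R X => (rad c)%:num) [set x | 0 < x]) => [c _|].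
    exact: rad_continuous.
  exact: open_gt.
have oPU : open [set c : cone R X | 0 < (rad c)%:num /\ U (base c)].
  rewrite openE => c [/= c0 Uc]; apply: filterI; first exact: (open_nbhs_nbhs (conj oP c0)).
  by apply: (@base_continuous R X c _ U); [rewrite gt_eqF|exact: open_nbhs_nbhs].
have mo (A : set (cone R X)) : open A -> measurable (A : set (borel (cone R X))).
  by move=> ?; exact: sub_sigma_algebra.
have mPU := mo _ oPU; have mP := mo _ oP.
have [Uv|Uv] := pselect (U (base (cpt point 0%:nng : cone R X))).
  rewrite (_ : _ @^-1` U = [set c : cone R X | 0 < (rad c)%:num /\ U (base c)] `|`
      ~` [set c : cone R X | 0 < (rad c)%:num]).
    exact: (measurableU _ _ mPU (measurableC mP)).
  apply/seteqP; split => [c Uc|c [[]//|]].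
    by have [c0|c0] := pselect (0 < (rad c)%:num); [left|right].
  by move=> /negP; rewrite /= rad_gt0 negbK rad_eq0 => /eqP ->.
rewrite (_ : _ @^-1` U = [set c : cone R X | 0 < (rad c)%:num /\ U (base c)])//.
apply/seteqP; split => [c Uc|c []//]; split => //.
by rewrite rad_gt0; apply/eqP => /eqP; rewrite rad_eq0 => /eqP c0; apply: Uv; rewrite -c0.
Qed.

(** Complete regularity gives, around each point of [K], a function that is small
    there and 1 off [U]. Finitely many of them are multiplied together, and the
    product is cut off at the value [2^-1]. *)
Lemma compact_open_urysohn (R : realType) (X : completelyRegularType) (K U : set X) :
  compact K -> open U -> K `<=` U ->
  exists phi : Cb R X, [/\ forall x, 0 <= phi x <= 1, forall x, K x -> phi x = 1 &
    forall x, ~ U x -> phi x = 0].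
Proof.
move=> cK oU KU.
pose G := [set g : X -> R | [/\ continuous g, forall x, 0 <= g x <= 1 &
  forall x, ~ U x -> g x = 1]].
pose F := filter_from G (fun g => [set h | G h /\ forall x, h x <= g x]).
have G1 : G (cst 1).
  by split => // [x|x]; [exact: cvg_cst|rewrite ler01 lexx].
have GM g h : G g -> G h -> G (g * h).
  move=> [cg g01 g1] [ch h01 h1]; split.
  - by move=> x; apply: cvgM; [exact: cg|exact: ch].
  - move=> x; have /andP[? ?] := g01 x; have /andP[? ?] := h01 x.
    by rewrite mulr_ge0//= mulr_ile1.
  - by move=> x nU; rewrite /= fctE g1// h1// mulr1.
have GMl g h x : G g -> G h -> (g * h) x <= g x.
  move=> [_ g01 _] [_ h01 _]; have /andP[? ?] := g01 x; have /andP[? ?] := h01 x.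
  by rewrite fctE ler_piMr.
have FF : Filter F.
  apply: filter_from_filter; first by exists (cst 1).
  move=> g h Gg Gh; exists (g * h); first exact: GM.
  move=> k [Gk kgh]; split; split => // x; apply: le_trans (kgh x) _; first exact: GMl.
  by rewrite mulrC; exact: GMl.
have [|g0 Gg0 gK] := (compact_near_coveringP K).1 cK _ F (fun g x => g x < 2^-1) _.
  move=> x Kx.
  have /(@uniform_separatorP _ R)[f [cf f01 fx fU]] :=
    @completely_regular_subproof X x (~` U) (open_closedC oU) (fun nU => nU (KU _ Kx)).
  have Gf : G f.
    split => //; first by move=> y; have := f01 (f y) (ex_intro2 _ _ y I erefl); rewrite /= in_itv.
    by move=> y nU; apply: fU; exists y.
  exists (f @^-1` [set t | t < 2^-1], [set h | G h /\ forall x, h x <= f x]) => /=.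
    split; last by exists f.
    by apply: cf; apply: lt_nbhsl; rewrite (fx (f x))//; exists x.
  by move=> [y h] /= [fy [_ hf]]; exact: le_lt_trans (hf y) fy.
have g0K := gK g0 (conj Gg0 (fun=> lexx _)).
have [cg g01 g1] := Gg0.
pose phi x := Num.min 1 (2 * (1 - g0 x)).
have phi01 x : 0 <= phi x <= 1.
  rewrite /phi ge_min lexx le_min ler01/= andbT mulr_ge0// subr_ge0.
  by have /andP[] := g01 x.
have cphi : continuous phi.
  move=> x; apply: (@continuous_min _ _ (cst 1) (fun x => 2 * (1 - g0 x))).
    exact: cvg_cst.
  apply: cvgM; first exact: cvg_cst.
  by apply: cvgB; [exact: cvg_cst|exact: cg].
have bphi : [bounded phi x | x in [set: X]].
  exists 1; split; first exact: num_real.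
  move=> M M1 x _ /=; have /andP[p0 p1] := phi01 x.
  by rewrite ger0_norm// (le_trans p1)// ltW.
exists (MkCb cphi bphi); split => //= x.
  move=> /g0K /= gx; rewrite /phi; apply/min_idPl.
  by rewrite -ler_pdivrMl//; lra.
by move=> /g1 gx; rewrite /phi gx subrr mulr0; apply/min_idPr.
Qed.

(** * Radon measures and test functions *)

Lemma lee_compl (R : realType) (a b c e : \bar R) :
  a \is a fin_num -> c \is a fin_num -> (b + e = a + c -> c <= e -> b <= a)%E.
Proof.
move: a b c e => [a| |]// [b| |] [c| |]// [e| |]//= _ _ [h]; rewrite ?lee_fin ?leNye//.
by move=> ?; lra.
Qed.

Section measure_of_sradon.
Local Open Scope ereal_scope.
Variables (R : realType) (X : completelyRegularType).

Definition measure_of_sradon (m : sradon R X) (m_ge0 : nonneg_sradon m) :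
  set (borel X) -> \bar R := measure_of_charge m m_ge0.

Section finite.
Variables (m : sradon R X) (m_ge0 : nonneg_sradon m).

HB.instance Definition _ := Measure.on (measure_of_sradon m_ge0).

Let measure_of_sradon_fin : fin_num_fun (measure_of_sradon m_ge0).
Proof. by move=> A mA; exact: (fin_num_measure m). Qed.

HB.instance Definition _ := @Measure_isFinite.Build _ (borel X) R
  (measure_of_sradon m_ge0) measure_of_sradon_fin.

Lemma measure_of_sradon_radon : radon (measure_of_sradon m_ge0).
Proof.
move=> A e mA e0; have [K [cK KA hK]] := @sradonP R X m A e mA e0.
exists K; split => //; apply: le_trans hK.
have mAK : measurable (A `\` K : set (borel X)).
  by apply: measurableD => //; exact: compact_borel.
by apply: le_trans (total_variation_abs m mAK); rewrite gee0_abs.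
Qed.

Lemma charge_integral_sradon (phi : Cb R X) :
  charge_integral m phi = (\int[measure_of_sradon m_ge0]_x phi x)%R.
Proof. by apply: charge_integral_measure => //; exact: Cb_bounded_measurable. Qed.

End finite.

Lemma open_borel (U : set X) : open U -> measurable (U : set (borel X)).
Proof. exact: sub_sigma_algebra. Qed.

Lemma measure_le_integral_Cb (mu : {finite_measure set (borel X) -> \bar R}) (K : set X) (phi : Cb R X) :
  compact K -> (forall x, 0 <= phi x)%R -> (forall x, K x -> 1 <= phi x)%R ->
  mu K <= (\int[mu]_x phi x)%:E.
Proof.
move=> cK p0 p1; have mK := compact_borel cK; have bp := Cb_bounded_measurable phi.
rewrite fineK; last by apply: integrable_fin_num => //; exact: bounded_measurable_integrable.
rewrite -[mu K]mul1e -integral_cst// integral_mkcond.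
apply: ge0_le_integral => //.
- by move=> x _; apply: erestrict_ge0.
- by apply/measurable_restrict => //; exact: measurable_cst.
- by apply/measurable_EFinP; exact: bp.1.
- move=> x _; rewrite /patch; case: ifPn => [|_]; last by rewrite lee_fin.
  by rewrite inE => /p1; rewrite lee_fin.
Qed.

Lemma integral_Cb_le_measure (mu : {finite_measure set (borel X) -> \bar R}) (U : set X) (phi : Cb R X) :
  open U -> (forall x, 0 <= phi x <= 1)%R -> (forall x, ~ U x -> phi x = 0)%R ->
  (\int[mu]_x phi x)%:E <= mu U.
Proof.
move=> oU p01 p0; have mU := open_borel oU; have bp := Cb_bounded_measurable phi.
rewrite fineK; last by apply: integrable_fin_num => //; exact: bounded_measurable_integrable.
rewrite -[mu U]mul1e -integral_cst// [leRHS]integral_mkcond.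
apply: ge0_le_integral => //.
- by move=> x _; rewrite lee_fin; have /andP[] := p01 x.
- by apply/measurable_EFinP; exact: bp.1.
- by apply/measurable_restrict => //; exact: measurable_cst.
- move=> x _; rewrite /patch; case: ifPn; first by rewrite lee_fin; have /andP[] := p01 x.
  by rewrite notin_setE => /p0 ->.
Qed.

Definition Cb_cst (c : R) : Cb R X := MkCb (@cst_continuous X R c) (bounded_cst c setT).

(** Urysohn functions compare the measures of a compact set and of an open set
    around it, and these determine Radon measures. *)
Lemma radon_eq (mu nu : {finite_measure set (borel X) -> \bar R}) :
  radon mu -> radon nu ->
  (forall phi : Cb R X, (forall x, 0 <= phi x <= 1)%R ->
    (\int[nu]_x phi x = \int[mu]_x phi x)%R) ->
  forall A, measurable A -> nu A = mu A.
Proof.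
move=> rmu rnu H.
have finm (m : {finite_measure set (borel X) -> \bar R}) (A : set (borel X)) :
  measurable A -> m A \is a fin_num by move=> ?; exact: fin_num_measure.
have muT : nu setT = mu setT.
  have c01 x : (0 <= Cb_cst 1 x <= 1)%R by rewrite /= ler01 lexx.
  have := H (Cb_cst 1) c01; rewrite /Rintegral/= => h.
  rewrite -(fineK (finm nu _ measurableT)) -(fineK (finm mu _ measurableT)).
  rewrite -[nu setT]mul1e -[mu setT]mul1e -!integral_cst//.
  by rewrite [X in X%:E]h.
have leU (U : set X) : open U -> mu U <= nu U.
  move=> oU; apply/lee_addgt0Pr => e e0.
  have mU := open_borel oU; have [K [cK KU hK]] := rmu U e mU e0.
  have mK := compact_borel cK.
  rewrite -(setDUK KU) measureU//; [|exact: measurableD|exact: setDIK].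
  rewrite setDUK//; apply: leeD => //.
  have [phi [p01 p1 p0]] := compact_open_urysohn R cK oU KU.
  apply: (@le_trans _ _ (\int[nu]_x phi x)%:E); last exact: integral_Cb_le_measure.
  rewrite H//; apply: measure_le_integral_Cb => // x; first by have /andP[] := p01 x.
  by move=> /p1 ->.
have leA (A : set (borel X)) : measurable A -> nu A <= mu A.
  move=> mA; apply/lee_addgt0Pr => e e0; have [K [cK KA hK]] := rnu A e mA e0.
  have mK := compact_borel cK.
  rewrite -(setDUK KA) measureU//; [|exact: measurableD|exact: setDIK].
  rewrite setDUK//; apply: leeD => //; apply: (@le_trans _ _ (mu K)); last first.
    by apply: le_measure; rewrite ?inE.
  have oK : open (~` K) by apply: closed_openC; apply: compact_closed => //; exact: hausdorff_subproof.
  have mT := muT.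
  rewrite -(setUv K) !measureU// ?setICr// in mT; [|exact: measurableC|exact: measurableC].
  exact: lee_compl (finm mu _ mK) (finm mu _ (measurableC mK)) mT (leU _ oK).
move=> A mA; apply/eqP; rewrite eq_le leA//=.
have mT := muT.
rewrite -(setUv A) !measureU// ?setICr// in mT; [|exact: measurableC|exact: measurableC].
exact: lee_compl (finm nu _ mA) (finm nu _ (measurableC mA)) (esym mT) (leA _ (measurableC mA)).
Qed.

(** A test function which is 1 on a compact [K] inside [A], and 0 off a
    neighbourhood of [K] of small additional total variation, has an integral
    close to [m A]. *)
Lemma nonneg_sradonP (m : sradon R X) :
  (forall phi : Cb R X, (forall x, 0 <= phi x <= 1)%R -> (0 <= charge_integral m phi)%R) ->
  nonneg_sradon m.
Proof.
move=> H A; have [mA|nA] := pselect (measurable A); last by rewrite sradon_nmeasurable.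
have finm (B : set (borel X)) : measurable B -> m B \is a fin_num.
  by move=> ?; exact: fin_num_measure.
apply/lee_addgt0Pr => e e0; have e20 : (0 < e / 2)%R by rewrite divr_gt0.
have [K [cK KA hK]] := @sradonP R X m A _ mA e20.
have mK := compact_borel cK.
have [L [cL LK hL]] := @sradonP R X m (~` K) _ (measurableC mK) e20.
have oL : open (~` L).
  by apply: closed_openC; apply: compact_closed => //; exact: hausdorff_subproof.
have KL : K `<=` ~` L by move=> x Kx /LK; exact.
have [phi [p01 p1 p0]] := compact_open_urysohn R cK oL KL.
have := H phi p01; rewrite -lee_fin; move=> h0; apply: (le_trans h0).
have mL := compact_borel cL.
set tv := total_variation m in hK hL *.
have hA : m K <= m A + (e / 2)%:E.
  have mAK : measurable (A `\` K : set (borel X)) by exact: measurableD.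
  rewrite -[X in _ <= m X + _](setDUK KA) chargeU//; last exact: setDIK.
  rewrite -addeA -[leLHS]adde0 leeD2lE ?finm//.
  have : - (e / 2)%:E <= m (A `\` K).
    rewrite leeNl; apply: le_trans hK; apply: le_trans (total_variation_abs m mAK).
    by rewrite -abseN lee_abs.
  move: (finm _ mAK); case: (m (A `\` K)) => [x| |]//= _.
  by rewrite -?EFinN -?EFinD !lee_fin; lra.
apply: (@le_trans _ _ (m K + (e / 2)%:E)); last first.
  by apply: (le_trans (leeD hA (lexx _))); rewrite -addeA -EFinD -splitr.
rewrite /charge_integral EFinB.
set jp := jordan_pos _; set jn := jordan_neg _.
have mLK : measurable (~` L `\` K : set (borel X)) by apply: measurableD => //; exact: measurableC.
have h1 : (\int[jp]_x phi x)%:E <= jp K + (e / 2)%:E.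
  apply: le_trans (integral_Cb_le_measure _ oL p01 p0) _.
  rewrite -(setDUK KL) measureU//; last exact: setDIK.
  apply: leeD => //.
  apply: le_trans hL.
  rewrite (_ : ~` L `\` K = ~` K `\` L); last by rewrite !setDE setIC.
  by rewrite /tv/= /total_variation/= /charge_variation leeDl.
have h2 : jn K <= (\int[jn]_x phi x)%:E.
  by apply: measure_le_integral_Cb => // x; [have /andP[] := p01 x|move=> /p1 ->].
have h3 : m K = jp K - jn K.
  by rewrite [LHS](jordan_decomp (hahnP m))// /cadd/= cscaleN1.
rewrite h3 addeAC; exact: leeB.
Qed.

End measure_of_sradon.

(** * Marginals of a measure on a product of cones *)

Section marginal.
Local Open Scope ereal_scope.
Variables (R : realType) (Y : ptopologicalType) (X : completelyRegularType).
Variables (pr : Y -> cone R X) (cpr : continuous pr).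
Variables (alpha : {finite_measure set (borel Y) -> \bar R}) (S : set Y).
Hypotheses (hY : hausdorff_space Y) (oS : open (~` S)) (aS : alpha (~` S) = 0).
Hypothesis ralpha : radon alpha.
Hypothesis (radS : forall p, S p -> ((rad (pr p))%:num <= 1)%R).

Lemma null_compl_integral (D : set (borel Y)) (f g : borel Y -> \bar R) :
  measurable D -> measurable_fun setT f -> measurable_fun setT g ->
  (forall p, 0 <= f p) -> (forall p, 0 <= g p) ->
  (forall p, S p -> f p = g p) ->
  \int[alpha]_(p in D) f p = \int[alpha]_(p in D) g p.
Proof.
move=> mD mf mg f0 g0 fg.
have mS : measurable (~` S : set (borel Y)) by exact: sub_sigma_algebra.
apply: ge0_ae_eq_integral => //; [exact: measurable_funTS|exact: measurable_funTS|].
exists (~` S); split => // p /=; apply: contra_not => Sp _; apply: fg.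
exact: Sp.
Qed.

(* The density is truncated at 1, which changes nothing on [S] and makes the
   image measure finite everywhere. *)
Let rad_pr (p : Y) : R := (rad (pr p))%:num.
Let w (p : Y) : R := Num.min (rad_pr p) 1%R.
Let bpr (p : Y) : borel X := base (pr p).

Lemma continuous_rad_pr : continuous rad_pr.
Proof. by move=> p; exact: (@continuous_comp _ _ _ pr (fun c : cone R X => (rad c)%:num : R) p (@cpr p) (@rad_continuous R X _)). Qed.

Let mrad : measurable_fun setT (rad_pr : borel Y -> R).
Proof. exact: continuous_real_measurable continuous_rad_pr. Qed.

Let mw : measurable_fun setT (w : borel Y -> R).
Proof. exact: measurable_minr. Qed.

Let w0 p : (0 <= w p)%R.
Proof. by rewrite /w le_min ler01 andbT /rad_pr. Qed.

Let wfin : \int[alpha]_p (w p)%:E < +oo.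
Proof.
apply: (@le_lt_trans _ _ (\int[alpha]_p (cst 1 p))); last first.
  by rewrite integral_cst// mul1e -ge0_fin_numE// fin_num_measure.
apply: ge0_le_integral => //.
- by move=> p _; rewrite lee_fin.
- exact/measurable_EFinP.
- by move=> p _; rewrite lee_fin /w ge_min lexx orbT.
Qed.

Let mbpr : measurable_fun setT (bpr : borel Y -> borel X).
Proof. exact: measurableT_comp (@measurable_base R X) (continuous_borel_measurable cpr). Qed.

Lemma measurable_above (A : set (borel X)) : measurable A ->
  measurable ([set p | (0 < (rad (pr p))%:num)%R /\ A (base (pr p))] : set (borel Y)).
Proof.
move=> mA; rewrite (_ : [set _ | _] = [set p | (0 < rad_pr p)%R] `&` bpr @^-1` A)//.
apply: measurableI; first exact: measurable_superlevel.
by rewrite -[X in measurable X]setTI; exact: mbpr.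
Qed.

Local Notation nu := (weighted_pushforward mw w0 wfin mbpr).

Let nuE (A : set (borel X)) : measurable A -> nu A =
  \int[alpha]_(p in [set p | (0 < (rad (pr p))%:num)%R /\ A (base (pr p))]) (w p)%:E.
Proof.
move=> mA; rewrite /weighted_pushforward integral_mkcond [RHS]integral_mkcond.
apply: eq_integral => p _; rewrite /patch.
case: ifPn; rewrite ?inE ?notin_setE/= => Ap; case: ifPn => //; rewrite ?inE ?notin_setE/=.
  move=> /not_andP[|//] /negP; rewrite rad_gt0 negbK /w /rad_pr => /eqP ->.
  by rewrite min_l// ler01.
by case.
Qed.

Let nu_radon : radon nu.
Proof.
move=> A e mA e0; have mBA := measurable_above mA.
have [K [cK KB hK]] := ralpha mBA e0.
pose L : set X := bpr @` K.
have cL : compact L.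
  apply: continuous_compact => //; apply: continuous_in_subspaceT => p /[!inE] Kp.
  have [p0 _] := KB _ Kp.
  apply: (@cvg_comp _ _ _ pr _ _ _ _ (@cpr p)); apply: base_continuous.
  by rewrite gt_eqF.
exists L; split => //; first by move=> _ [p Kp <-]; have [] := KB _ Kp.
have mL := compact_borel cL.
have mK : measurable (K : set (borel Y)).
  rewrite -[K]setCK; apply: measurableC; apply: sub_sigma_algebra.
  by apply: closed_openC; exact: compact_closed.
have mAL : measurable (A `\` L : set (borel X)) by exact: measurableD.
apply: le_trans hK; rewrite nuE//.
rewrite -[leRHS]mul1e -integral_cst; last exact: measurableD.
rewrite [leLHS]integral_mkcond [leRHS]integral_mkcond; apply: ge0_le_integral => //.
- by move=> p _; apply: erestrict_ge0 => q _; rewrite lee_fin.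
- apply/measurable_restrict => //; first exact: measurable_above.
  by apply: measurable_funTS; exact/measurable_EFinP.
- by apply/measurable_restrict => //; exact: measurableD.
- move=> p _; rewrite /patch; case: ifPn; rewrite ?inE ?notin_setE/=.
    move=> [p0 [Ap nL]]; rewrite ifT; first by rewrite lee_fin /w ge_min lexx orbT.
    by rewrite inE; split => // Kp; apply: nL; exists p.
  by move=> _; case: ifPn => // _; rewrite lee_fin.
Qed.

(** The weighted image of [alpha] is Radon, because the base point depends
    continuously on [p] off the vertex and the weight vanishes at the vertex;
    it has the same integrals as [m], and these determine a Radon measure. *)
Lemma marginal_of_integrals (m : sradon R X) : nonneg_sradon m ->
  (forall (phi : Cb R X) (g : Y -> R), (forall x, 0 <= phi x <= 1)%R ->
    continuous g -> (forall p, 0 <= g p <= 1)%R ->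
    (forall p, S p -> g p = phi (base (pr p)) * (rad (pr p))%:num)%R ->
    \int[alpha]_p (g p)%:E = (charge_integral m phi)%:E) ->
  forall A : set (borel X), measurable A ->
    m A = \int[alpha]_(p in [set p | (0 < (rad (pr p))%:num)%R /\ A (base (pr p))])
      (rad (pr p))%:num%:E.
Proof.
move=> m0 H A mA.
have mrad' : measurable_fun setT (EFin \o rad_pr : borel Y -> \bar R) by exact/measurable_EFinP.
have mw' : measurable_fun setT (EFin \o w : borel Y -> \bar R) by exact/measurable_EFinP.
rewrite (_ : m A = nu A).
  rewrite nuE//; apply: null_compl_integral => //.
  - exact: measurable_above.
  - by move=> p Sp; rewrite /w min_l//; exact: radS.
apply/esym; apply: (@radon_eq R X (measure_of_sradon m0) nu) => //.
  exact: measure_of_sradon_radon.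
move=> phi p01; rewrite -charge_integral_sradon.
rewrite (@Rintegral_weighted_transfer _ _ (borel Y) (borel X) R alpha w bpr nu mw w0 mbpr
  (fun _ _ => erefl) _ (Cb_bounded_measurable phi)).
pose f p := (phi (base (pr p)) * (rad (pr p))%:num)%R.
have f0 p : (0 <= f p)%R by rewrite mulr_ge0//; have /andP[] := p01 (base (pr p)).
have cf : continuous f.
  move=> p; have crb := @rad_base_continuous R X phi (@Cb_continuous _ _ phi) (Cb_bounded phi).
  exact: (@continuous_comp _ _ _ pr _ p (@cpr p) (@crb (pr p))).
pose g p := Num.min (f p) 1%R.
have cg : continuous g.
  by move=> p; apply: (@continuous_min _ _ f (cst 1%R)); [exact: cf|exact: cvg_cst].
have fS p : S p -> (f p <= 1)%R.
  by move=> Sp; rewrite mulr_ile1 ?radS//; have /andP[] := p01 (base (pr p)).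
rewrite /Rintegral -[RHS]/(fine (charge_integral m phi)%:E) -(H phi g)//; last 2 first.
- by move=> p; rewrite /g ge_min lexx orbT le_min f0 ler01.
- by move=> p Sp; rewrite /g min_l//; exact: fS.
congr fine; apply: null_compl_integral => //.
- apply/measurable_EFinP; apply: measurable_funM => //.
  by apply: (measurableT_comp _ mbpr); have [] := Cb_bounded_measurable phi.
- by apply/measurable_EFinP; exact: continuous_real_measurable.
- by move=> p; rewrite lee_fin mulr_ge0//; have /andP[] := p01 (bpr p).
- by move=> p; rewrite lee_fin /g le_min f0 ler01.
- by move=> p Sp; rewrite /g min_l ?fS// /w min_l ?radS.
Qed.

End marginal.

(** * Test pairs and the dual problem *)

Section Cb_vector.
Variables (R : realType) (X : topologicalType).

Lemma bounded_lin (a : R) (f g : X -> R) : [bounded f x | x in [set: X]] ->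
  [bounded g x | x in [set: X]] -> [bounded a * f x + g x | x in [set: X]].
Proof.
move=> [M [Mr fM]] [N [Nr gN]]; exists (`|a| * (`|M| + 1) + (`|N| + 1)).
split=> [|K hK x _ /=]; first exact: num_real.
apply: le_trans (ltW hK); apply: (le_trans (ler_normD _ _)).
rewrite normrM lerD// ?ler_wpM2l//.
  by apply: fM => //; rewrite (le_lt_trans (ler_norm _))// ltrDl.
by apply: gN => //; rewrite (le_lt_trans (ler_norm _))// ltrDl.
Qed.

Lemma continuous_lin (a : R) (f g : X -> R) : continuous f -> continuous g ->
  continuous (fun x => a * f x + g x).
Proof.
move=> cf cg x; apply: cvgD; last exact: cg.
by apply: cvgM; [exact: cvg_cst|exact: cf].
Qed.

Definition Cb_lin (a : R) (f g : Cb R X) : Cb R X :=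
  MkCb (continuous_lin (a := a) (@Cb_continuous _ _ f) (@Cb_continuous _ _ g))
    (bounded_lin a (Cb_bounded f) (Cb_bounded g)).

End Cb_vector.

Section duality.
Local Open Scope ereal_scope.
Variables (R : realType) (X1 X2 : completelyRegularType).
Local Notation Y := (cone R X1 * cone R X2)%type.
Implicit Types (phi : Cb R X1 * Cb R X2) (mu : sradon R X1 * sradon R X2) (p : Y).

(** A section of the rays on which the radii are bounded; by homogeneity it
    suffices to look for couplings supported there. *)
Definition slice : set Y := [set p | (rad p.1)%:num + (rad p.2)%:num = 1 :> R]%R.

Definition cone_sum phi p : R :=
  (phi.1 (base p.1) * (rad p.1)%:num + phi.2 (base p.2) * (rad p.2)%:num)%R.

Definition pairing mu phi : R :=
  (charge_integral mu.1 phi.1 + charge_integral mu.2 phi.2)%R.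

Definition Cb2_lin (a : R) phi psi : Cb R X1 * Cb R X2 :=
  (Cb_lin a phi.1 psi.1, Cb_lin a phi.2 psi.2).

Lemma cone_sum_lin a phi psi p :
  cone_sum (Cb2_lin a phi psi) p = (a * cone_sum phi p + cone_sum psi p)%R.
Proof. by rewrite /cone_sum /=; ring. Qed.

Lemma charge_integral_lin (X : completelyRegularType) (m : sradon R X) a (f g : Cb R X) :
  charge_integral m (Cb_lin a f g) = (a * charge_integral m f + charge_integral m g)%R.
Proof.
have H (p : {finite_measure set (borel X) -> \bar R}) :
    (\int[p]_x Cb_lin a f g x = a * \int[p]_x f x + \int[p]_x g x)%R.
  have i1 := bounded_measurable_integrable p (Cb_bounded_measurable f).
  have i2 := bounded_measurable_integrable p (Cb_bounded_measurable g).
  rewrite -RintegralZl// -RintegralD//.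
  exact: (integrableZl measurableT a i1).
by rewrite /charge_integral !H; ring.
Qed.

Lemma pairing_lin mu a phi psi :
  pairing mu (Cb2_lin a phi psi) = (a * pairing mu phi + pairing mu psi)%R.
Proof. by rewrite /pairing !charge_integral_lin; ring. Qed.

Definition dual (H : Y -> \bar R) mu : \bar R :=
  ereal_sup [set (pairing mu phi)%:E | phi in Phi H].

Definition Cb2_cst (c : R) : Cb R X1 * Cb R X2 := (Cb_cst X1 c, Cb_cst X2 c).

Lemma cone_sum_cst c p : slice p -> cone_sum (Cb2_cst c) p = c.
Proof. by rewrite /slice/= /cone_sum/= -mulrDr => ->; rewrite mulr1. Qed.

Lemma charge_integral0 (X : completelyRegularType) (m : sradon R X) :
  charge_integral m (Cb_cst X (0%R : R)) = 0%R.
Proof. by rewrite /charge_integral /= !Rintegral_cst// !mul0r subrr. Qed.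

Lemma pairing0 mu : pairing mu (Cb2_cst 0) = 0%R.
Proof. by rewrite /pairing !charge_integral0 addr0. Qed.

Variable H : Y -> \bar R.
Hypothesis H_ge0 : forall p, 0 <= H p.

Lemma Phi0 : Phi H (Cb2_cst 0).
Proof. by move=> x1 x2 r1 r2; rewrite /= !mul0r addr0. Qed.

Lemma dual_ge0 mu : 0 <= dual H mu.
Proof.
apply: ereal_sup_ubound; exists (Cb2_cst 0); first exact: Phi0.
by rewrite pairing0.
Qed.

Hypothesis H_homogeneous : radially_1homogeneous H.

Lemma Phi_cone_sum phi : Phi H phi <-> forall p, (cone_sum phi p)%:E <= H p.
Proof.
split=> [P p|P x1 x2 r1 r2].
  have := P (base p.1) (base p.2) (rad p.1) (rad p.2).
  by rewrite !cptK -surjective_pairing.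
have := P (cpt x1 r1, cpt x2 r2); rewrite /cone_sum/= !rad_cpt.
have E (X : completelyRegularType) (f : X -> R) (x : X) (r : {nonneg R}) :
    (f (base (cpt x r : cone R X)) * r%:num = f x * r%:num)%R.
  by have [->|r0] := eqVneq r%:num 0%R; rewrite ?mulr0// base_cpt.
by rewrite !E.
Qed.

Lemma homogeneousE p (l : R) : (0 < l)%R ->
  exists q : Y, [/\ H q = l%:E * H p, forall phi, cone_sum phi q = (l * cone_sum phi p)%R,
    (rad q.1)%:num = (l * (rad p.1)%:num)%R & (rad q.2)%:num = (l * (rad p.2)%:num)%R].
Proof.
move=> l0.
have l00 : (0 <= l)%R := ltW l0.
pose ll : {posnum R} := PosNum l0.
exists (cpt (base p.1) (ll%:num * (rad p.1)%:num)%:nng, cpt (base p.2) (ll%:num * (rad p.2)%:num)%:nng)%R.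
split; rewrite /= ?rad_cpt//.
  have := @H_homogeneous (base p.1) (base p.2) ll (rad p.1) (rad p.2).
  by rewrite /radial_section/= !cptK -surjective_pairing.
move=> phi; rewrite /cone_sum/= !rad_cpt/=.
have E (X : completelyRegularType) (f : X -> R) (c : cone R X) (s : {nonneg R}) :
    s%:num = (l * (rad c)%:num)%R ->
    (f (base (cpt (base c) s : cone R X)) * s%:num = l * (f (base c) * (rad c)%:num))%R.
  move=> sE; have [r0|r0] := eqVneq (rad c)%:num 0%R.
    by rewrite sE r0 !mulr0.
  by rewrite base_cpt sE; [ring|rewrite mulf_neq0// gt_eqF].
by rewrite (E _ phi.1 p.1)// (E _ phi.2 p.2)//; ring.
Qed.

Lemma Phi_slice phi : (forall p, slice p -> (cone_sum phi p)%:E <= H p) -> Phi H phi.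
Proof.
move=> P; apply/Phi_cone_sum => p.
pose r1 : R := (rad p.1)%:num; pose r2 : R := (rad p.2)%:num.
have r10 : (0 <= r1)%R by rewrite /r1.
have r20 : (0 <= r2)%R by rewrite /r2.
have [r0|r0] := eqVneq (r1 + r2)%R 0%R.
  have r10' : r1 = 0%R by lra.
  have r20' : r2 = 0%R by lra.
  by rewrite /cone_sum -/r1 -/r2 r10' r20' !mulr0 addr0.
have rp : (0 < r1 + r2)%R by rewrite lt_neqAle eq_sym r0 addr_ge0.
have [q [Hq cq q1 q2]] := @homogeneousE p (r1 + r2)^-1 (ltac:(by rewrite invr_gt0)).
have := P q; rewrite Hq cq EFinM lee_pmul2l//; last by rewrite lte_fin invr_gt0.
by apply; rewrite /slice/= q1 q2 -mulrDr mulVf.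
Qed.

End duality.

(** * A functional dominated by the dual problem *)

Section functional_of_dual.
Local Open Scope ereal_scope.
Variables (R : realType) (X1 X2 : completelyRegularType).
Local Notation Y := (cone R X1 * cone R X2)%type.
Implicit Types (phi : Cb R X1 * Cb R X2) (p : Y).
Local Notation slice := (@slice R X1 X2).

Variable H : Y -> \bar R.
Hypothesis H_ge0 : forall p, 0 <= H p.
Hypothesis H_homogeneous : radially_1homogeneous H.
Variable mu : sradon R X1 * sradon R X2.
Hypotheses (mu1 : nonneg_sradon mu.1) (mu2 : nonneg_sradon mu.2).

Lemma pairing_ge0 phi : (forall x, 0 <= phi.1 x)%R -> (forall x, 0 <= phi.2 x)%R ->
  (0 <= pairing mu phi)%R.
Proof.
move=> p1 p2; rewrite /pairing (charge_integral_sradon mu1) (charge_integral_sradon mu2).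
by rewrite addr_ge0// Rintegral_ge0.
Qed.

Lemma cone_sum_ge0 phi : (forall p, slice p -> 0 <= cone_sum phi p)%R ->
  (forall x, 0 <= phi.1 x)%R /\ (forall x, 0 <= phi.2 x)%R.
Proof.
move=> h; pose r0 : {nonneg R} := NngNum (lexx 0%R); pose r1 : {nonneg R} := NngNum ler01.
split => x.
  have := h (cpt x r1, cpt point r0); rewrite /slice /cone_sum/= !rad_cpt/=.
  by rewrite base_cpt/= ?oner_eq0// mulr1 mulr0 !addr0; exact.
have := h (cpt point r0, cpt x r1); rewrite /slice /cone_sum/= !rad_cpt/=.
by rewrite (base_cpt x)/= ?oner_eq0// mulr1 mulr0 !add0r; exact.
Qed.

Hypothesis dual_fin : dual H mu < +oo.
Let D := fine (dual H mu).
Let D0 : (0 <= D)%R. Proof. by rewrite fine_ge0// dual_ge0. Qed.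
Let DE : dual H mu = D%:E.
Proof. by rewrite fineK// ge0_fin_numE// dual_ge0. Qed.

Definition dominates (f : Y -> R) phi (t : R) :=
  forall p, slice p -> (f p)%:E <= (cone_sum phi p)%:E + t%:E * H p.

(** This is where the supremum defining [D] enters: for [t > 0] the pair
    [- t^-1 phi] belongs to [Phi H]. *)
Lemma dominates0 phi t : (0 <= t)%R -> dominates (cst 0%R) phi t ->
  (0 <= pairing mu phi + t * D)%R.
Proof.
move=> t0 dom; have [tp|] := ltP 0%R t; last first.
  move=> t0'; have {t0'}tE : t = 0%R by apply/eqP; rewrite eq_le t0 t0'.
  rewrite tE mul0r addr0; have [|h1 h2] := @cone_sum_ge0 phi.
    by move=> p /dom /=; rewrite tE mul0e adde0 lee_fin.
  exact: pairing_ge0.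
pose psi := Cb2_lin (- t^-1) phi (Cb2_cst X1 X2 0).
have psiH : Phi H psi.
  apply: Phi_slice => // p Sp; rewrite cone_sum_lin (cone_sum_cst 0)// addr0.
  have := dom p Sp; move: (H_ge0 p); case: (H p) => [h| |]//=; last by move=> _ _; rewrite leey.
  rewrite -EFinM -EFinD !lee_fin => _ hh.
  by rewrite mulNr mulrC lerNl ler_pdivlMr//; lra.
have : (pairing mu psi <= D)%R.
  by rewrite -lee_fin -DE; apply: ereal_sup_ubound; exists psi.
rewrite pairing_lin.
by rewrite pairing0 addr0 mulNr mulrC lerNl ler_pdivlMr//; lra.
Qed.

(* The infimum of [Q f] is the least value that domination by test functions and
   multiples of [H] allows for the integral of [f]. *)
Let Q (f : Y -> R) : set R := [set v | exists phi t,
  [/\ (0 <= t)%R, dominates f phi t & v = (pairing mu phi + t * D)%R]].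

Let mass := pairing mu (Cb2_cst X1 X2 1).

Let pairing_cst c : pairing mu (Cb2_cst X1 X2 c) = (c * mass)%R.
Proof.
rewrite /mass /pairing !(charge_integral_sradon mu1) !(charge_integral_sradon mu2).
by rewrite /= !Rintegral_cst// !mul1r; ring.
Qed.

Let QN f M : (forall p, `|f p| <= M)%R -> Q f !=set0 /\ lbound (Q f) (- (M * mass))%R.
Proof.
move=> fM; split.
  exists (pairing mu (Cb2_cst X1 X2 M)), (Cb2_cst X1 X2 M), 0%R; split => //.
    move=> p Sp; rewrite cone_sum_cst// mul0e adde0 lee_fin.
    by apply: le_trans (fM p); exact: ler_norm.
  by rewrite mul0r addr0.
move=> _ [phi [t [t0 dom ->]]].
have : (0 <= pairing mu (Cb2_lin 1 phi (Cb2_cst X1 X2 M)) + t * D)%R.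
  apply: dominates0 => // p Sp; rewrite cone_sum_lin cone_sum_cst// mul1r /cst.
  apply: (@le_trans _ _ ((f p)%:E + M%:E)).
    by rewrite -EFinD lee_fin; have := fM p; rewrite ler_norml => /andP[]; lra.
  by rewrite EFinD addeAC leeD2r// dom.
by rewrite pairing_lin pairing_cst mul1r; lra.
Qed.

Let q f := inf (Q f).

Let q_le f v : bdd_fun f -> Q f v -> (q f <= v)%R.
Proof.
by move=> [M fM] Qv; apply: ge_inf => //; exists (- (M * mass))%R; exact: (QN fM).2.
Qed.

Let le_q f v : bdd_fun f -> (forall u, Q f u -> v <= u)%R -> (v <= q f)%R.
Proof. by move=> [M fM] h; apply: lb_le_inf => //; exact: (QN fM).1. Qed.

Let qD f g : bdd_fun f -> bdd_fun g -> (q (f + g) <= q f + q g)%R.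
Proof.
move=> bf bg; suff h u : Q f u -> (q (f + g) - u <= q g)%R.
  suff : (q (f + g) - q g <= q f)%R by lra.
  by apply: le_q => // u /h; lra.
move=> Qu; apply: le_q => // v Qv; rewrite lerBlDl; apply: q_le; first exact: bdd_funD.
have [phi [t [t0 dom ->]]] := Qu; have [psi [s [s0 doms ->]]] := Qv.
exists (Cb2_lin 1 phi psi), (t + s)%R; split; first exact: addr_ge0.
  move=> p Sp; rewrite -[(f + g)%R p]/(f p + g p)%R cone_sum_lin mul1r (EFinD (f p)) (EFinD (cone_sum phi p)) (EFinD t) ge0_muleDl ?lee_fin// addeACA.
  by apply: leeD; [exact: dom|exact: doms].
by rewrite pairing_lin; ring.
Qed.

Let qZ a f : (0 < a)%R -> bdd_fun f -> (q (a *: f) <= a * q f)%R.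
Proof.
move=> a0 bf; rewrite -ler_pdivrMl//; apply: le_q => // _ [phi [t [t0 dom ->]]].
rewrite ler_pdivrMl//; apply: q_le; first exact: bdd_funZ.
exists (Cb2_lin a phi (Cb2_cst X1 X2 0)), (a * t)%R; split.
- by rewrite mulr_ge0// ltW.
- move=> p Sp; rewrite cone_sum_lin (cone_sum_cst 0)// addr0.
  have -> : (a * cone_sum phi p)%:E + (a * t)%:E * H p = a%:E * ((cone_sum phi p)%:E + t%:E * H p).
    by rewrite muleDr ?fin_num_adde_defr// muleA.
  by rewrite [leLHS]EFinM; apply: lee_wpmul2l; [rewrite lee_fin ltW|exact: dom].
- by rewrite pairing_lin pairing_cst mul0r addr0; ring.
Qed.

(** Taking [t = 0] and [phi], [- phi] shows that [L] integrates [cone_sum phi] to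
    [pairing mu phi], and taking [t = 1] that it integrates [H] to at most [D]:
    up to countable additivity, [L] is an optimal coupling. *)
Lemma functional_of_dual : exists2 L : (Y -> R) -> R, positive_functional L &
  forall f phi t, bdd_fun f -> (0 <= t)%R -> dominates f phi t ->
    (L f <= pairing mu phi + t * D)%R.
Proof.
have [||L [LL Lq]] := @hahn_banach R _ (@bdd_fun R Y) q _ _ qD qZ.
- exact: (bdd_fun_cst _ 0%R).
- by move=> a u v; exact: bdd_fun_lin.
have LQ f phi t : bdd_fun f -> (0 <= t)%R -> dominates f phi t ->
    (L f <= pairing mu phi + t * D)%R.
  move=> bf t0 dom; apply: (le_trans (Lq f bf)); apply: q_le => //.
  by exists phi, t.
exists L => //; split => // u bu u0.
have bN : bdd_fun (- u)%R by rewrite -scaleN1r; exact: bdd_funZ.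
have L0 : L 0%R = 0%R.
  have b0 := bdd_fun_cst Y (0%R : R).
  by have := LL 1%R _ _ b0 b0; rewrite scaler0 addr0 mul1r -[X in X = _]addr0 => /addrI.
have : (L (- u) <= pairing mu (Cb2_cst X1 X2 0) + 0 * D)%R.
  apply: LQ => // p Sp; rewrite cone_sum_cst// mul0e adde0 lee_fin.
  by rewrite oppr_le0.
rewrite pairing_cst !mul0r addr0.
have -> : L (- u)%R = (- L u)%R.
  rewrite -scaleN1r -[(_ *: _)%R]addr0 LL//; last exact: (bdd_fun_cst _ 0%R).
  by rewrite L0 addr0 mulN1r.
by rewrite oppr_le0.
Qed.

End functional_of_dual.

(** * Compact boxes in the product of cones *)

Section tightness.
Variables (R : realType) (X1 X2 : completelyRegularType).
Local Notation Y := (cone R X1 * cone R X2)%type.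
Local Notation slice := (@slice R X1 X2).

Definition small_far (X : completelyRegularType) (K : nat -> set X) (n : nat) : set (cone R X) :=
  [set c | 2^-1 ^+ n < (rad c)%:num -> K n (base c)].

Definition cone_box (X : completelyRegularType) (K : nat -> set X) : set (cone R X) :=
  [set c | (rad c)%:num <= 1 /\ forall n, small_far K n c].

Lemma compact_cone_box (X : completelyRegularType) (K : nat -> set X) :
  (forall n, compact (K n)) -> compact (cone_box K).
Proof.
move=> cK; rewrite compact_ultra => G GU GK.
have GF : Filter G by exact: filter_filter.
have [|n U oU KU|c Gc [c1 cK']] := cone_ultra_cvg (@hausdorff_subproof X) GU cK.
- by apply: (@filterS _ G GF _ _ _ GK) => c [].
- apply: (@filterS _ G GF _ _ _ GK) => c [_ h] cn; apply: KU; exact: h.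
by exists c.
Qed.

(** Finitely many of the constraints that define the compact box suffice to enter
    a given neighbourhood of it: otherwise an ultrafilter on the complement would
    satisfy all of them and converge into the box. *)
Lemma slice_neighbourhood (K1 : nat -> set X1) (K2 : nat -> set X2) (U : set Y) :
  (forall n, compact (K1 n)) -> (forall n, compact (K2 n)) ->
  open U -> cone_box K1 `*` cone_box K2 `<=` U ->
  exists N V1 V2, [/\ forall n, open (V1 n) /\ K1 n `<=` V1 n,
    forall n, open (V2 n) /\ K2 n `<=` V2 n &
    forall p, slice p -> (forall n, (n < N)%N -> small_far V1 n p.1 /\ small_far V2 n p.2) -> U p].
Proof.
move=> cK1 cK2 oU KU; apply: contrapT => nex.
pose I := [set i : nat * ((nat -> set X1) * (nat -> set X2)) |
  (forall n, open (i.2.1 n) /\ K1 n `<=` i.2.1 n) /\ (forall n, open (i.2.2 n) /\ K2 n `<=` i.2.2 n)].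
pose B (i : nat * ((nat -> set X1) * (nat -> set X2))) := [set p : Y | [/\ slice p, ~ U p &
  forall n, (n < i.1)%N -> small_far i.2.1 n p.1 /\ small_far i.2.2 n p.2]].
have FF : ProperFilter (filter_from I B).
  apply: filter_from_proper => [|[N [V1 V2]] [/= hV1 hV2]].
    apply: filter_from_filter.
      by exists (0%N, (fun=> setT, fun=> setT)); split => n /=; split => //; exact: openT.
    move=> [N [V1 V2]] [N' [V1' V2']] [/= h1 h2] [/= h1' h2'].
    exists (maxn N N', (fun n => V1 n `&` V1' n, fun n => V2 n `&` V2' n)).
      split => n /=.
        have [oV K] := h1 n; have [oV' K'] := h1' n; split; first exact: openI.
        by move=> x Kx; split; [exact: K|exact: K'].
      have [oV K] := h2 n; have [oV' K'] := h2' n; split; first exact: openI.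
      by move=> x Kx; split; [exact: K|exact: K'].
    move=> p [/= Sp nU h]; split; split => //= n nN.
      have [f1 f2] := h n (leq_trans nN (leq_maxl _ _)).
      by split; [move=> /f1[]|move=> /f2[]].
    have [f1 f2] := h n (leq_trans nN (leq_maxr _ _)).
    by split; [move=> /f1[]|move=> /f2[]].
  apply: contrapT => Bempty; apply: nex; exists N, V1, V2; split => // p Sp hp.
  by apply: contrapT => nUp; apply: Bempty; exists p.
have [G [GU FG]] := ultraFilterLemma FF.
have GF : Filter G by exact: filter_filter.
have GI i : I i -> G (B i) by move=> Ii; apply: FG; exists i.
have i0 : I (0%N, (fun=> setT, fun=> setT)) by split => n /=; split => //; exact: openT.
have GU1 : UltraFilter (fst @ G) by exact: ultra_fmap.
have GU2 : UltraFilter (snd @ G) by exact: ultra_fmap.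
have [||c1 Gc1 [c11 c1K]] := cone_ultra_cvg (@hausdorff_subproof X1) GU1 cK1.
- apply: (@filterS _ G GF _ _ _ (GI _ i0)) => p [+ _ _].
  by rewrite /slice/= => <-; rewrite lerDl.
- move=> n V oV KV; pose i := (n.+1, (fun m => if m == n then V else setT, fun m : nat => @setT X2)).
  have Ii : I i.
    by split => m /=; last (by split => //; exact: openT); case: eqP => [->|_]; split => //; exact: openT.
  apply: (@filterS _ G GF _ _ _ (GI _ Ii)) => p [_ _ /(_ n (ltnSn _))[+ _]].
  by rewrite /small_far/= eqxx.
have [||c2 Gc2 [c21 c2K]] := cone_ultra_cvg (@hausdorff_subproof X2) GU2 cK2.
- apply: (@filterS _ G GF _ _ _ (GI _ i0)) => p [+ _ _].
  by rewrite /slice/= => <-; rewrite lerDr.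
- move=> n V oV KV; pose i := (n.+1, (fun m : nat => @setT X1, fun m => if m == n then V else setT)).
  have Ii : I i.
    by split => m /=; first (by split => //; exact: openT); case: eqP => [->|_]; split => //; exact: openT.
  apply: (@filterS _ G GF _ _ _ (GI _ Ii)) => p [_ _ /(_ n (ltnSn _))[_ +]].
  by rewrite /small_far/= eqxx.
have Uc : U (c1, c2) by apply: KU; split.
have [[A1 A2] /= [c1A c2A] AU] : nbhs (c1, c2) U by exact: open_nbhs_nbhs.
apply: (@filter_not_empty _ G); apply: (@filterS _ G GF _ _ _
  (@filterI _ G GF _ _ (@filterI _ G GF _ _ (Gc1 _ c1A) (Gc2 _ c2A)) (GI _ i0))).
by move=> p [[pA1 pA2] [_ nU _]]; apply: nU; rewrite (surjective_pairing p); apply: AU; split.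
Qed.

End tightness.

(** * Tightness *)

Section tight_functional.
Local Open Scope ereal_scope.
Variables (R : realType) (X1 X2 : completelyRegularType).
Local Notation Y := (cone R X1 * cone R X2)%type.
Implicit Types (phi : Cb R X1 * Cb R X2) (p : Y).
Local Notation slice := (@slice R X1 X2).

Lemma open_slice : open (~` slice).
Proof.
apply: closed_openC.
rewrite (_ : slice = (fun p : Y => (rad p.1)%:num + (rad p.2)%:num : R)%R @^-1` [set 1%R]); last first.
  by apply/seteqP; split.
apply: (@closed_comp _ _ (fun p : Y => (rad p.1)%:num + (rad p.2)%:num : R)%R); last exact: closed_eq.
move=> p _; apply: cvgD.
  exact: (@continuous_comp _ _ _ (@fst (cone R X1) (cone R X2))
    (fun c : cone R X1 => (rad c)%:num : R) p cvg_fst (@rad_continuous R X1 p.1)).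
exact: (@continuous_comp _ _ _ (@snd (cone R X1) (cone R X2))
    (fun c : cone R X2 => (rad c)%:num : R) p cvg_snd (@rad_continuous R X2 p.2)).
Qed.

Lemma hausdorff_cones : hausdorff_space Y.
Proof.
by apply: prod_hausdorff; apply: cone_hausdorff; exact: hausdorff_subproof.
Qed.

(** The decay [4 ^- n] leaves room for the factor [2 ^+ n] that compensates the
    radii between [2 ^- n] and 1. *)
Lemma radon_exhaustion (X : completelyRegularType) (m : sradon R X) (e : R) :
  nonneg_sradon m -> (0 < e)%R ->
  exists K : nat -> set X, (forall n, compact (K n)) /\
    forall n (V : set X), open V -> K n `<=` V ->
      exists psi : Cb R X, [/\ forall x, (0 <= psi x <= 1)%R, forall x, ~ V x -> psi x = 1%R &
        (charge_integral m psi <= e / 4 ^+ n)%R].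
Proof.
move=> m0 e0.
have en n : (0 < e / 4 ^+ n)%R by rewrite divr_gt0// exprn_gt0.
have rm := measure_of_sradon_radon m0.
pose K n := sval (cid (rm setT _ measurableT (en n))).
have KP n : [/\ compact (K n), K n `<=` setT &
    measure_of_sradon m0 (setT `\` K n) <= (e / 4 ^+ n)%:E].
  exact: (svalP (cid (rm setT _ measurableT (en n)))).
exists K; split=> [n|n V oV KV]; first by have [] := KP n.
have [cK _ hK] := KP n.
have [phi [p01 p1 p0]] := compact_open_urysohn R cK oV KV.
exists (Cb_lin (-1) phi (Cb_cst X 1)); split.
- by move=> x /=; have /andP[? ?] := p01 x; rewrite mulN1r; lra.
- by move=> x /p0 /= ->; rewrite mulr0 add0r.
rewrite -lee_fin (charge_integral_sradon m0); apply: le_trans hK; rewrite setTD.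
apply: integral_Cb_le_measure.
- by apply: closed_openC; apply: compact_closed => //; exact: hausdorff_subproof.
- by move=> x /=; have /andP[? ?] := p01 x; rewrite mulN1r; lra.
- by move=> x /contrapT /p1 /= ->; rewrite mulr1 addNr.
Qed.

Definition Cb_sum (X : completelyRegularType) (psi : nat -> Cb R X) : nat -> Cb R X :=
  fix F N := if N is N'.+1 then Cb_lin (2 ^+ N') (psi N') (F N') else Cb_cst X 0.

Lemma Cb_sum_ge0 (X : completelyRegularType) (psi : nat -> Cb R X) N x :
  (forall n x, 0 <= psi n x)%R -> (0 <= Cb_sum psi N x)%R.
Proof.
move=> p0; elim: N => [//|N IH] /=.
by rewrite addr_ge0// mulr_ge0// exprn_ge0.
Qed.

Lemma Cb_sum_ge (X : completelyRegularType) (psi : nat -> Cb R X) N n x :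
  (forall n x, 0 <= psi n x)%R -> (n < N)%N -> (2 ^+ n * psi n x <= Cb_sum psi N x)%R.
Proof.
move=> p0; elim: N => [//|N IH]; rewrite ltnS leq_eqVlt => /predU1P[->|nN] /=.
  by rewrite lerDl Cb_sum_ge0.
by apply: (le_trans (IH nN)); rewrite lerDr mulr_ge0// exprn_ge0.
Qed.

Lemma Cb_sum_integral (X : completelyRegularType) (m : sradon R X) (psi : nat -> Cb R X) (e : R) N :
  (forall n, charge_integral m (psi n) <= e / 4 ^+ n)%R ->
  (charge_integral m (Cb_sum psi N) <= e * (2 - 2 / 2 ^+ N))%R.
Proof.
move=> pe; elim: N => [|N IH].
  by rewrite charge_integral0 expr0 divr1 subrr mulr0.
rewrite [Cb_sum _ _]/= charge_integral_lin.
apply: (@le_trans _ _ (2 ^+ N * (e / 4 ^+ N) + e * (2 - 2 / 2 ^+ N))%R).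
  by apply: lerD => //; rewrite ler_wpM2l// exprn_ge0.
have -> : (4 ^+ N = 2 ^+ N * 2 ^+ N :> R)%R by rewrite -exprMn; congr (_ ^+ _)%R; ring.
have p0 : (2 ^+ N != 0 :> R)%R by rewrite expf_neq0.
rewrite le_eqVlt; apply/orP; left; apply/eqP; rewrite exprS; field.
by rewrite p0.
Qed.

Variables (H : Y -> \bar R) (mu : sradon R X1 * sradon R X2) (D : R).
Hypotheses (mu1 : nonneg_sradon mu.1) (mu2 : nonneg_sradon mu.2).

(** The indicator of the complement of a neighbourhood of the box is dominated by
    [cone_sum] of test functions of small integral: a point that violates the
    constraint of index [n] has radius above [2 ^- n] over the complement of
    [K n], where the test function is at least [2 ^+ n]. *)
Lemma functional_tight (L : (Y -> R) -> R) : positive_functional L ->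
  (forall f phi t, bdd_fun f -> (0 <= t)%R -> dominates H f phi t ->
    L f <= pairing mu phi + t * D)%R ->
  forall e : R, (0 < e)%R -> exists2 K : set Y, compact K &
    forall U, open U -> K `<=` U -> (L \1_(~` U) <= e)%R.
Proof.
move=> posL HL e e0; have e40 : (0 < e / 4)%R by rewrite divr_gt0.
have [K1 [cK1 HK1]] := radon_exhaustion mu1 e40.
have [K2 [cK2 HK2]] := radon_exhaustion mu2 e40.
exists (cone_box K1 `*` cone_box K2).
  by apply: compact_setX; exact: compact_cone_box.
move=> U oU KU; have [N [V1 [V2 [HV1 HV2 HU]]]] := slice_neighbourhood cK1 cK2 oU KU.
pose psi1 n := sval (cid (HK1 n _ (HV1 n).1 (HV1 n).2)).
pose psi2 n := sval (cid (HK2 n _ (HV2 n).1 (HV2 n).2)).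
have P1 n : [/\ forall x, (0 <= psi1 n x <= 1)%R, forall x, ~ V1 n x -> psi1 n x = 1%R &
    (charge_integral mu.1 (psi1 n) <= e / 4 / 4 ^+ n)%R].
  exact: (svalP (cid (HK1 n _ (HV1 n).1 (HV1 n).2))).
have P2 n : [/\ forall x, (0 <= psi2 n x <= 1)%R, forall x, ~ V2 n x -> psi2 n x = 1%R &
    (charge_integral mu.2 (psi2 n) <= e / 4 / 4 ^+ n)%R].
  exact: (svalP (cid (HK2 n _ (HV2 n).1 (HV2 n).2))).
have p10 n x : (0 <= psi1 n x)%R by have [/(_ x)/andP[]] := P1 n.
have p20 n x : (0 <= psi2 n x)%R by have [/(_ x)/andP[]] := P2 n.
pose phi := (Cb_sum psi1 N, Cb_sum psi2 N).
apply: (@le_trans _ _ (pairing mu phi + 0 * D)%R); last first.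
  rewrite mul0r addr0 /pairing/=.
  have c1 : (charge_integral mu.1 (Cb_sum psi1 N) <= e / 4 * (2 - 2 / 2 ^+ N))%R.
    by apply: Cb_sum_integral => n; have [] := P1 n.
  have c2 : (charge_integral mu.2 (Cb_sum psi2 N) <= e / 4 * (2 - 2 / 2 ^+ N))%R.
    by apply: Cb_sum_integral => n; have [] := P2 n.
  apply: (le_trans (lerD c1 c2)).
  have : (0 <= 2 / 2 ^+ N :> R)%R by rewrite divr_ge0// exprn_ge0.
  by set x := (2 / _)%R => x0; nra.
apply: HL => //; first exact: bdd_fun_indic.
move=> p Sp; rewrite mul0e adde0 lee_fin.
have cs0 : (0 <= cone_sum phi p)%R.
  by rewrite /cone_sum/= addr_ge0// mulr_ge0//; exact: Cb_sum_ge0.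
have half n (r : R) : (2^-1 ^+ n < r)%R -> (1 <= 2 ^+ n * r)%R.
  by move=> nr; rewrite -ler_pdivrMl ?exprn_gt0// mulr1 -exprVn ltW.
rewrite indicE; have [|//] := boolP (p \in ~` U); rewrite inE => nUp.
have [n [nN]] : exists n, (n < N)%N /\ ~ (small_far V1 n p.1 /\ small_far V2 n p.2).
  apply: contrapT => hn; apply: nUp; apply: HU => // n nN.
  by apply: contrapT => hp; apply: hn; exists n.
move=> /not_andP[|] /not_implyP[rn nV]; rewrite /cone_sum/=.
- have := @Cb_sum_ge _ psi1 N n (base p.1) p10 nN.
  have [_ /(_ _ nV) -> _] := P1 n; rewrite mulr1 => h.
  apply: (le_trans (half _ _ rn)); rewrite -[leLHS]addr0 lerD//.
    by rewrite ler_wpM2r.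
  by rewrite mulr_ge0//; exact: Cb_sum_ge0.
- have := @Cb_sum_ge _ psi2 N n (base p.2) p20 nN.
  have [_ /(_ _ nV) -> _] := P2 n; rewrite mulr1 => h.
  apply: (le_trans (half _ _ rn)); rewrite -[leLHS]add0r lerD//.
    by rewrite mulr_ge0//; exact: Cb_sum_ge0.
  by rewrite ler_wpM2r.
Qed.

End tight_functional.

(** * Optimal couplings *)

Section marginal_integral.
Local Open Scope ereal_scope.
Variables (R : realType) (Y : ptopologicalType) (X : completelyRegularType).
Variables (pr : Y -> cone R X) (alpha : {finite_measure set (borel Y) -> \bar R}).

Lemma marginal_integral (m : sradon R X) (phi : Cb R X) : continuous pr ->
  nonneg_sradon m ->
  (forall A : set (borel X), measurable A ->
    m A = \int[alpha]_(p in [set p | (0 < (rad (pr p))%:num)%R /\ A (base (pr p))])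
      (rad (pr p))%:num%:E) ->
  alpha.-integrable setT (fun p => (phi (base (pr p)) * (rad (pr p))%:num)%:E) /\
  (charge_integral m phi = \int[alpha]_p (phi (base (pr p)) * (rad (pr p))%:num))%R.
Proof.
move=> cpr m0 mE.
have mw : measurable_fun setT ((fun p => (rad (pr p))%:num) : borel Y -> R).
  by apply: continuous_real_measurable; exact: continuous_rad_pr.
have w0 p : (0 <= (rad (pr p))%:num :> R)%R by [].
have mb : measurable_fun setT ((fun p => base (pr p)) : borel Y -> borel X).
  exact: measurableT_comp (@measurable_base R X) (continuous_borel_measurable cpr).
have muE A : measurable A -> measure_of_sradon m0 A =
    \int[alpha]_(p in (fun p => base (pr p)) @^-1` A) (rad (pr p))%:num%:E.
  move=> mA; rewrite [LHS](mE A mA) integral_mkcond [RHS]integral_mkcond.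
  apply: eq_integral => p _; rewrite /patch.
  case: ifPn; rewrite ?inE ?notin_setE/= => Ap; case: ifPn => //; rewrite ?inE ?notin_setE/=.
    by case: Ap.
  by move=> Abp; have /not_andP[/negP|//] := Ap; rewrite rad_gt0 negbK => /eqP ->.
split; first exact: (weighted_transfer_integrable mw w0 mb muE (Cb_bounded_measurable phi)).
rewrite (charge_integral_sradon m0).
exact: (Rintegral_weighted_transfer mw w0 mb muE (Cb_bounded_measurable phi)).
Qed.

End marginal_integral.

Section optimal_coupling.
Local Open Scope ereal_scope.
Variables (R : realType) (X1 X2 : completelyRegularType).
Local Notation Y := (cone R X1 * cone R X2)%type.
Implicit Types (phi : Cb R X1 * Cb R X2) (p : Y).
Local Notation slice := (@slice R X1 X2).

Lemma fst_cont : continuous (@fst (cone R X1) (cone R X2)).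
Proof. by move=> p; exact: cvg_fst. Qed.

Lemma snd_cont : continuous (@snd (cone R X1) (cone R X2)).
Proof. by move=> p; exact: cvg_snd. Qed.

Lemma weak_duality (H : Y -> \bar R) (mu : sradon R X1 * sradon R X2) alpha phi :
  (forall p, 0 <= H p) -> measurable_fun setT (H : borel Y -> \bar R) ->
  nonneg_sradon mu.1 -> nonneg_sradon mu.2 ->
  hcoupling mu alpha -> (forall p, (cone_sum phi p)%:E <= H p) ->
  (pairing mu phi)%:E <= \int[alpha]_p H p.
Proof.
move=> H0 mH mu1 mu2 [_ _ h1 h2] phiH.
have [i1 E1] := marginal_integral phi.1 fst_cont mu1 h1.
have [i2 E2] := marginal_integral phi.2 snd_cont mu2 h2.
rewrite /pairing E1 E2 -RintegralD// fineK; last first.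
  by apply: integrable_fin_num => //; exact: (integrableD measurableT i1 i2).
have [->|Hfin] := eqVneq (\int[alpha]_p H p) +oo; first by rewrite leey.
apply: le_integral => //; [exact: (integrableD measurableT i1 i2)| |by move=> p _; exact: phiH].
apply/integrableP; split => //.
under eq_integral do rewrite gee0_abs//.
by rewrite ltey.
Qed.

Lemma lsc_borel_measurable (F : Y -> \bar R) : lower_semicontinuous F ->
  measurable_fun setT (F : borel Y -> \bar R).
Proof.
move=> /lower_semicontinuousP oF.
apply: (measurability _ (@ErealGenOInfty.measurableE R)).
move=> _ [_ [a ->] <-]; rewrite setTI preimage_itvoy; apply: sub_sigma_algebra.
exact: oF.
Qed.

Variable H : Y -> \bar R.
Hypothesis H_ge0 : forall p, 0 <= H p.
Hypothesis H_homogeneous : radially_1homogeneous H.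
Hypothesis H_lsc : lower_semicontinuous H.
Variable mu : sradon R X1 * sradon R X2.
Hypotheses (mu1 : nonneg_sradon mu.1) (mu2 : nonneg_sradon mu.2).

(** The Radon measure below the Hahn-Banach functional keeps its integrals of
    continuous functions, which are those of [mu], and can only decrease those
    of lower semicontinuous functions, among them the truncations of [H]. *)
Lemma exists_optimal_coupling : dual H mu < +oo ->
  exists2 alpha, hcoupling mu alpha &
    alpha (~` slice) = 0 /\ \int[alpha]_p H p <= dual H mu.
Proof.
move=> dual_fin; have [L posL HL] := functional_of_dual H_ge0 H_homogeneous mu1 mu2 dual_fin.
have tL := functional_tight mu1 mu2 posL HL.
have [alpha [ralpha aT aL]] := radon_of_functional posL (@hausdorff_cones R X1 X2) tL.
(* Off the slice every function is dominated, so [L] vanishes there. *)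
have aS : alpha (~` slice) = 0.
  have mS : measurable (~` slice : set (borel Y)) by apply: sub_sigma_algebra; exact: open_slice.
  apply/eqP; rewrite eq_le measure_ge0 andbT.
  have L0 : (L \1_(~` slice) <= 0)%R.
    rewrite -[leRHS](_ : pairing mu (Cb2_cst X1 X2 0) + 0 * fine (dual H mu) = 0)%R.
      apply: HL => //; first exact: bdd_fun_indic.
      by move=> p Sp; rewrite cone_sum_cst// mul0e adde0 lee_fin indicE memNset.
    by rewrite pairing0 mul0r addr0.
  apply: (@le_trans _ _ (L \1_(~` slice))%:E); last by rewrite lee_fin.
  have := aL \1_(~` slice) (bdd_fun_indic _ _) _ _.
  rewrite integral_indic// setIT; apply; first by move=> p; rewrite indicE.
  move=> a; have [a0|a0] := ltP a 0%R.
    rewrite (_ : [set _ | _] = setT); first exact: openT.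
    by apply/seteqP; split => // p _ /=; rewrite indicE (lt_le_trans a0).
  have [a1|a1] := ltP a 1%R.
    rewrite (_ : [set _ | _] = ~` slice); first exact: open_slice.
    apply/seteqP; split => p /=; rewrite indicE.
      by have [|_] := boolP (p \in ~` slice); rewrite ?inE//= ltNge a0.
    by move=> nS; rewrite mem_set.
  rewrite (_ : [set _ | _] = set0); first exact: open0.
  rewrite -subset0 => p /=; rewrite indicE ltNge; move/negP; apply.
  by apply: le_trans a1; rewrite lern1 leq_b1.
have marg (X : completelyRegularType) (pr : Y -> cone R X) (m : sradon R X)
    (inj : Cb R X -> Cb R X1 * Cb R X2) : continuous pr ->
    nonneg_sradon m -> (forall p, slice p -> (rad (pr p))%:num <= 1)%R ->
    (forall f p, cone_sum (inj f) p = f (base (pr p)) * (rad (pr p))%:num)%R ->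
    (forall f, pairing mu (inj f) = charge_integral m f) ->
    forall A, measurable A -> m A =
      \int[alpha]_(p in [set p | (0 < (rad (pr p))%:num)%R /\ A (base (pr p))]) (rad (pr p))%:num%:E.
  move=> cpr m0 rS csE pE; apply: (@marginal_of_integrals R Y X pr cpr alpha slice
    (@hausdorff_cones R X1 X2) (@open_slice R X1 X2) aS ralpha rS) => // phi g p01 cg g01 gS.
  have bg : bdd_fun g by exists 1%R => p; have /andP[? ?] := g01 p; rewrite ger0_norm.
  rewrite (integral_of_functional posL aT aL)//; last by move=> p; have /andP[] := g01 p.
  congr EFin; apply/eqP; rewrite eq_le; apply/andP; split.
    rewrite -pE -[leRHS]addr0 -[X in (_ + X)%R](mul0r (fine (dual H mu))); apply: HL => //.
    by move=> p Sp; rewrite mul0e adde0 lee_fin gS// csE.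
  have : (L (- g) <= pairing mu (Cb2_lin (-1) (inj phi) (Cb2_cst X1 X2 0)) + 0 * fine (dual H mu))%R.
    apply: HL => //; first by rewrite -scaleN1r; exact: bdd_funZ.
    move=> p Sp; rewrite mul0e adde0 lee_fin cone_sum_lin cone_sum_cst// addr0 csE mulN1r.
    by rewrite -gS.
  rewrite pairing_lin pE pairing0.
  have -> : L (- g)%R = (- L g)%R by rewrite -scaleN1r (pfunZ posL)// mulN1r.
  by lra.
have rad_le1 p : slice p -> ((rad p.1)%:num <= 1 /\ (rad p.2)%:num <= 1)%R.
  by rewrite /slice/= => <-; split; rewrite ?lerDl ?lerDr.
have m1 : measurable_fun setT (fun p : borel Y => (rad p.1)%:num : R).
  by apply: continuous_real_measurable; exact: (continuous_rad_pr fst_cont).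
have m2 : measurable_fun setT (fun p : borel Y => (rad p.2)%:num : R).
  by apply: continuous_real_measurable; exact: (continuous_rad_pr snd_cont).
exists alpha.
  split => //.
  - rewrite (@null_compl_integral R Y alpha slice (@open_slice R X1 X2) aS setT _ (cst 1))//.
    + by rewrite integral_cst// mul1e -ge0_fin_numE// fin_num_measure.
    + by apply/measurable_EFinP; exact: measurable_funD.
    + by move=> p; rewrite /slice/= => ->.
  - apply: (marg X1 fst mu.1 (fun f => (f, Cb_cst X2 0))) => //.
    + exact: fst_cont.
    + by move=> p /rad_le1[].
    + by move=> f p; rewrite /cone_sum/= mul0r addr0.
    + by move=> f; rewrite /pairing charge_integral0 addr0.
  - apply: (marg X2 snd mu.2 (fun f => (Cb_cst X1 0, f))) => //.
    + exact: snd_cont.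
    + by move=> p /rad_le1[].
    + by move=> f p; rewrite /cone_sum/= mul0r add0r.
    + by move=> f; rewrite /pairing charge_integral0 add0r.
split => //.
have dE : dual H mu = (fine (dual H mu))%:E.
  by rewrite fineK// ge0_fin_numE// dual_ge0.
have mH := lsc_borel_measurable H_lsc.
(* [H] is the increasing limit of bounded lower semicontinuous functions, each
   dominated by [H] itself. *)
pose h (N : nat) p : R := fine (mine (H p) N%:R%:E).
have hE N p : (h N p)%:E = mine (H p) N%:R%:E.
  rewrite /h fineK// ge0_fin_numE; first by rewrite gt_min ltry orbT.
  by rewrite le_min H_ge0 lee_fin/=.
have hle (n : nat) : \int[alpha]_p (h n p)%:E <= dual H mu.
  have h0 (p : Y) : (0 <= h n p)%R by rewrite -lee_fin hE le_min H_ge0 lee_fin/=.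
  have bh : bdd_fun (h n).
    by exists n%:R => p; rewrite ger0_norm// -lee_fin hE ge_min lexx orbT.
  apply: (le_trans (aL _ bh h0 _)).
    move=> a; have [an|an] := ltP a n%:R.
      rewrite (_ : [set _ | _] = [set p | H p > a%:E]).
        by have /lower_semicontinuousP := H_lsc; exact.
      by apply/seteqP; split => p /=; rewrite -lte_fin hE lt_min lte_fin an andbT.
    rewrite (_ : [set _ | _] = set0); first exact: open0.
    rewrite -subset0 => p /=; rewrite -lte_fin hE lt_min => /andP[_].
    by rewrite lte_fin ltNge an.
  rewrite dE lee_fin.
  rewrite -[leRHS](_ : pairing mu (Cb2_cst X1 X2 0) + 1 * fine (dual H mu) = _)%R.
    apply: HL => // p Sp; rewrite cone_sum_cst// add0e mul1e hE ge_min lexx//.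
  by rewrite pairing0 add0r mul1r.
have mh N : measurable_fun setT ((fun p => (h N p)%:E) : borel Y -> \bar R).
  rewrite (_ : (fun p => _) = fun p => mine (H p) N%:R%:E).
    exact: measurable_mine.
  by apply/funext => p; exact: hE.
have h_ge0 N p : 0 <= (h N p)%:E by rewrite hE le_min H_ge0 lee_fin/=.
have h_nd p : nondecreasing_seq (fun N => (h N p)%:E).
  move=> M N MN; rewrite !hE le_min !ge_min lexx/= lee_fin ler_nat MN orbT//.
have hlim p : limn (fun N => (h N p)%:E) = H p.
  apply/cvg_lim => //; have := H_ge0 p; case HpE : (H p) => [x| |]// _.
    apply: cvg_near_cst.
    near=> N; rewrite hE HpE min_l// lee_fin.
    by near: N; exact: nbhs_infty_ger.
  rewrite (_ : (fun N => _) = fun N => N%:R%:E); first by apply/cvgeryP; exact: cvgr_idn.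
  by apply/funext => N; rewrite hE HpE min_r// leey.
have := @cvg_monotone_convergence _ (borel Y) R alpha setT measurableT
  (fun N p => (h N p)%:E) mh (fun N p _ => h_ge0 N p) (fun p _ => h_nd p).
under [X in _ --> X]eq_integral do rewrite hlim.
move=> /cvg_lim <- //; apply: lime_le.
  apply: ereal_nondecreasing_is_cvgn => M N MN; apply: ge0_le_integral => //.
  by move=> p _; exact: h_nd.
by near=> N; exact: hle.
Unshelve. all: by end_near. Qed.

End optimal_coupling.

(** * Duality *)

Lemma ge0_daddE (R : realType) (x y : \bar R) : (0 <= x -> 0 <= y -> (x + y)%dE = (x + y)%E)%E.
Proof. by case: x => [x| |]//; case: y => [y| |]. Qed.

Section calU_dual.
Local Open Scope ereal_scope.
Local Open Scope convex_scope.
Variables (R : realType).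

Lemma charge_integral_add (X : completelyRegularType) (m n : sradon R X) (f : Cb R X) :
  charge_integral (m + n)%R f = (charge_integral m f + charge_integral n f)%R.
Proof. by apply: charge_integralD => //; exact: Cb_bounded_measurable. Qed.

Lemma charge_integral_scale (X : completelyRegularType) (m : sradon R X) (r : R) (f : Cb R X) :
  (0 <= r)%R -> charge_integral (r *: m)%R f = (r * charge_integral m f)%R.
Proof. by move=> r0; apply: charge_integralZ => //; exact: Cb_bounded_measurable. Qed.

Lemma charge_integral_dirac (X : completelyRegularType) (x : X) (f : Cb R X) :
  charge_integral (sdirac x : sradon R X) f = f x.
Proof.
have bf := Cb_bounded_measurable f.
rewrite (@charge_integral_measure _ (borel X) R _ (dirac (x : borel X)))//.
  rewrite /Rintegral integral_dirac//; last by apply/measurable_EFinP; exact: bf.1.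
  by rewrite diracT mul1e.
by move=> A mA; exact: sdiracE.
Qed.

Lemma charge_integral_continuous (X : completelyRegularType) (f : Cb R X) :
  continuous (fun m : sradon R X => charge_integral m f).
Proof.
move=> m.
have h := (@cvg_sup _ _ (fun phi : Cb R X => Topological.class
    (initial_topology (fun mu : sradon R X => charge_integral mu phi))) (nbhs m) m _).1.
have h' := h (nbhs_filter (m : sradon R X)) (@cvg_id _ (nbhs m)) f.
have c := @initial_continuous _ _ (fun mu : sradon R X => charge_integral mu f) m.
by apply: cvg_trans c; apply: cvg_app; exact: h'.
Qed.

Variables (X1 X2 : completelyRegularType).
Local Notation Y := (cone R X1 * cone R X2)%type.
Implicit Types (phi : Cb R X1 * Cb R X2) (mu : sradon R X1 * sradon R X2).

Lemma pairing_continuous phi : continuous (fun mu => pairing mu phi).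
Proof.
move=> mu; apply: cvgD.
  exact: (@continuous_comp _ _ _ (@fst (sradon R X1) (sradon R X2))
    (fun m : sradon R X1 => charge_integral m phi.1) mu cvg_fst (@charge_integral_continuous _ phi.1 mu.1)).
exact: (@continuous_comp _ _ _ (@snd (sradon R X1) (sradon R X2))
    (fun m : sradon R X2 => charge_integral m phi.2) mu cvg_snd (@charge_integral_continuous _ phi.2 mu.2)).
Qed.

Lemma pairing_conv (t : {i01 R}) mu nu phi :
  pairing (mu <| t |> nu) phi = (t%:num * pairing mu phi + (1 - t%:num) * pairing nu phi)%R.
Proof.
have t1 : (0 <= 1 - t%:num)%R by rewrite subr_ge0.
have E (X : completelyRegularType) (m n : sradon R X) (f : Cb R X) :
    charge_integral (m <| t |> n : sradon R X) f =
    (t%:num * charge_integral m f + (1 - t%:num) * charge_integral n f)%R.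
  by rewrite -!charge_integral_scale// -charge_integral_add.
by rewrite /pairing !E; ring.
Qed.

Lemma pairing_dirac (x1 : X1) (x2 : X2) (r1 r2 : {nonneg R}) phi :
  pairing (r1%:num *: sdirac x1, r2%:num *: sdirac x2)%R phi =
  (phi.1 x1 * r1%:num + phi.2 x2 * r2%:num)%R.
Proof.
have -> (m : sradon R X1) (n : sradon R X2) :
  pairing (m, n) phi = (charge_integral m phi.1 + charge_integral n phi.2)%R by [].
by rewrite !charge_integral_scale// !charge_integral_dirac; ring.
Qed.

Lemma nonneg_sradon_dirac (X : completelyRegularType) (x : X) (r : {nonneg R}) :
  nonneg_sradon (r%:num *: sdirac x : sradon R X)%R.
Proof.
apply: nonneg_sradonP => f f01; rewrite charge_integral_scale// charge_integral_dirac.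
by rewrite mulr_ge0//; have /andP[] := f01 x.
Qed.

Variable H : Y -> \bar R.
Hypothesis H_ge0 : forall p, 0 <= H p.

Lemma dual_lsc : lower_semicontinuous (dual H).
Proof.
apply/lower_semicontinuousP => a.
rewrite (_ : [set _ | _] = \bigcup_(phi in Phi H) [set mu | (a < pairing mu phi)%R]).
  apply: bigcup_open => phi _.
  apply: (@open_comp _ _ (fun mu => pairing mu phi) [set x | (a < x)%R]); last exact: open_gt.
  by move=> mu _; exact: pairing_continuous.
apply/seteqP; split => mu /=.
  by move=> /ereal_sup_gt[_ [phi Pphi <-]]; rewrite lte_fin => ?; exists phi.
move=> [phi Pphi /= h]; apply: (@lt_le_trans _ _ (pairing mu phi)%:E); first by rewrite lte_fin.
by apply: ereal_sup_ubound; exists phi.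
Qed.

Lemma dual_econvex : econvex (dual H).
Proof.
move=> t mu nu.
have t0 : 0 <= t%:num%:E by rewrite lee_fin.
have t1 : 0 <= (1 - t%:num)%:E by rewrite lee_fin subr_ge0.
rewrite ge0_daddE; [|exact: mule_ge0 (dual_ge0 H_ge0 _)|exact: mule_ge0 (dual_ge0 H_ge0 _)].
apply: ge_ereal_sup => _ [phi Pphi <-]; rewrite pairing_conv EFinD !EFinM.
by apply: leeD; apply: lee_wpmul2l => //; apply: ereal_sup_ubound; exists phi.
Qed.

(** A nonnegative test pair with negative pairing, multiplied by large negative
    constants, stays in [Phi H]. *)
Lemma dual_pinfty mu : ~ (nonneg_sradon mu.1 /\ nonneg_sradon mu.2) -> dual H mu = +oo.
Proof.
move=> nn.
have [phi [p1 p2 pneg]] : exists phi, [/\ forall x, (0 <= phi.1 x)%R,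
    forall x, (0 <= phi.2 x)%R & (pairing mu phi < 0)%R].
  apply: contrapT => nex; apply: nn; split; apply: nonneg_sradonP => f f01;
    rewrite leNgt; apply/negP => fneg; apply: nex.
    exists (f, Cb_cst X2 0); split => //=; first by move=> x; have /andP[] := f01 x.
    by rewrite /pairing/= charge_integral0 addr0.
  exists (Cb_cst X1 0, f); split => //=; first by move=> x; have /andP[] := f01 x.
  by rewrite /pairing/= charge_integral0 add0r.
apply/eqP; rewrite -leye_eq leNgt; apply/negP => fin.
have dE : dual H mu = (fine (dual H mu))%:E by rewrite fineK// ge0_fin_numE// dual_ge0.
pose t := ((fine (dual H mu) + 1) / - pairing mu phi)%R.
have pp : (0 < - pairing mu phi)%R by rewrite oppr_gt0.
have t0 : (0 <= t)%R by rewrite divr_ge0 ?(ltW pp)// addr_ge0// fine_ge0// dual_ge0.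
have : (pairing mu (Cb2_lin (- t) phi (Cb2_cst X1 X2 0)))%:E <= dual H mu.
  apply: ereal_sup_ubound; exists (Cb2_lin (- t) phi (Cb2_cst X1 X2 0)) => //.
  move=> x1 x2 r1 r2; apply: le_trans (H_ge0 _); rewrite lee_fin /= !addr0.
  by rewrite -oppr_ge0 opprD !mulNr !opprK addr_ge0// mulr_ge0// mulr_ge0.
rewrite pairing_lin dE lee_fin.
by rewrite pairing0 addr0 mulNr -mulrN /t divfK ?gt_eqF//; lra.
Qed.

Lemma calU_nonneg mu : nonneg_sradon mu.1 -> nonneg_sradon mu.2 ->
  calU H mu = ereal_inf [set \int[alpha]_p H p | alpha in hcoupling mu].
Proof. by move=> m1 m2; rewrite /calU asboolT. Qed.

Lemma dual_le_calU (mH : measurable_fun setT (H : borel Y -> \bar R)) mu :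
  nonneg_sradon mu.1 -> nonneg_sradon mu.2 -> dual H mu <= calU H mu.
Proof.
move=> m1 m2; rewrite calU_nonneg//; apply: le_ereal_inf_tmp => _ [alpha ca <-].
apply: ge_ereal_sup => _ [phi Pphi <-]; apply: (weak_duality H_ge0 mH m1 m2 ca).
exact/Phi_cone_sum.
Qed.

Hypothesis H_homogeneous : radially_1homogeneous H.
Hypothesis H_lsc : lower_semicontinuous H.

(** The optimal coupling attains the dual value. Unless both measures are
    nonnegative there is no coupling, and the supremum is infinite as well. *)
Lemma calU_dual mu : calU H mu = dual H mu.
Proof.
have [[m1 m2]|nn] := pselect (nonneg_sradon mu.1 /\ nonneg_sradon mu.2); last first.
  by rewrite dual_pinfty// /calU asboolF.
apply/eqP; rewrite eq_le dual_le_calU ?andbT//; last exact: lsc_borel_measurable.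
have [->|fin] := eqVneq (dual H mu) +oo; first by rewrite leey.
have fin' : dual H mu < +oo by rewrite ltey.
have [alpha ca [_ h]] := exists_optimal_coupling H_ge0 H_homogeneous H_lsc m1 m2 fin'.
rewrite calU_nonneg//; apply: le_trans h.
by apply: ereal_inf_lbound; exists alpha.
Qed.

End calU_dual.

(** * Approximation of integrals by finite sums *)

Section finite_approximation.
Local Open Scope ereal_scope.
Context d (T : measurableType d) (R : realType).
Variables (alpha : {finite_measure set T -> \bar R}) (h : T -> \bar R).
Variables (n : nat) (g : nat -> T -> R) (P : set T) (C eta : R).
Hypotheses (h0 : forall x, 0 <= h x) (mh : measurable_fun setT h).
Hypotheses (mP : measurable P) (eta0 : (0 < eta)%R).
Hypothesis ig : forall j, (j < n)%N -> alpha.-integrable setT (EFin \o g j).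
Hypothesis gC : forall j x, (j < n)%N -> P x -> (`|g j x| <= C)%R.

Definition has_approximation (B : set T) := exists s : seq ({posnum R} * T),
  [/\ forall wx, List.In wx s -> P wx.2,
    \sum_(wx <- s) wx.1%:num%:E * h wx.2 <= \int[alpha]_(x in B) h x + eta%:E * alpha B &
    forall j, (j < n)%N ->
      (`|\sum_(wx <- s) wx.1%:num * g j wx.2 - \int[alpha]_(x in B) g j x| <=
        eta * fine (alpha B))%R].

Let mg j : (j < n)%N -> measurable_fun setT (g j).
Proof. by move=> /ig /integrableP[/measurable_EFinP]. Qed.

Let igB j B : (j < n)%N -> measurable B -> alpha.-integrable B (EFin \o g j).
Proof. by move=> jn mB; apply: (integrableS measurableT mB (@subsetT _ _)); exact: ig. Qed.

Let has_approximationU B1 B2 : measurable B1 -> measurable B2 -> B1 `&` B2 = set0 ->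
  has_approximation B1 -> has_approximation B2 -> has_approximation (B1 `|` B2).
Proof.
move=> m1 m2 B12 [s1 [P1 h1 g1]] [s2 [P2 h2 g2]].
have dB : [disjoint B1 & B2] by apply/disj_setPS; rewrite B12.
exists (s1 ++ s2); split.
- by move=> wx /List.in_app_iff[/P1|/P2].
- rewrite big_cat/= ge0_integral_setU//; last exact: measurable_funTS.
  rewrite measureU// muleDr ?fin_num_adde_defl ?fin_num_measure//.
  by rewrite addeACA; exact: leeD.
- move=> j jn; rewrite big_cat/= Rintegral_setU//; last by apply: igB => //; exact: measurableU.
  rewrite measureU// fineD ?fin_num_measure// mulrDr opprD addrACA.
  by apply: (le_trans (ler_normD _ _)); apply: lerD; [exact: g1|exact: g2].
Qed.

Let has_approximation0 : has_approximation set0.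
Proof.
exists [::]; split => //; first by rewrite big_nil integral_set0 measure0 mule0 adde0.
by move=> j jn; rewrite big_nil Rintegral_set0 subrr normr0 measure0 mulr0.
Qed.

Let osc (f : T -> R) (B : set T) := forall x y, B x -> B y -> (f x - f y <= eta)%R.

(** On a set where all test functions oscillate by at most [eta], a single point
    suffices: one at which [h] does not exceed its average by more than [eta]. *)
Let has_approximation_osc B : measurable B -> B `<=` P ->
  (forall j, (j < n)%N -> osc (g j) B) -> has_approximation B.
Proof.
move=> mB BP oB; have [a0|a0] := eqVneq (alpha B) 0.
  exists [::]; split => //.
    by rewrite big_nil a0 mule0 adde0; exact: integral_ge0.
  move=> j jn; rewrite big_nil a0 mulr0 sub0r normrN /Rintegral.
  rewrite null_set_integral ?normr0//; apply/measurable_funTS/measurable_EFinP; exact: mg.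
have aE : alpha B = (fine (alpha B))%:E by rewrite fineK// fin_num_measure.
set a := fine (alpha B) in aE *.
have ap : (0 < a)%R by rewrite -lte_fin -aE lt_neqAle eq_sym a0 measure_ge0.
have [x Bx hx] : exists2 x, B x & a%:E * h x <= \int[alpha]_(x in B) h x + eta%:E * alpha B.
  apply: contrapT => /forall2NP hB.
  have lt_h x : B x -> \int[alpha]_(x in B) h x + eta%:E * alpha B < a%:E * h x.
    by move=> Bx; have [//|/negP] := hB x; rewrite -ltNge.
  have B0 : B !=set0 by apply/set0P/eqP => B0; move: a0; rewrite B0 measure0 eqxx.
  have [x0 Bx0] := B0.
  have Ifin : \int[alpha]_(x in B) h x \is a fin_num.
    rewrite ge0_fin_numE ?integral_ge0//; have := lt_h _ Bx0; rewrite aE -EFinM.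
    by case: (\int[alpha]_(x in B) h x) => [r| |]//=; rewrite ?ltry// => /lt_le_trans/(_ (leey _)); rewrite ltxx.
  have : (a^-1)%:E * (\int[alpha]_(x in B) h x + eta%:E * alpha B) * alpha B <=
      \int[alpha]_(x in B) h x.
    rewrite -(integral_cst alpha mB); apply: ge0_le_integral => //.
    - by move=> x Bx /=; rewrite mule_ge0// ?lee_fin ?invr_ge0 ?(ltW ap)// adde_ge0 ?integral_ge0// mule_ge0// lee_fin ltW.
    - exact: measurable_funTS.
    - move=> x Bx /=; rewrite -[h x]mul1e -(_ : (a^-1)%:E * a%:E = 1); last by rewrite -EFinM mulVf ?gt_eqF.
      by rewrite -muleA; apply: lee_wpmul2l; [rewrite lee_fin invr_ge0 ltW|exact/ltW/lt_h].
  rewrite -(fineK Ifin) aE; set I := fine _.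
  rewrite -[leLHS]/(((a^-1 * (I + eta * a)) * a)%R%:E) lee_fin.
  rewrite mulrAC mulVf ?gt_eqF// mul1r; have : (0 < eta * a)%R by exact: mulr_gt0.
  by lra.
exists [:: (PosNum ap, x)]; split.
- by move=> wx [<-|//] /=; exact: BP.
- by rewrite big_seq1.
- move=> j jn; rewrite big_seq1/=.
  have ic c : alpha.-integrable B (EFin \o cst c).
    apply: measurable_bounded_integrable => //; [|exact: bounded_cst].
    by rewrite -ge0_fin_numE// fin_num_measure.
  have le1 : (\int[alpha]_(y in B) g j y <= (g j x + eta) * a)%R.
    rewrite /a -(Rintegral_cst alpha mB); apply: le_Rintegral => //; [exact: igB|exact: ic|].
    by move=> y By; have := oB j jn y x By Bx; lra.
  have le2 : ((g j x - eta) * a <= \int[alpha]_(y in B) g j y)%R.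
    rewrite /a -(Rintegral_cst alpha mB); apply: le_Rintegral => //; [exact: ic|exact: igB|].
    by move=> y By; have := oB j jn x y Bx By; lra.
  rewrite mulrDl in le1; rewrite mulrBl in le2; rewrite mulrC ler_norml -/a.
  by apply/andP; split; lra.
Qed.

(** Slicing by the values of the test function of index [k], one slice of height
    [eta] at a time. *)
Let has_approximation_refine k N B : (k < n)%N -> measurable B -> B `<=` P ->
  (forall B', measurable B' -> B' `<=` B -> osc (g k) B' -> has_approximation B') ->
  (forall x, B x -> (- C <= g k x < - C + N%:R * eta)%R) -> has_approximation B.
Proof.
move=> kn; elim: N B => [|N IH] B mB BP hB gB.
  rewrite (_ : B = set0); first exact: has_approximation0.
  by rewrite -subset0 => x /gB; rewrite mul0r addr0 => /andP[/le_lt_trans/[apply]]; rewrite ltxx.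
pose A := [set x | (- C + N%:R * eta <= g k x)%R].
have mA : measurable A.
  rewrite (_ : A = ~` [set x | (C - N%:R * eta < - g k x)%R]).
    by apply/measurableC/measurable_superlevel/measurableT_comp => //; exact: mg.
  by apply/seteqP; split => x; rewrite /A /=; [move=> ? | move=> /negP]; rewrite -?leNgt; lra.
rewrite -(setIT B) -(setUv A) setIUr; apply: has_approximationU.
- exact: measurableI.
- by apply: measurableI => //; exact: measurableC.
- by rewrite setIACA setICr setI0.
- apply: hB; [exact: measurableI|by move=> x []|].
  move=> x y [Bx Ax] [By Ay]; have /andP[_] := gB _ Bx; move: Ay; rewrite /A/= -natr1 mulrDl mul1r.
  by lra.
- apply: IH; [by apply: measurableI => //; exact: measurableC|by move=> x [/BP]| |].
    by move=> B' mB' B'B; apply: hB => // x /B'B[].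
  by move=> x [/gB/andP[-> _] /negP]; rewrite /A/= -ltNge.
Qed.

(** The integral of [h] can only be approximated from above by choosing where to
    sample, as [h] need not be continuous; the bounded test functions are
    approximated on both sides. *)
Lemma finite_approximation : has_approximation P.
Proof.
suff H k B : (k <= n)%N -> measurable B -> B `<=` P ->
    (forall j, (k <= j < n)%N -> osc (g j) B) -> has_approximation B.
  by apply: (H n) => // j; rewrite leqNgt andNb.
elim: k B => [|k IH] B kn mB BP oB; first exact: has_approximation_osc.
apply: (@has_approximation_refine k (Num.Def.archi_bound ((2 * C + 1) / eta)%R)) => //.
  move=> B' mB' B'B o'; apply: IH => //; [exact: ltnW|exact: subset_trans BP|].
  move=> j /andP[]; rewrite leq_eqVlt => /predU1P[<- _//|kj jn] x y Bx By.
  by apply: (oB j) => //; [rewrite kj|exact: B'B|exact: B'B].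
move=> x Bx; have := gC kn (BP _ Bx); rewrite ler_norml => /andP[c1 c2]; rewrite c1/=.
have c0 : (0 <= (2 * C + 1) / eta)%R by rewrite divr_ge0 ?(ltW eta0)//; lra.
have := archi_boundP c0; rewrite ltr_pdivrMr//; lra.
Qed.

End finite_approximation.

(** * Convexity and 1-homogeneous bounds *)

Section epigraph.
Local Open Scope ereal_scope.
Local Open Scope convex_scope.
Variables (R : realType).

Lemma half_ge0 : (0 <= 2^-1 :> R)%R. Proof. by rewrite invr_ge0. Qed.

Lemma half_le1 : (2^-1 <= 1 :> R)%R. Proof. by rewrite invf_le1// ler1n. Qed.

Definition half : {i01 R} := Itv01 half_ge0 half_le1.

Definition double (l : {posnum R}) : {posnum R} := (2 * l%:num)%:pos%R.

(** The pairs [(a, c)] for which [F (l a) <= l c] for all [l > 0] form a convex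
    cone, which is how a bound by a 1-homogeneous function passes to sums. In a
    space where only convex combinations exist, [psi l s] stands for [l] times
    the sum of the entries of [s], and a sum is the midpoint of the doubles. *)
Lemma econvex_sum_le (T : convType R) (F : T -> \bar R) (I : Type) (c : I -> \bar R)
    (psi : {posnum R} -> seq I -> T) (s : seq I) :
  econvex F -> (forall x, 0 <= c x) ->
  (forall l x s', psi l (x :: s') = psi (double l) [:: x] <| half |> psi (double l) s') ->
  (forall l, F (psi l [::]) <= 0) ->
  (forall l x, List.In x s -> F (psi l [:: x]) <= l%:num%:E * c x) ->
  forall l, F (psi l s) <= l%:num%:E * \sum_(x <- s) c x.
Proof.
move=> cF c0 psiD psi0; elim: s => [|x s IH] psi1 l; first by rewrite big_nil mule0.
rewrite psiD big_cons ge0_muleDr//; last by apply: sume_ge0.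
apply: (le_trans (cF half _ _)).
have h2 : (1 - 2^-1 = 2^-1 :> R)%R by lra.
have hl (u v : \bar R) : 0 <= v -> u <= (double l)%:num%:E * v -> (2^-1)%:E * u <= l%:num%:E * v.
  move=> v0 uv; apply: (@le_trans _ _ ((2^-1)%:E * ((double l)%:num%:E * v))).
    by apply: lee_wpmul2l => //; rewrite lee_fin invr_ge0.
  by rewrite muleA -EFinM /= mulrA mulVf// mul1r.
rewrite /= h2 -ge0_daddE; [|by rewrite mule_ge0|by rewrite mule_ge0// sume_ge0].
apply: DualAddTheoryRealDomain.lee_dD.
  by apply: hl => //; apply: psi1; left.
by apply: hl; [exact: sume_ge0|apply: IH => l' y sy; apply: psi1; right].
Qed.

End epigraph.

(** * Approximation of couplings *)

Section weak_neighbourhoods.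
Local Open Scope ereal_scope.
Variables (R : realType) (X1 X2 : completelyRegularType).
Local Notation M := (sradon R X1 * sradon R X2)%type.
Local Notation Cb2 := (Cb R X1 * Cb R X2)%type.

Definition weak_box (mu : M) (i : seq Cb2 * R) : set M :=
  [set nu | forall j, (j < size i.1)%N ->
    (`|pairing nu (nth (Cb2_cst X1 X2 0) i.1 j) - pairing mu (nth (Cb2_cst X1 X2 0) i.1 j)| <= i.2)%R].

Lemma nbhs_weak_box (mu : M) (V : set M) : nbhs mu V ->
  exists2 i, (0 < i.2)%R & weak_box mu i `<=` V.
Proof.
move=> muV; pose F := filter_from [set i : seq Cb2 * R | (0 < i.2)%R] (weak_box mu).
have FF : Filter F.
  apply: filter_from_filter; first by exists ([::], 1%R); exact: ltr01.
  move=> [l e] [l' e'] /= e0 e0'; exists (l ++ l', Num.min e e'); first by rewrite /= lt_min e0.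
  move=> nu h; split => j /= jl.
    have := h j; rewrite /= nth_cat size_cat jl => /(_ (ltn_addr _ jl)) /le_trans; apply.
    by rewrite ge_min lexx.
  have := h (size l + j)%N; rewrite /= nth_cat size_cat ltn_add2l [(_ + j < _)%N]ltnNge leq_addr/= addKn.
  by move=> /(_ jl)/le_trans; apply; rewrite ge_min lexx orbT.
have cvg_comp_ (X : completelyRegularType) (pr : M -> sradon R X) (inj : Cb R X -> Cb2) :
    (forall nu f, pairing nu (inj f) = charge_integral (pr nu) f) -> pr @ F --> pr mu.
  move=> pE; apply/cvg_sup => f A /= [B [[W oW <-] Wm] BA].
  have [e e0 eW] : exists2 e : R, (0 < e)%R & ball (charge_integral (pr mu) f) e `<=` W.
    by have /nbhs_ballP[e e0 eW] := open_nbhs_nbhs (conj oW Wm); exists e.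
  exists ([:: inj f], (e / 2)%R); first by rewrite /= divr_gt0.
  move=> nu /(_ 0%N isT) /=; rewrite !pE => h; apply: BA; apply: eW.
  by rewrite /ball/= distrC (le_lt_trans h)// ltr_pdivrMr// ltr_pMr// ltr1n.
have c1 : fst @ F --> mu.1.
  apply: (cvg_comp_ X1 fst (fun f => (f, Cb_cst X2 0))) => nu f.
  by rewrite /pairing/= charge_integral0 addr0.
have c2 : snd @ F --> mu.2.
  apply: (cvg_comp_ X2 snd (fun f => (Cb_cst X1 0, f))) => nu f.
  by rewrite /pairing/= charge_integral0 add0r.
have [[A B] /= [mA mB] AB] := muV.
have [i i0 iV] : F V.
  apply: (@filterS _ F FF _ _ _ (@filterI _ F FF _ _ (c1 _ mA) (c2 _ mB))).
  by move=> nu [? ?]; rewrite (surjective_pairing nu); apply: AB; split.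
by exists i.
Qed.

End weak_neighbourhoods.

Section minorants.
Local Open Scope ereal_scope.
Local Open Scope convex_scope.
Variables (R : realType) (X1 X2 : completelyRegularType).
Local Notation Y := (cone R X1 * cone R X2)%type.
Local Notation M := (sradon R X1 * sradon R X2)%type.
Implicit Types (mu : M) (p : Y) (l : {posnum R}) (s : seq ({posnum R} * Y)).
Local Notation slice := (@slice R X1 X2).

Variable H : Y -> \bar R.
Hypothesis H_ge0 : forall p, 0 <= H p.
Hypothesis H_homogeneous : radially_1homogeneous H.
Hypothesis H_lsc : lower_semicontinuous H.
Hypothesis H_proper : proper_fun H.

Lemma H_scale p l (s1 s2 : {nonneg R}) : s1%:num = (l%:num * (rad p.1)%:num)%R ->
  s2%:num = (l%:num * (rad p.2)%:num)%R ->
  H (cpt (base p.1) s1, cpt (base p.2) s2) = l%:num%:E * H p.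
Proof.
move=> e1 e2; have := @H_homogeneous (base p.1) (base p.2) l (rad p.1) (rad p.2).
rewrite /radial_section/= !cptK -surjective_pairing => <-.
by congr (H (cpt _ _, cpt _ _)); apply/val_inj.
Qed.

(** Lower semicontinuity at the vertex, along the ray through a point where
    [H] is finite. *)
Lemma H_vertex : H (cpt point 0%:nng%R, cpt point 0%:nng%R) = 0.
Proof.
have [p Hp] := H_proper; set o := (X in H X).
apply/eqP; rewrite eq_le H_ge0 andbT leNgt; apply/negP => Ho.
have [a [a0 aH]] : exists a : R, (0 < a)%R /\ a%:E < H o.
  case HoE : (H o) Ho => [x| |]//; rewrite ?lte_fin => x0.
    by exists (x / 2)%R; rewrite lte_fin divr_gt0//; split => //; rewrite ltr_pdivrMr// ltr_pMr// ltr1n.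
  by exists 1%R; rewrite ltry.
have [V [[A B] /= [oA oB] AB] HV] := H_lsc aH.
have [e1 e10 hA] : exists2 e : R, (0 < e)%R & forall d, ((rad d)%:num < e)%R -> A d.
  by apply: (@nbhs_vertex R _ _ _ _).1 oA; rewrite rad_cpt.
have [e2 e20 hB] : exists2 e : R, (0 < e)%R & forall d, ((rad d)%:num < e)%R -> B d.
  by apply: (@nbhs_vertex R _ _ _ _).1 oB; rewrite rad_cpt.
have HpE : H p = (fine (H p))%:E by rewrite fineK// ge0_fin_numE// ltey.
pose K := (1 + (rad p.1)%:num / e1 + (rad p.2)%:num / e2 + fine (H p) / a)%R.
have fH : (0 <= fine (H p))%R by rewrite fine_ge0.
have q1 : (0 <= (rad p.1)%:num / e1)%R by rewrite divr_ge0// ltW.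
have q2 : (0 <= (rad p.2)%:num / e2)%R by rewrite divr_ge0// ltW.
have q3 : (0 <= fine (H p) / a)%R by rewrite divr_ge0// ltW.
have K0 : (0 < K^-1)%R by rewrite invr_gt0 /K; lra.
have Klt (x y : R) : (0 < y)%R -> (x / y < K)%R -> (K^-1 * x < y)%R.
  by move=> y0; rewrite ltr_pdivrMr// ltr_pdivrMl// /K; lra.
have s0 (r : {nonneg R}) : (0 <= K^-1 * r%:num)%R by rewrite mulr_ge0// ltW.
pose q : Y := (cpt (base p.1) (NngNum (s0 (rad p.1))), cpt (base p.2) (NngNum (s0 (rad p.2)))).
have : a%:E < H q.
  apply: HV; apply: AB; split; rewrite /q /=.
    by apply: hA; rewrite rad_cpt /=; apply: Klt => //; rewrite /K; lra.
  by apply: hB; rewrite rad_cpt /=; apply: Klt => //; rewrite /K; lra.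
rewrite /q (@H_scale p (PosNum K0))// HpE -EFinM lte_fin/=; apply/negP; rewrite -leNgt ltW//.
by apply: Klt => //; rewrite /K; lra.
Qed.

Lemma H_vertices x1 x2 (r1 r2 : {nonneg R}) : r1%:num = 0%R -> r2%:num = 0%R ->
  H (cpt x1 r1, cpt x2 r2) = 0.
Proof. by move=> r10 r20; rewrite !cpt0// H_vertex. Qed.

Definition dirac_sum l s : M :=
  (\sum_(wp <- s) (l%:num * (wp.1%:num * (rad wp.2.1)%:num)) *: sdirac (base wp.2.1),
   \sum_(wp <- s) (l%:num * (wp.1%:num * (rad wp.2.2)%:num)) *: sdirac (base wp.2.2))%R.

Lemma pairing_dirac_sum s phi l : pairing (dirac_sum l s) phi =
  (l%:num * \sum_(wp <- s) wp.1%:num * cone_sum phi wp.2)%R.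
Proof.
have E (X : completelyRegularType) (f : Cb R X) (r : Y -> {nonneg R}) (b : Y -> X) :
    charge_integral (\sum_(wp <- s) (l%:num * (wp.1%:num * (r wp.2)%:num)) *: sdirac (b wp.2)
      : sradon R X)%R f =
    (l%:num * \sum_(wp <- s) wp.1%:num * (f (b wp.2) * (r wp.2)%:num))%R.
  elim: s => [|wp s IH].
    rewrite !big_nil mulr0; have := @charge_integral_scale R X 0%R 0%R f (lexx _).
    by rewrite scale0r mul0r.
  rewrite !big_cons charge_integral_add IH charge_integral_scale// charge_integral_dirac.
  by ring.
have -> (m : sradon R X1) (n : sradon R X2) :
  pairing (m, n) phi = (charge_integral m phi.1 + charge_integral n phi.2)%R by [].
rewrite (E X1 phi.1 (fun p => rad p.1) (fun p => base p.1)).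
rewrite (E X2 phi.2 (fun p => rad p.2) (fun p => base p.2)).
by rewrite -mulrDr -big_split/=; congr (_ * _)%R; apply: eq_bigr => wp _; rewrite /cone_sum; ring.
Qed.

(** Sampling a coupling at finitely many points of [P] gives a pair of finite sums
    of Dirac masses which is weakly close to [mu], at no larger cost up to [e].
    The freedom in [P] serves couplings of Dirac masses, which must be sampled
    over a prescribed pair of base points. *)
Lemma coupling_approximation mu (P : set Y) (phis : seq (Cb R X1 * Cb R X2)) (e : R) alpha :
  nonneg_sradon mu.1 -> nonneg_sradon mu.2 -> hcoupling mu alpha ->
  measurable (P : set (borel Y)) -> P `<=` slice -> alpha (~` P) = 0 -> (0 < e)%R ->
  exists s, [/\ forall wp, List.In wp s -> P wp.2,
    \sum_(wp <- s) wp.1%:num%:E * H wp.2 <= \int[alpha]_p H p + e%:E &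
    weak_box mu (phis, e) (dirac_sum 1%:pos%R s)].
Proof.
move=> m1 m2 [_ _ h1 h2] mP PS aP e0.
pose c0 := Cb2_cst X1 X2 (0%R : R).
pose g j : Y -> R := cone_sum (nth c0 phis j).
have gint phi : alpha.-integrable setT (fun p => (cone_sum phi p)%:E) /\
    pairing mu phi = (\int[alpha]_p cone_sum phi p)%R.
  have [i1 E1] := marginal_integral phi.1 (@fst_cont R X1 X2) m1 h1.
  have [i2 E2] := marginal_integral phi.2 (@snd_cont R X1 X2) m2 h2.
  split; first exact: (integrableD measurableT i1 i2).
  by rewrite /pairing E1 E2 -RintegralD.
have [C Cb] : exists C : R, forall j p, (j < size phis)%N -> P p -> (`|g j p| <= C)%R.
  have bd (phi : Cb R X1 * Cb R X2) : exists C : R, (0 <= C)%R /\ forall p, slice p -> (`|cone_sum phi p| <= C)%R.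
    have [M1 [_ b1]] := Cb_bounded phi.1; have [M2 [_ b2]] := Cb_bounded phi.2.
    exists (`|M1| + 1 + (`|M2| + 1))%R; split; first by rewrite !addr_ge0.
    move=> p Sp; rewrite /cone_sum (le_trans (ler_normD _ _))// !normrM.
    have r1 : (`|(rad p.1)%:num| <= 1 :> R)%R by rewrite ger0_norm// -Sp lerDl.
    have r2 : (`|(rad p.2)%:num| <= 1 :> R)%R by rewrite ger0_norm// -Sp lerDr.
    have M1' : (M1 < `|M1| + 1)%R by rewrite (le_lt_trans (ler_norm _))// ltrDl.
    have M2' : (M2 < `|M2| + 1)%R by rewrite (le_lt_trans (ler_norm _))// ltrDl.
    apply: lerD; rewrite -[leRHS]mulr1 ler_pM//.
      exact: (b1 _ M1' (base p.1) I).
    exact: (b2 _ M2' (base p.2) I).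
  elim: phis @g => [|phi phis IH] g; first by exists 0%R.
  have [C CP] := IH; have [C' [C0' CP']] := bd phi.
  exists (Num.max C C') => -[|j] p jn Pp; rewrite le_max.
    by rewrite CP' ?orbT//; exact: PS.
  by rewrite [X in X || _](CP j).
have aT : (0 <= fine (alpha P))%R by rewrite fine_ge0.
pose eta := (e / (fine (alpha P) + 1))%R.
have eta0 : (0 < eta)%R by rewrite divr_gt0// ltr_wpDl.
have etaP : (eta * fine (alpha P) <= e)%R.
  by rewrite /eta mulrAC ler_pdivrMr ?ltr_wpDl// ler_pM2l// lerDl.
have mH := lsc_borel_measurable H_lsc.
have mCP : measurable (~` P : set (borel Y)) by exact: measurableC.
have [s [sP sH sg]] := @finite_approximation _ (borel Y) R alpha H (size phis) g P C eta
  H_ge0 mH mP eta0 (fun j _ => (gint _).1) Cb.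
exists s; split => //.
  apply: (le_trans sH); apply: leeD.
    by apply: ge0_subset_integral => //.
  by rewrite -(fineK (fin_num_measure alpha P mP)) -EFinM lee_fin.
move=> j jn /=; rewrite pairing_dirac_sum mul1r (gint _).2.
rewrite [X in (_ - X)%R](_ : _ = (\int[alpha]_(p in P) g j p)%R).
  exact: (le_trans (sg j jn)).
rewrite /Rintegral; congr fine.
rewrite (@negligible_integral _ _ _ alpha setT (~` P))//; first by rewrite setTD setCK.
exact: (gint _).1.
Qed.

End minorants.

(** * Maximality among convex lower semicontinuous minorants *)

Section maximality.
Local Open Scope ereal_scope.
Local Open Scope convex_scope.
Variables (R : realType) (X1 X2 : completelyRegularType).
Local Notation Y := (cone R X1 * cone R X2)%type.
Local Notation M := (sradon R X1 * sradon R X2)%type.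
Implicit Types (mu : M) (p : Y) (l : {posnum R}) (s : seq ({posnum R} * Y)).
Local Notation slice := (@slice R X1 X2).

Variable H : Y -> \bar R.
Hypothesis H_ge0 : forall p, 0 <= H p.
Hypothesis H_homogeneous : radially_1homogeneous H.
Hypothesis H_lsc : lower_semicontinuous H.
Hypothesis H_proper : proper_fun H.

Lemma dirac_sum_cons l (x : {posnum R} * Y) s :
  dirac_sum l (x :: s) = dirac_sum (double l) [:: x] <| half R |> dirac_sum (double l) s.
Proof.
have E (X : completelyRegularType) (c : {posnum R} * Y -> R) (d : {posnum R} * Y -> sradon R X) :
    (\sum_(wp <- x :: s) (l%:num * c wp) *: d wp =
     2^-1 *: (\sum_(wp <- [:: x]) (2 * l%:num * c wp) *: d wp) +
     (1 - 2^-1) *: (\sum_(wp <- s) (2 * l%:num * c wp) *: d wp))%R.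
  have h2 : (1 - 2^-1 = 2^-1 :> R)%R by lra.
  rewrite h2 !scaler_sumr !big_cons big_nil addr0; congr (_ + _)%R.
    by rewrite scalerA !mulrA mulVf// mul1r.
  by apply: eq_bigr => wp _; rewrite scalerA !mulrA mulVf// mul1r.
rewrite /dirac_sum; congr pair; exact: E.
Qed.

Lemma dirac_sum_le F l s : convex_lsc_minorant (calS H) F ->
  F (dirac_sum l s) <= l%:num%:E * \sum_(wp <- s) wp.1%:num%:E * H wp.2.
Proof.
move=> [cF _ FS]; apply: (econvex_sum_le (c := fun wp => wp.1%:num%:E * H wp.2) cF).
- by move=> wp; rewrite mule_ge0.
- exact: dirac_sum_cons.
- move=> {}l; apply: (le_trans (FS _)).
  rewrite -(H_vertices H_ge0 H_homogeneous H_lsc H_proper point point (r1 := 0%:nng%R) (r2 := 0%:nng%R) erefl erefl).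
  apply: ereal_inf_lbound.
  exists ((point, 0%:nng%R), (point, 0%:nng%R)) => //=.
  by rewrite /dirac_sum !big_nil !scale0r.
- move=> {}l [w p] _; apply: (le_trans (FS _)).
  have s0 (r : {nonneg R}) : (0 <= l%:num * (w%:num * r%:num))%R by [].
  rewrite /= muleA -EFinM.
  rewrite -(@H_scale _ _ _ _ H_homogeneous p (l%:num * w%:num)%:pos%R (NngNum (s0 (rad p.1))) (NngNum (s0 (rad p.2)))) /= ?mulrA//.
  apply: ereal_inf_lbound.
  exists ((base p.1, NngNum (s0 (rad p.1))), (base p.2, NngNum (s0 (rad p.2)))) => //=.
  by rewrite /dirac_sum !big_cons !big_nil !addr0.
Qed.

(** Near [mu] there are sums of Dirac masses at which [F] is at most the cost of
    the optimal coupling, up to [e]; lower semicontinuity carries the bound over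
    to [mu]. *)
Lemma minorant_le_calU F mu : convex_lsc_minorant (calS H) F -> F mu <= calU H mu.
Proof.
move=> mF; have [_ lF _] := mF.
have [fin|] := boolP (calU H mu < +oo); last by rewrite -leNgt leye_eq => /eqP ->; exact: leey.
have [m1 m2] : nonneg_sradon mu.1 /\ nonneg_sradon mu.2.
  by move: fin; rewrite /calU; case: asboolP.
rewrite (calU_dual H_ge0 H_homogeneous H_lsc) in fin *.
have [alpha ha [aS aH]] := exists_optimal_coupling H_ge0 H_homogeneous H_lsc m1 m2 fin.
apply/lee_addgt0Pr => e e0; rewrite leNgt; apply/negP => aF.
have cfin : dual H mu \is a fin_num by rewrite ge0_fin_numE ?dual_ge0.
rewrite -(fineK cfin) -EFinD in aF.
have [V muV VF] := lF _ _ aF.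
have [[phis d] /= d0 dV] := nbhs_weak_box muV.
have mS : measurable (slice : set (borel Y)).
  by rewrite -(setCK slice); apply: measurableC; apply: sub_sigma_algebra; exact: open_slice.
have ed0 : (0 < Num.min e d)%R by rewrite lt_min e0.
have [s [_ sH sB]] := coupling_approximation H_ge0 H_lsc phis m1 m2 ha mS (@subset_refl _ _) aS ed0.
have : (fine (dual H mu) + e)%:E < F (dirac_sum 1%:pos%R s).
  apply: VF; apply: dV => j jn; apply: (le_trans (sB j jn)).
  by rewrite /= ge_min lexx orbT.
apply/negP; rewrite -leNgt; apply: (le_trans (dirac_sum_le _ _ mF)).
rewrite mul1e (le_trans sH)// EFinD fineK//; apply: leeD => //.
by rewrite lee_fin ge_min lexx.
Qed.

End maximality.

(** * Couplings of Dirac masses *)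

Section dirac_marginal.
Local Open Scope ereal_scope.
Variables (R : realType) (Y : ptopologicalType) (X : completelyRegularType).
Variables (pr : Y -> cone R X) (alpha : {finite_measure set (borel Y) -> \bar R}).

Lemma measurable_away (x : X) : continuous pr ->
  measurable ([set p | (0 < (rad (pr p))%:num)%R /\ (~` [set x]) (base (pr p))] : set (borel Y)).
Proof.
move=> cpr; apply: measurable_above => //.
by apply: measurableC; apply: compact_borel; exact: compact_set1.
Qed.

(** The marginal [r *: sdirac x] gives no mass to the complement of [x], and the
    density of its preimage, the radius, is positive there. *)
Lemma dirac_marginal_null (x : X) (r : R) : continuous pr ->
  (forall A : set (borel X), measurable A ->
    (r *: sdirac x)%R A = \int[alpha]_(p in [set p | (0 < (rad (pr p))%:num)%R /\ A (base (pr p))])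
      (rad (pr p))%:num%:E) ->
  alpha [set p | (0 < (rad (pr p))%:num)%R /\ (~` [set x]) (base (pr p))] = 0.
Proof.
move=> cpr mE; have mB := measurable_away x cpr; set B : set (borel Y) := [set p | _] in mB *.
have mx : measurable (~` [set x] : set (borel X)).
  by apply: measurableC; apply: compact_borel; exact: compact_set1.
have mr : measurable_fun B ((fun p => (rad (pr p))%:num%:E) : borel Y -> \bar R).
  apply: measurable_funTS; apply/measurable_EFinP.
  by apply: continuous_real_measurable; exact: continuous_rad_pr.
have : \int[alpha]_(p in B) `|(rad (pr p))%:num%:E| = 0.
  under eq_integral do rewrite gee0_abs//.
  rewrite -(mE _ mx) sradonZE sdiracE// diracE memNset ?mule0//.
  by move=> /=; apply.
move/(ae_eq_integral_abs alpha mB mr) => [N [mN N0 BN]].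
apply: (subset_measure0 mB mN _ N0) => p Bp; apply: BN => /= h.
by have [p0 _] := Bp; have [/eqP] := h Bp; rewrite gt_eqF.
Qed.

End dirac_marginal.

Section section_minorants.
Local Open Scope ereal_scope.
Local Open Scope convex_scope.
Variables (R : realType) (X1 X2 : completelyRegularType).
Local Notation Y := (cone R X1 * cone R X2)%type.
Implicit Types (p : Y) (l : {posnum R}) (s : seq ({posnum R} * Y)).
Local Notation slice := (@slice R X1 X2).

Variable H : Y -> \bar R.
Hypothesis H_ge0 : forall p, 0 <= H p.
Hypothesis H_homogeneous : radially_1homogeneous H.
Hypothesis H_lsc : lower_semicontinuous H.
Hypothesis H_proper : proper_fun H.

Lemma radius_sum_ge0 (r : Y -> {nonneg R}) l s :
  (0 <= \sum_(wp <- s) l%:num * (wp.1%:num * (r wp.2)%:num))%R.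
Proof. by apply: sumr_ge0 => wp _. Qed.

Definition radius_sum l s : {nonneg R} * {nonneg R} :=
  (NngNum (radius_sum_ge0 (fun p => rad p.1) l s), NngNum (radius_sum_ge0 (fun p => rad p.2) l s)).

Lemma radius_sum_cons l (x : {posnum R} * Y) s :
  radius_sum l (x :: s) = radius_sum (double l) [:: x] <| half R |> radius_sum (double l) s.
Proof.
have E (c : {posnum R} * Y -> R) : (\sum_(wp <- x :: s) l%:num * c wp =
    2^-1 * (\sum_(wp <- [:: x]) 2 * l%:num * c wp) +
    (1 - 2^-1) * (\sum_(wp <- s) 2 * l%:num * c wp))%R.
  have h2 : (1 - 2^-1 = 2^-1 :> R)%R by lra.
  rewrite h2 !mulr_sumr !big_cons big_nil addr0; congr (_ + _)%R.
    by rewrite !mulrA mulVf// mul1r.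
  by apply: eq_bigr => wp _; rewrite !mulrA mulVf// mul1r.
by congr pair; apply/val_inj; exact: E.
Qed.

Definition over (x1 : X1) (x2 : X2) : set Y :=
  slice `&` [set p | ((rad p.1)%:num = 0%R \/ base p.1 = x1) /\ ((rad p.2)%:num = 0%R \/ base p.2 = x2)].

Lemma cpt_over (X : completelyRegularType) (x : X) (c : cone R X) (r : {nonneg R}) (l : R) :
  r%:num = (l * (rad c)%:num)%R -> (rad c)%:num = 0%R \/ base c = x ->
  cpt x r = cpt (base c) r.
Proof. by move=> rE [c0|<-//]; rewrite !cpt0// rE c0 mulr0. Qed.

Lemma radius_sum_le (x1 : X1) (x2 : X2) G l s :
  convex_lsc_minorant (radial_section H x1 x2) G ->
  (forall wp, List.In wp s -> over x1 x2 wp.2) ->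
  G (radius_sum l s) <= l%:num%:E * \sum_(wp <- s) wp.1%:num%:E * H wp.2.
Proof.
move=> [cG _ GH] sP; apply: (econvex_sum_le (c := fun wp => wp.1%:num%:E * H wp.2) cG).
- by move=> wp; rewrite mule_ge0.
- exact: radius_sum_cons.
- move=> {}l; apply: (le_trans (GH _)); rewrite /radial_section.
  by rewrite (H_vertices H_ge0 H_homogeneous H_lsc H_proper)//= big_nil.
- move=> {}l [w p] /sP [_ /= [p1 p2]]; apply: (le_trans (GH _)); rewrite /radial_section.
  have rE (r : Y -> {nonneg R}) : (\sum_(wp <- [:: (w, p)]) l%:num * (wp.1%:num * (r wp.2)%:num) =
      (l%:num * w%:num) * (r p)%:num)%R by rewrite big_cons big_nil addr0 mulrA.
  rewrite (@cpt_over X1 x1 p.1 (radius_sum l [:: (w, p)]).1 _ (rE (fun p => rad p.1)) p1).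
  rewrite (@cpt_over X2 x2 p.2 (radius_sum l [:: (w, p)]).2 _ (rE (fun p => rad p.2)) p2).
  rewrite (@H_scale _ _ _ _ H_homogeneous p (l%:num * w%:num)%:pos%R) /=.
  - by rewrite EFinM -muleA.
  - by rewrite big_cons big_nil addr0 mulrA.
  - by rewrite big_cons big_nil addr0 mulrA.
Qed.

Lemma nbhs_nonneg (r : {nonneg R}) (A : set {nonneg R}) : nbhs r A ->
  exists2 e : R, (0 < e)%R & forall t : {nonneg R}, (`|t%:num - r%:num| < e)%R -> A t.
Proof.
rewrite nbhsE => -[B [[W oW <-] Wr] BA].
have /nbhs_ballP[e e0 eW] := open_nbhs_nbhs (conj oW Wr).
by exists e => // t te; apply: BA; apply: eW; rewrite /ball/= distrC.
Qed.

(** A coupling of two Dirac masses lives over their base points, so sampling it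
    gives sums of radii in the section over these points. *)
Lemma section_minorant_le_calU (x1 : X1) (x2 : X2) G (r : {nonneg R} * {nonneg R}) :
  convex_lsc_minorant (radial_section H x1 x2) G ->
  G r <= calU H (r.1%:num *: sdirac x1, r.2%:num *: sdirac x2)%R.
Proof.
move=> mG; have [_ lG _] := mG; set mu := (X in calU H X).
have [fin|] := boolP (calU H mu < +oo); last by rewrite -leNgt leye_eq => /eqP ->; exact: leey.
have m1 : nonneg_sradon mu.1 by exact: nonneg_sradon_dirac.
have m2 : nonneg_sradon mu.2 by exact: nonneg_sradon_dirac.
rewrite (calU_dual H_ge0 H_homogeneous H_lsc) in fin *.
have [alpha ha [aS aH]] := exists_optimal_coupling H_ge0 H_homogeneous H_lsc m1 m2 fin.
apply/lee_addgt0Pr => e e0; rewrite leNgt; apply/negP => aG.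
have cfin : dual H mu \is a fin_num by rewrite ge0_fin_numE ?dual_ge0.
rewrite -(fineK cfin) -EFinD in aG.
have [V [[A B] /= [rA rB] AB] VG] := lG _ _ aG.
have [d1 d10 dA] := nbhs_nonneg rA; have [d2 d20 dB] := nbhs_nonneg rB.
pose N1 : set (borel Y) := [set p : Y | (0 < (rad p.1)%:num)%R /\ (~` [set x1]) (base p.1)].
pose N2 : set (borel Y) := [set p : Y | (0 < (rad p.2)%:num)%R /\ (~` [set x2]) (base p.2)].
have mN1 : measurable N1 := measurable_away x1 (@fst_cont R X1 X2).
have mN2 : measurable N2 := measurable_away x2 (@snd_cont R X1 X2).
have mS : measurable (~` slice : set (borel Y)) by apply: sub_sigma_algebra; exact: open_slice.
have PE : (over x1 x2 : set (borel Y)) = ~` (~` slice `|` N1 `|` N2).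
  have E (X : completelyRegularType) (x : X) (c : cone R X) :
      ((rad c)%:num = 0%R \/ base c = x) <-> ~ ((0 < (rad c)%:num)%R /\ base c <> x).
    rewrite rad_gt0; split=> [[->|->] []|/not_andP[/negP|/contrapT]]; rewrite ?eqxx//.
      by rewrite negbK => /eqP; left.
    by right.
  apply/seteqP; split=> p /=; rewrite /over/=.
    by move=> [Sp [/E n1 /E n2]] [[|]|].
  move=> /not_orP[/not_orP[/contrapT Sp n1] n2]; split => //; split; exact/E.
have mP : measurable (over x1 x2 : set (borel Y)).
  by rewrite PE; apply: measurableC; apply: measurableU => //; exact: measurableU.
have aP : alpha (~` (over x1 x2 : set (borel Y))) = 0.
  have [_ _ h1 h2] := ha.
  have n1 : alpha N1 = 0 := dirac_marginal_null (@fst_cont R X1 X2) h1.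
  have n2 : alpha N2 = 0 := dirac_marginal_null (@snd_cont R X1 X2) h2.
  have mSN : measurable (~` slice `|` N1 : set (borel Y)) by exact: measurableU.
  rewrite PE setCK measureU0//; rewrite measureU0//.
have d0 : (0 < Num.min e (Num.min d1 d2 / 2))%R by rewrite lt_min e0 divr_gt0// lt_min d10.
(* Tested with 1 on one factor and 0 on the other, a pair of measures shows its
   total masses: these are the radii. *)
pose phis := [:: (Cb_cst X1 1%R, Cb_cst X2 0%R); (Cb_cst X1 0%R, Cb_cst X2 1%R)] : seq (Cb R X1 * Cb R X2).
have [s [sP sH sB]] := coupling_approximation H_ge0 H_lsc phis m1 m2 ha mP (@subIsetl _ _ _) aP d0.
have : (fine (dual H mu) + e)%:E < G (radius_sum 1%:pos%R s).
  have dd (d : R) : (0 < d)%R -> (Num.min d1 d2 <= d)%R -> (Num.min e (Num.min d1 d2 / 2) < d)%R.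
    move=> d0' dd; rewrite gt_min; apply/orP; right.
    by rewrite ltr_pdivrMr//; apply: (le_lt_trans dd); lra.
  apply: VG; apply: AB; split => /=.
    apply: dA => /=; apply: le_lt_trans (dd _ d10 _); last by rewrite ge_min lexx.
    have := sB 0%N isT; rewrite /= pairing_dirac_sum pairing_dirac /cone_sum/=.
    rewrite mul1r mul1r mul0r addr0; congr (`| _ - _ | <= _)%R.
    by apply: eq_bigr => wp _; rewrite !mul1r mul0r addr0.
  apply: dB => /=; apply: le_lt_trans (dd _ d20 _); last by rewrite ge_min lexx orbT.
  have := sB 1%N isT; rewrite /= pairing_dirac_sum pairing_dirac /cone_sum/=.
  rewrite mul1r mul1r mul0r add0r; congr (`| _ - _ | <= _)%R.
  by apply: eq_bigr => wp _; rewrite !mul1r mul0r add0r.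
apply/negP; rewrite -leNgt; apply: (le_trans (radius_sum_le _ mG sP)).
rewrite mul1e (le_trans sH)// EFinD fineK//; apply: leeD => //.
by rewrite lee_fin ge_min lexx.
Qed.

End section_minorants.

(** * Envelopes *)

Section envelopes.
Local Open Scope ereal_scope.
Local Open Scope convex_scope.
Variables (R : realType) (X1 X2 : completelyRegularType).
Local Notation Y := (cone R X1 * cone R X2)%type.
Local Notation M := (sradon R X1 * sradon R X2)%type.
Local Notation diracs x1 x2 r := (r.1%:num *: sdirac x1, r.2%:num *: sdirac x2)%R.

Variable H : Y -> \bar R.
Hypothesis H_ge0 : forall p, 0 <= H p.
Hypothesis H_homogeneous : radially_1homogeneous H.
Hypothesis H_lsc : lower_semicontinuous H.
Hypothesis H_proper : proper_fun H.

Let calUE := calU_dual H_ge0 H_homogeneous H_lsc.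

Lemma calU_le_calS mu : calU H mu <= calS H mu.
Proof.
rewrite calUE; apply: le_ereal_inf_tmp => _ [[[x1 r1] [x2 r2]] /= -> <-].
by apply: ge_ereal_sup => _ [phi Pphi <-]; rewrite pairing_dirac; exact: Pphi.
Qed.

Lemma calU_minorant : convex_lsc_minorant (calS H) (calU H).
Proof.
rewrite (_ : calU H = dual H); last by apply/funext => mu; exact: calUE.
split; [exact: dual_econvex|exact: dual_lsc|].
by move=> mu; rewrite -calUE; exact: calU_le_calS.
Qed.

Lemma linear_minorant phi (x1 : X1) (x2 : X2) : Phi H phi ->
  convex_lsc_minorant (radial_section H x1 x2)
    (fun r => (phi.1 x1 * r.1%:num + phi.2 x2 * r.2%:num)%:E).
Proof.
move=> Pphi; split.
- by move=> t a b; rewrite /= -!EFinM -DualAddTheoryNumDomain.dEFinD lee_fin le_eqVlt; apply/orP; left; apply/eqP; ring.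
- apply/lower_semicontinuousP => a.
  apply: (@open_comp _ _ (fun r : {nonneg R} * {nonneg R} =>
    phi.1 x1 * r.1%:num + phi.2 x2 * r.2%:num)%R [set y | (a < y)%R]); last exact: open_gt.
  move=> r _; apply: cvgD; (apply: cvgM; first exact: cvg_cst).
    exact: (@continuous_comp _ _ _ fst (fun s : {nonneg R} => s%:num : R) r cvg_fst (@nonneg_num_continuous R _)).
  exact: (@continuous_comp _ _ _ snd (fun s : {nonneg R} => s%:num : R) r cvg_snd (@nonneg_num_continuous R _)).
- by move=> [r1 r2]; exact: Pphi.
Qed.

(** Test pairs restrict to linear minorants of the section, which gives one
    inequality; for the other, a general minorant is compared with couplings. *)
Lemma calU_diracs (x1 : X1) (x2 : X2) (r : {nonneg R} * {nonneg R}) :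
  calU H (diracs x1 x2 r) = lsc_convex_envelope (radial_section H x1 x2) r.
Proof.
apply/eqP; rewrite eq_le; apply/andP; split.
  rewrite calUE; apply: ge_ereal_sup => _ [phi Pphi <-]; rewrite pairing_dirac.
  apply: ereal_sup_ubound; exists (fun r => (phi.1 x1 * r.1%:num + phi.2 x2 * r.2%:num)%:E) => //.
  exact: linear_minorant.
apply: ge_ereal_sup => _ [G mG <-].
exact: section_minorant_le_calU.
Qed.

(** Independence of the base points chosen at the vertex is inherited from
    [calU], since a zero mass has no base point. *)
Lemma co_cone_cpt (x1 : X1) (x2 : X2) (r1 r2 : {nonneg R}) :
  co_cone H (cpt x1 r1, cpt x2 r2) = lsc_convex_envelope (radial_section H x1 x2) (r1, r2).
Proof.
rewrite /co_cone /= !rad_cpt -!calU_diracs /=.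
have E (X : completelyRegularType) (x : X) (r : {nonneg R}) :
    (r%:num *: sdirac (base (cpt x r : cone R X)) = r%:num *: sdirac x :> sradon R X)%R.
  by have [->|r0] := eqVneq r%:num 0%R; rewrite ?scale0r// base_cpt.
by rewrite !E.
Qed.

Lemma co_cone_le p : co_cone H p <= H p.
Proof.
rewrite (surjective_pairing p) -(cptK p.1) -(cptK p.2) co_cone_cpt.
by apply: ge_ereal_sup => _ [G [_ _ GH] <-]; exact: GH.
Qed.

Lemma co_cone_dual p : co_cone H p = ereal_sup [set (cone_sum phi p)%:E | phi in Phi H].
Proof.
rewrite {1}(surjective_pairing p) -{1}(cptK p.1) -{1}(cptK p.2) co_cone_cpt -calU_diracs calUE.
by congr ereal_sup; apply/seteqP; split => _ [phi Pphi <-]; exists phi => //; rewrite pairing_dirac.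
Qed.

(** The functions [cone_sum phi] are linear on sections, so they cannot separate
    [H] from its envelope. *)
Lemma Phi_co_cone : Phi (co_cone H) = Phi H.
Proof.
apply/seteqP; split=> phi /Phi_cone_sum h; apply/Phi_cone_sum => p.
  exact: le_trans (h p) (co_cone_le p).
by rewrite co_cone_dual; apply: ereal_sup_ubound; exists phi => //; apply/Phi_cone_sum.
Qed.

Lemma cone_sum_continuous (phi : Cb R X1 * Cb R X2) : continuous (cone_sum phi : Y -> R).
Proof.
have E (X : completelyRegularType) (f : Cb R X) := @rad_base_continuous R X f (@Cb_continuous _ _ f) (Cb_bounded f).
move=> p; apply: cvgD.
  exact: (@continuous_comp _ _ _ fst (fun c : cone R X1 => phi.1 (base c) * (rad c)%:num)%R p cvg_fst (E _ phi.1 _)).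
exact: (@continuous_comp _ _ _ snd (fun c : cone R X2 => phi.2 (base c) * (rad c)%:num)%R p cvg_snd (E _ phi.2 _)).
Qed.

Lemma co_cone_lsc : lower_semicontinuous (co_cone H).
Proof.
apply/lower_semicontinuousP => a.
rewrite (_ : [set _ | _] = \bigcup_(phi in Phi H) [set p | (a < cone_sum phi p)%R]).
  apply: bigcup_open => phi _.
  apply: (@open_comp _ _ (cone_sum phi) [set x | (a < x)%R]); last exact: open_gt.
  by move=> p _; exact: cone_sum_continuous.
apply/seteqP; split => p /=; rewrite co_cone_dual.
  by move=> /ereal_sup_gt[_ [phi Pphi <-]]; rewrite lte_fin => ?; exists phi.
move=> [phi Pphi /= h]; apply: (@lt_le_trans _ _ (cone_sum phi p)%:E); first by rewrite lte_fin.
by apply: ereal_sup_ubound; exists phi.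
Qed.

Lemma co_cone_ge0 p : 0 <= co_cone H p.
Proof.
rewrite co_cone_dual; apply: ereal_sup_ubound; exists (Cb2_cst X1 X2 0); first exact: Phi0.
by rewrite /cone_sum/= !mul0r addr0.
Qed.

Lemma calU_co_cone (mu : M) : nonneg_sradon mu.1 -> nonneg_sradon mu.2 ->
  calU H mu = calU (co_cone H) mu.
Proof.
move=> m1 m2; apply/eqP; rewrite eq_le; apply/andP; split.
  rewrite calUE /dual -Phi_co_cone; apply: dual_le_calU => //; first exact: co_cone_ge0.
  exact: lsc_borel_measurable co_cone_lsc.
rewrite !calU_nonneg//; apply: le_ereal_inf_tmp => _ [alpha ha <-].
apply: (@le_trans _ _ (\int[alpha]_p co_cone H p)); first by apply: ereal_inf_lbound; exists alpha.
apply: ge0_le_integral => //.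
- by move=> p _; exact: co_cone_ge0.
- exact: lsc_borel_measurable co_cone_lsc.
- exact: lsc_borel_measurable.
- by move=> p _; exact: co_cone_le.
Qed.

Lemma radial_section_lsc (x1 : X1) (x2 : X2) : lower_semicontinuous (radial_section H x1 x2).
Proof.
apply/lower_semicontinuousP => a.
apply: (@open_comp _ _ (fun r : {nonneg R} * {nonneg R} => (cpt x1 r.1, cpt x2 r.2) : Y) [set p | a%:E < H p]);
  last by have /lower_semicontinuousP := H_lsc; apply.
move=> r _.
have c1 : {for r, continuous (fun r : {nonneg R} * {nonneg R} => cpt x1 r.1 : cone R X1)}.
  exact: (@continuous_comp _ _ _ fst (fun s : {nonneg R} => cpt x1 s : cone R X1) r cvg_fst (@cpt_continuous R X1 x1 _)).
have c2 : {for r, continuous (fun r : {nonneg R} * {nonneg R} => cpt x2 r.2 : cone R X2)}.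
  exact: (@continuous_comp _ _ _ snd (fun s : {nonneg R} => cpt x2 s : cone R X2) r cvg_snd (@cpt_continuous R X2 x2 _)).
exact: (cvg_pair c1 c2).
Qed.

Lemma radially_convex_envelope (x1 : X1) (x2 : X2) r : radially_convex H ->
  lsc_convex_envelope (radial_section H x1 x2) r = radial_section H x1 x2 r.
Proof.
move=> cH; apply/eqP; rewrite eq_le; apply/andP; split.
  by apply: ge_ereal_sup => _ [G [_ _ GH] <-].
apply: ereal_sup_ubound; exists (radial_section H x1 x2) => //.
by split=> [||p]; [exact: cH|exact: radial_section_lsc|exact: lexx].
Qed.

Lemma calU_envelope (mu : M) : calU H mu = lsc_convex_envelope (calS H) mu.
Proof.
apply/eqP; rewrite eq_le; apply/andP; split.
  by apply: ereal_sup_ubound; exists (calU H) => //; exact: calU_minorant.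
by apply: ge_ereal_sup => _ [F mF <-]; exact: minorant_le_calU.
Qed.

Lemma calU_attained (mu : M) : nonneg_sradon mu.1 -> nonneg_sradon mu.2 ->
  calU H mu < +oo -> exists2 alpha, hcoupling mu alpha & calU H mu = \int[alpha]_p H p.
Proof.
move=> m1 m2 fin.
have fin' : dual H mu < +oo by rewrite -calUE.
have [alpha ha [_ aH]] := exists_optimal_coupling H_ge0 H_homogeneous H_lsc m1 m2 fin'.
exists alpha => //; apply/eqP; rewrite eq_le {2}calUE aH andbT calU_nonneg//.
by apply: ereal_inf_lbound; exists alpha.
Qed.

End envelopes.

Local Open Scope ereal_scope.

Theorem theorem1 (R : realType) (X1 X2 : completelyRegularType)
    (H : cone R X1 * cone R X2 -> \bar R)
    (H_ge0 : forall p, 0 <= H p) (H_proper : proper_fun H)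
    (H_homogeneous : radially_1homogeneous H)
    (H_lsc : lower_semicontinuous H) :
  [/\
    (* (1) *)
    forall mu : sradon R X1 * sradon R X2,
      nonneg_sradon mu.1 -> nonneg_sradon mu.2 -> calU H mu < +oo ->
      exists2 alpha, hcoupling mu alpha & calU H mu = \int[alpha]_p H p,
    (* (2) *)
    [/\ lower_semicontinuous (calU H), econvex (calU H),
      forall (x1 : X1) (x2 : X2) (r1 r2 : {nonneg R}),
        [/\ calU H (r1%:num *: sdirac x1, r2%:num *: sdirac x2)%R =
              co_cone H (cpt x1 r1, cpt x2 r2),
            co_cone H (cpt x1 r1, cpt x2 r2) =
              lsc_convex_envelope (radial_section H x1 x2) (r1, r2) &
            co_cone H (cpt x1 r1, cpt x2 r2) <= H (cpt x1 r1, cpt x2 r2)] &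
      radially_convex H ->
        forall (x1 : X1) (x2 : X2) (r1 r2 : {nonneg R}),
          calU H (r1%:num *: sdirac x1, r2%:num *: sdirac x2)%R =
          H (cpt x1 r1, cpt x2 r2)] &
    (* (3) *)
    [/\ convex_lsc_minorant (calS H) (calU H),
      forall F, convex_lsc_minorant (calS H) F -> forall mu, F mu <= calU H mu &
      forall mu : sradon R X1 * sradon R X2,
        nonneg_sradon mu.1 -> nonneg_sradon mu.2 ->
        [/\ calU H mu = calU (co_cone H) mu,
            calU H mu = lsc_convex_envelope (calS H) mu &
            calU H mu = ereal_sup
              [set (charge_integral mu.1 phi.1 +
                    charge_integral mu.2 phi.2)%:E | phi in Phi H]]]].
Proof.
split.
- by move=> mu m1 m2; exact: calU_attained.
- have [cU lU _] := calU_minorant H_ge0 H_homogeneous H_lsc.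
  split=> // [x1 x2 r1 r2|cH x1 x2 r1 r2].
    split; last exact: co_cone_le.
      by rewrite (co_cone_cpt H_ge0)// -(calU_diracs H_ge0).
    exact: co_cone_cpt.
  rewrite (calU_diracs H_ge0 H_homogeneous H_lsc H_proper x1 x2 (r1, r2)).
  exact: radially_convex_envelope.
- split; first exact: calU_minorant.
    by move=> F mF mu; exact: minorant_le_calU.
  move=> mu m1 m2; split; first exact: calU_co_cone.
    exact: calU_envelope.
  exact: calU_dual.
Qed.
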